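(* Consider the symmetric Toda flow $\dot M=[M,\pi_{\mathfrak{u}}(M)]$ on $n\times n$ real symmetric matrices $M$ with eigenvalues $\lambda_1>\cdots>\lambda_n$, where for all $1\le k\le n-1$ the $\binom nk$ numbers $\lambda^{(k)}_I:=\sum_{i\in I}\lambda_i$ ($I\in\binom{[n]}{k}$) are pairwise distinct. The tridiagonalization procedure $M\mapsto\big((M_{(k)})_T\big)_{1\le k\le n-1}$ of Deift, Li, Nanda, and Tomei of this flow is given as follows. By multiplying $M$ by $\mathrm{i}$ and applying, in turn, the twist map $\vartheta_\lambda$, the isomorphism $\mathcal{O}_\lambda\cong\mathrm{Fl}_n(\mathbb{C})$, and the Plücker embedding, we can embed the symmetric Toda flow as a gradient flow on the product of projective spaces $$\prod_{k=1}^{n-1}\mathbb{P}^{\binom nk-1}(\mathbb{R}).$$ For $(p_1,\dots,p_{n-1})\in\prod_{k=1}^{n-1}\mathbb{P}^{\binom nk-1}(\mathbb{R})$, we disregard the zero coordinates of every $p_k$ ($1\le k\le n-1$) and replace each nonzero coordinate of $p_k$ with its absolute value. Then applying Moser's map (to each of the $n-1$ resulting points, the coordinate indexed by $I\in\binom{[n]}{k}$ being associated with the eigenvalue $\lambda^{(k)}_I$) embeds the symmetric Toda flow into a family of $n-1$ tridiagonal Toda lattice flows.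
   Context: Here $\mathrm{i}=\sqrt{-1}$, $[n]=\{1,\dots,n\}$, $\binom{[n]}{k}$ is the set of $k$-element subsets of $[n]$, $\mathrm{Diag}(c)$ is the diagonal matrix with diagonal $c$, $\mathrm{U}_n$ is the unitary group, $[A,B]=AB-BA$. Toda flow: for an $m\times m$ matrix $N$, $\pi_{\mathfrak{u}}(N)$ is the unique skew-Hermitian matrix such that $N-\pi_{\mathfrak{u}}(N)$ is upper-triangular with real diagonal entries. The symmetric Toda flow on $m\times m$ symmetric matrices is $\dot N=[N,\pi_{\mathfrak{u}}(N)]$; restricted to tridiagonal matrices with positive entries immediately above and below the diagonal it is the (tridiagonal) Toda lattice flow. Orbits and flags: $\mathcal{O}_\lambda=\{g(\mathrm{i}\,\mathrm{Diag}(\lambda))g^{-1}:g\in\mathrm{U}_n\}$, so $\mathrm{i}M\in\mathcal{O}_\lambda$. $\mathrm{Fl}_n(\mathbb{C})=\mathrm{GL}_n(\mathbb{C})/\mathrm{B}_n(\mathbb{C})$ ($\mathrm{B}_n(\mathbb{C})$ = invertible upper-triangular matrices) is the variety of complete flags $(V_1,\dots,V_{n-1})$ in $\mathbb{C}^n$, the class of $g$ being the flag with $V_k$ the span of the first $k$ columns of $g$. The isomorphism $\mathcal{O}_\lambda\cong\mathrm{Fl}_n(\mathbb{C})$ sends $L$ to the flag with $V_k$ spanned by the eigenvectors of $L$ for the eigenvalues $\mathrm{i}\lambda_1,\dots,\mathrm{i}\lambda_k$; equivalently, $g(\mathrm{i}\,\mathrm{Diag}(\lambda))g^{-1}\mapsto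 g$ for $g\in\mathrm{U}_n$. For $|I|=k$, $\Delta_I(g)$ is the minor of $g$ in rows $I$ and columns $1,\dots,k$; the Plücker embedding is $\mathrm{Fl}_n(\mathbb{C})\hookrightarrow\prod_{k=1}^{n-1}\mathbb{P}^{\binom nk-1}(\mathbb{C})$, $g\mapsto\big(\Delta_I(g):I\in\binom{[n]}{k}\big)_{1\le k\le n-1}$. (For real symmetric $M$ the resulting point is real.) Twist map: for $w\in\mathfrak{S}_n$, let $\mathring w$ be the signed permutation matrix with nonzero entries $\pm1$ in positions $(w(j),j)$, signs chosen so that all $\Delta_I(\mathring w)\ge0$, and $\mathring X^w=\mathrm{B}_n(\mathbb{C})\cdot\mathring w\subseteq\mathrm{Fl}_n(\mathbb{C})$; these partition $\mathrm{Fl}_n(\mathbb{C})$. Let $\delta_n=\mathrm{Diag}(1,-1,\dots,(-1)^{n-1})$. Each $V\in\mathring X^w$ has a canonical representative $g\in\mathrm{U}_n$, such that for all $1\le k\le n$, $\Delta_{w([k])}(g)\in\mathbb{R}_{>0}$ and $\Delta_I(g)=0$ for all $I\in\binom{[n]}{k}$ lexicographically greater than $w([k])$. Then $\vartheta_\lambda:\mathcal{O}_\lambda\to\mathcal{O}_\lambda$ is defined by $\vartheta_\lambda(g(\mathrm{i}\,\mathrm{Diag}(\lambda))g^{-1})=\delta_ng^{-1}(\mathrm{i}\,\mathrm{Diag}(\lambda))g\delta_n$ for all canonical representatives $g$. Gradient flow on projective spaces: on the $k$th factor it has the form $\dot x_I=\lambda^{(k)}_Ix_I$ for all $I\in\binom{[n]}{k}$.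 Moser's map: for $\nu_1>\cdots>\nu_m$ and $x\in\mathbb{P}^{m-1}(\mathbb{R})$ with positive entries, Moser's map sends $x$ to the unique symmetric tridiagonal $m\times m$ matrix with eigenvalues $\nu_1,\dots,\nu_m$ and positive entries immediately above and below the diagonal such that $x=(v^{(1)}_1:\cdots:v^{(m)}_1)$, where $v^{(i)}$ is the unit eigenvector with eigenvalue $\nu_i$ whose first entry $v^{(i)}_1$ is positive. Under this map the flow $\dot x_i=\nu_ix_i$ corresponds to the Toda lattice flow. Tridiagonalization procedure: for a symmetric matrix $M$, let $m=\dim\,\mathrm{span}(M^je_1:j\ge0)$, let $A$ be the matrix obtained by Gram–Schmidt orthonormalization of the columns $e_1,Me_1,\dots,M^{m-1}e_1$, and put $M_T:=A^*MA$. The matrix $M_{(k)}$ is that of the operator $x_1\wedge\cdots\wedge x_k\mapsto\sum_{i=1}^kx_1\wedge\cdots\wedge Mx_i\wedge\cdots\wedge x_k$ on $\bigwedge^k\mathbb{C}^n$ in the basis $e_{i_1}\wedge\cdots\wedge e_{i_k}$ ($i_1<\cdots<i_k$) ordered lexicographically.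
   Formalization: The first ''embed'' is read as an injective map taking trajectories to trajectories (no continuity). The second ''embeds'' is not injective (n=2: changing the sign of the off-diagonal entry), so it is stated as: the tridiagonal matrices determine the projective points up to signs of coordinates. *)

(* Defs.v *)
From HB Require Import structures.
From mathcomp Require Import all_boot all_order all_algebra perm spectral.
From mathcomp Require Import complex.
From mathcomp Require Import boolp classical_sets reals topology normedtype derive.

Set Implicit Arguments.
Unset Strict Implicit.
Unset Printing Implicit Defensive.

Import Order.TTheory GRing.Theory Num.Theory numFieldNormedType.Exports.

Local Open Scope classical_set_scope.
Local Open Scope ring_scope.

(* The k-element subsets of 'I_n, as increasing k-tuples.  The family of all
   of them is indexed by 'I_('C(n, k)) in lexicographic order, so that a < b
   as indices means that the a-th subset is lexicographically smaller than the
   b-th one.  Indices of rows, columns and subsets start from 0. *)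

Definition lexle n k (s t : k.-tuple 'I_n) : bool :=
  @Order.le _ (seqlexi nat) (map val s) (map val t).

Definition ksubset_seq n k : seq (k.-tuple 'I_n) :=
  sort (@lexle n k)
       (enum [set t : k.-tuple 'I_n | sorted ltn (map val t)]%SET).

Lemma size_ksubset_seq n k : size (ksubset_seq n k) == 'C(n, k).
Proof. by rewrite size_sort -cardE card_ltn_sorted_tuples. Qed.

Definition ksub n k (a : 'I_('C(n, k))) : k.-tuple 'I_n :=
  tnth (Tuple (size_ksubset_seq n k)) a.

Definition ksum (R : nmodType) n (lam : 'I_n -> R) k (a : 'I_('C(n, k))) : R :=
  \sum_(i <- ksub a) lam i.

Section Exterior.
Variable K : comPzRingType.

(* x_1 /\ ... /\ x_k, where the x_s are the columns of X, in the basis of the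
   e_(i_1) /\ ... /\ e_(i_k), i_1 < ... < i_k, ordered lexicographically. *)
Definition wedge n k (X : 'M[K]_(n, k)) : 'cV[K]_('C(n, k)) :=
  \col_a \det (rowsub (tnth (ksub a)) X).

(* \sum_r x_1 /\ ... /\ M x_r /\ ... /\ x_k *)
Definition wedge_deriv n k (M : 'M[K]_n) (X : 'M[K]_(n, k)) :
    'cV[K]_('C(n, k)) :=
  \sum_(r < k)
     wedge (\matrix_(i < n, s < k) (if s == r then M *m X else X) i s).

Definition ext_mx n (M : 'M[K]_n) k : 'M[K]_('C(n, k)) :=
  \matrix_(a, b) wedge_deriv M (colsub (tnth (ksub b)) 1%:M) a 0.

(* For k <= n, g *m pid_mx k consists of the first k columns of g, so the
   entries are the minors Delta_I(g), #|I| = k. *)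
Definition minors n k (g : 'M[K]_n) : 'cV[K]_('C(n, k)) :=
  wedge (g *m (pid_mx k : 'M_(n, k))).

End Exterior.

Section Toda.
Variable R : realType.

Definition cplx m n (A : 'M[R]_(m, n)) : 'M[R[i]]_(m, n) :=
  map_mx (real_complex R) A.

Definition pi_u m (N : 'M[R]_m) : 'M[R]_m :=
  \matrix_(i, j) (if (j < i)%N then N i j
                  else if (i < j)%N then - N j i else 0).

Lemma pi_uP m (N : 'M[R]_m) (A : 'M[R[i]]_m) :
  [/\ (forall i j, (A j i)^* = - A i j),
      (forall i j : 'I_m, (j < i)%N -> (cplx N - A) i j = 0) &
      (forall i, (cplx N - A) i i \is Num.real)]
  <-> A = cplx (pi_u N).
Proof.
have realC (x : R) : x%:C%C \is Num.real by rewrite complex_real.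
have conjR (x : R) : (x%:C%C)^* = x%:C%C by apply: CrealP.
split=> [[sk up rl]|->].
  have low (i j : 'I_m) : (j < i)%N -> A i j = (N i j)%:C%C.
    by move=> ji; move/eqP: (up i j ji); rewrite !mxE subr_eq0 => /eqP.
  apply/matrixP=> i j; rewrite !mxE; case: ifP => [/low//|ji].
  case: ifP => [ij|ij].
    by rewrite -[A i j]opprK -sk (low _ _ ij) conjR rmorphN.
  have -> : j = i by apply/val_inj; case: ltngtP ji ij.
  have /CrealP : A i i \is Num.real.
    have := rl i; rewrite !mxE => /(rpredB (realC (N i i))).
    by rewrite opprB addrCA subrr addr0.
  rewrite sk => /eqP; rewrite eq_sym -addr_eq0 -mulr2n mulrn_eq0 /=.
  by move/eqP->; rewrite rmorph0.
split=> [i j|i j ji|i]; rewrite !mxE.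
- by rewrite conjR -rmorphN; case: ltngtP => _; rewrite ?opprK ?oppr0.
- by rewrite ji subrr.
- by rewrite ltnn rmorph0 subr0.
Qed.

Definition toda_curve m (J : set R) (M : R -> 'M[R]_m) : Prop :=
  forall t, J t -> forall i j,
    is_derive t (1 : R) (fun s => M s i j)
      ((M t *m pi_u (M t) - pi_u (M t) *m M t) i j).

Definition sym_with_eigenvalues m (nu : 'I_m -> R) (M : 'M[R]_m) : Prop :=
  M^T = M /\ forall a, eigenvalue M a <-> exists i, a = nu i.

Section Orbit.
Variables (n : nat) (lam : 'I_n -> R).

Definition ilam : 'M[R[i]]_n := 'i *: cplx (diag_mx (\row_j lam j)).

Definition orbit_pt (g : 'M[R[i]]_n) : 'M[R[i]]_n := g *m ilam *m invmx g.

Definition borel (b : 'M[R[i]]_n) : Prop :=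
  b \in unitmx /\ forall i j : 'I_n, (j < i)%N -> b i j = 0.

(* The signs of the entries of the representing permutation matrix are
   immaterial here, since borel contains the diagonal sign matrices. *)
Definition schubert_cell (w : {perm 'I_n}) (g : 'M[R[i]]_n) : Prop :=
  exists b c, [/\ borel b, borel c &
    g = b *m (\matrix_(i, j) (i == w j)%:R) *m c].

Definition canonical_rep (g : 'M[R[i]]_n) : Prop :=
  g \is unitarymx /\ exists w, schubert_cell w g /\
    forall k, (0 < k <= n)%N -> forall a : 'I_('C(n, k)),
      [set i in ksub a]%SET = [set w j | j : 'I_n & (j < k)%N]%SET ->
      0 < minors k g a 0 /\
      forall b : 'I_('C(n, k)), (a < b)%N -> minors k g b 0 = 0.

Definition altsign_mx : 'M[R[i]]_n := diag_mx (\row_j (-1) ^+ j).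

Definition twist (L : 'M[R[i]]_n) : 'M[R[i]]_n :=
  let g := xget 1%:M [set g | canonical_rep g /\ L = orbit_pt g] in
  altsign_mx *m invmx g *m ilam *m g *m altsign_mx.

(* A flag is a left coset of the Borel subgroup. *)
Definition orbit_flag (L : 'M[R[i]]_n) : set 'M[R[i]]_n :=
  [set h | exists g b,
     [/\ g \is unitarymx, L = orbit_pt g, borel b & h = g *m b]].

(* A point of a projective space is represented by the set of all its vectors
   of homogeneous coordinates. *)
Definition plucker (F : set 'M[R[i]]_n) k : set 'cV[R[i]]_('C(n, k)) :=
  [set x | exists g c, [/\ F g, c != 0 & x = c *: minors k g]].

Definition toda_point (M : 'M[R]_n) k : set 'cV[R]_('C(n, k)) :=
  [set x | plucker (orbit_flag (twist ('i *: cplx M))) (cplx x)].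

End Orbit.

Definition proj_point N (P : set 'cV[R]_N) : Prop :=
  exists2 x, x != 0 & P = [set y | exists2 c : R, c != 0 & y = c *: x].

Definition basis1 N : 'cV[R]_N := \col_i (i == 0 :> nat)%:R.

Definition dot N (u v : 'cV[R]_N) : R := (u^T *m v) 0 0.

Definition jacobi m (T : 'M[R]_m) : Prop :=
  T^T = T /\ forall i j : 'I_m,
    ((i.+1 < j)%N -> T i j = 0) /\ (j = i.+1 :> nat -> 0 < T i j).

Definition moser_spec m (nu x : 'I_m -> R) (T : 'M[R]_m) : Prop :=
  jacobi T /\ sym_with_eigenvalues nu T /\
  exists v : 'I_m -> 'cV[R]_m,
    (forall i, [/\ T *m v i = nu i *: v i, dot (v i) (v i) = 1 &
                   0 < dot (basis1 m) (v i)]) /\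
    exists2 c : R, c != 0 & forall i, x i = c * dot (basis1 m) (v i).

Definition is_moser m (nu x : 'I_m -> R) (T : 'M[R]_m) : Prop :=
  moser_spec nu x T /\ forall T', moser_spec nu x T' -> T' = T.

(* Square matrices of unspecified size. *)
Definition sqmx := {m : nat & 'M[R]_m}.
Definition Sqmx m (T : 'M[R]_m) : sqmx := Tagged (fun m => 'M[R]_m) T.

(* The positions of the nonzero coordinates of x, by decreasing mu. *)
Definition support_by N (mu : 'I_N -> R) (x : 'cV[R]_N) : seq 'I_N :=
  sort (fun a b => mu b <= mu a) [seq a <- enum 'I_N | x a 0 != 0].

Definition is_moser_abs N (mu : 'I_N -> R) (x : 'cV[R]_N) (S : sqmx) : Prop :=
  let s := tnth (in_tuple (support_by mu x)) in
  exists2 T, S = Sqmx T & is_moser (mu \o s) (fun i => `|x (s i) 0|) T.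

Definition krylov N (M : 'M[R]_N) j : 'cV[R]_N := iter j (mulmx M) (basis1 N).

Definition krylov_mx N (M : 'M[R]_N) : 'M[R]_N :=
  \matrix_(j < N) (krylov M j)^T.

(* The first N vectors M^j e_1 already span. *)
Lemma krylov_sub N (M : 'M[R]_N) j : ((krylov M j)^T <= krylov_mx M)%MS.
Proof.
case: N M => [|n] M; first by rewrite [X in (X <= _)%MS]thinmx0 sub0mx.
have krE i : krylov M i = M ^+ i *m basis1 n.+1.
  by elim: i => [|i IH] /=; rewrite ?mul1mx // IH exprS -mulmxA.
have := horner_mx_mem M 'X^j; rewrite rmorphXn /= horner_mx_X.
case/submxP=> c /(congr1 (fun u => vec_mx u)); rewrite mxvecK => Mj.
rewrite krE Mj mulmx_sum_row linear_sum /= mulmx_suml linear_sum /=.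
apply: summx_sub => i _; rewrite linearZ /= rowK mxvecK -scalemxAl linearZ /=.
apply: scalemx_sub; rewrite -krE.
have lin : (i < n.+1)%N.
  apply: leq_trans (ltn_ord i) _.
  have := size_mxminpoly M => sz.
  have := dvdp_leq (monic_neq0 (char_poly_monic M)) (mxminpoly_dvd_char M).
  by rewrite sz size_char_poly.
by have := row_sub (Ordinal lin) (krylov_mx M); rewrite rowK.
Qed.

Definition krylov_dim N (M : 'M[R]_N) : nat := \rank (krylov_mx M).

Definition gram_schmidt N (s : seq 'cV[R]_N) : seq 'cV[R]_N :=
  foldl (fun q v => let u := v - \sum_(a <- q) dot a v *: a in
                    rcons q ((Num.sqrt (dot u u))^-1 *: u)) [::] s.

Definition tridiag N (M : 'M[R]_N) : sqmx :=
  let m := krylov_dim M in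
  let A : 'M[R]_(N, m) :=
    \matrix_(i, j) (nth 0 (gram_schmidt (mkseq (krylov M) m)) j) i 0 in
  Sqmx (A^T *m M *m A).

End Toda.

(* Main.v *)
(* The canonical representative g of iM is real orthogonal, with M g = g Diag(lam),
   so the k-th projective point of M has coordinates +-Delta_([k], I)(g).  By the
   Cauchy-Binet formula the k-th compound of g is orthogonal and diagonalizes M_(k);
   up to sign, its first row is the projective point.  Tridiagonalization started
   at e_1 depends only on the eigenvalues and on the absolute values of these first
   entries, and inverts the spectral map, so it is Moser's map.

   Along the flow g(t) = Y(t) g(0) exp(-t Diag(lam)) with Y upper triangular with
   positive diagonal, hence g(t) remains canonical, in the same cell.  As g is
   orthogonal, g(t)^T = exp(t Diag(lam)) g(0)^T Y(t)^-1, which multiplies the minor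
   indexed by I by exp(t lam_I) and a factor independent of I.  On the tridiagonal
   side, the Krylov matrix of this exponential curve has a QR factorization whose
   orthogonal factor W satisfies W^T W' = pi_u(T).

   Injectivity: the minors determine the flag of g^T, hence g up to the signs of its
   rows, and these are fixed by the positivity in the definition of canonical
   representatives. *)
Require Import Defs.
From HB Require Import structures.
From mathcomp Require Import all_boot all_order all_algebra perm spectral.
From mathcomp Require Import complex.
From mathcomp Require Import boolp classical_sets reals topology normedtype derive.
From mathcomp Require Import functions ereal sequences realfun exp.
From mathcomp Require measure lebesgue_measure lebesgue_integral ftc.

Set Implicit Arguments.
Unset Strict Implicit.
Unset Printing Implicit Defensive.

Import Order.TTheory GRing.Theory Num.Theory numFieldNormedType.Exports.

Local Open Scope ring_scope.

(** * k-subsets in lexicographic order *)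

(** Tridiagonalization is studied in spectral coordinates: the Krylov vector of order j becomes the
    vector of values [nu i ^+ j * f i], where f lists the absolute values of the nonzero first
    entries of the eigenvectors. Gram-Schmidt then produces the orthonormal polynomials of the
    measure with weights [f i ^+ 2] at the nodes [nu i], and the tridiagonal matrix is
    multiplication by X in this basis, so that tridiagonality and positivity become statements about
    degrees and leading coefficients. An eigenvector orthogonal to e_1 never meets the Krylov space,
    which is why zero coordinates are deleted.

    Along the flow the curve M is given, so M - pi_u M is a known upper triangular coefficient and
    the equation for Y is linear. Existence and uniqueness follow row by row from the bottom, with
    integrating factors; the diagonal entries of Y are exponentials, hence positive.

    The twist is defined through a choice of canonical representative. That choice is controlled by
    one fact: compounds of triangular matrices are triangular for the lexicographic order, so
    triangular factors do not move the last nonzero minor. *)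

Lemma mem_ksubset n k (t : k.-tuple 'I_n) :
  (t \in ksubset_seq n k) = sorted ltn (map val t).
Proof. by rewrite mem_sort mem_enum inE. Qed.

Lemma ksub_sorted n k (a : 'I_('C(n, k))) : sorted ltn (map val (ksub a)).
Proof. by rewrite -mem_ksubset /ksub mem_tnth. Qed.

Lemma ksub_inj n k : injective (@ksub n k).
Proof.
move=> a b; rewrite /ksub => /(tuple_uniqP (Tuple (size_ksubset_seq n k)) _).
by apply; rewrite /= sort_uniq enum_uniq.
Qed.

Lemma ksub_surj n k (t : k.-tuple 'I_n) :
  sorted ltn (map val t) -> exists a, ksub a = t.
Proof.
rewrite -mem_ksubset => t_in.
have /tnthP[a ->] : t \in Tuple (size_ksubset_seq n k) by [].
by exists a.
Qed.

Lemma ksub_uniq n k (a : 'I_('C(n, k))) : uniq (ksub a).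
Proof.
have := ksub_sorted a => /(sorted_uniq ltn_trans ltnn).
by rewrite map_inj_uniq //; apply: val_inj.
Qed.

Lemma tnth_ksub_inj n k (a : 'I_('C(n, k))) : injective (tnth (ksub a)).
Proof. exact/tuple_uniqP/ksub_uniq. Qed.

Lemma ksub_mono n k (a : 'I_('C(n, k))) (i j : 'I_k) :
  (tnth (ksub a) i < tnth (ksub a) j)%N = (i < j)%N.
Proof.
have nthE (s : 'I_k) : nth 0%N (map val (ksub a)) s = tnth (ksub a) s.
  have s_lt : (s < size (ksub a))%N by rewrite size_tuple.
  by rewrite (nth_map (tnth (ksub a) s)) // -tnth_nth.
have lt_mono (p q : 'I_k) : (p < q)%N -> (tnth (ksub a) p < tnth (ksub a) q)%N.
  move=> pq; rewrite -!nthE; apply: (sorted_ltn_nth ltn_trans) => //.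
  - exact: ksub_sorted.
  - by rewrite inE size_map size_tuple.
  - by rewrite inE size_map size_tuple.
have [/lt_mono//|ji|/val_inj->] := ltngtP i j; last by rewrite ltnn.
by apply/negbTE; rewrite -leqNgt ltnW // lt_mono.
Qed.

Lemma ksub_le n k (a : 'I_('C(n, k))) (i j : 'I_k) :
  (tnth (ksub a) i <= tnth (ksub a) j)%N = (i <= j)%N.
Proof. by rewrite leqNgt ksub_mono -leqNgt. Qed.

Lemma ksub_set_inj n k (a b : 'I_('C(n, k))) : ksub a =i ksub b -> a = b.
Proof.
move=> ab; apply/ksub_inj/val_inj/(inj_map val_inj).
apply: (irr_sorted_eq ltn_trans ltnn); rewrite ?ksub_sorted // => x.
by apply/mapP/mapP => -[y yin ->]; exists y; rewrite // ?ab // -ab.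
Qed.

(** Sorting the values of [f] gives the subset, and [s] records the sorting. This is how ordered
    choices of rows are collected into subsets, at the cost of a sign. *)
Lemma ksub_perm n k (f : 'I_k -> 'I_n) : injective f ->
  exists a (s : {perm 'I_k}), f =1 tnth (ksub a) \o s.
Proof.
move=> f_inj; pose u := mktuple f.
have u_uniq : uniq u by rewrite map_inj_uniq ?enum_uniq.
have sz_t : size (sort (fun i j : 'I_n => (i <= j)%N) u) == k.
  by rewrite size_sort size_tuple.
have le_total : total (fun i j : 'I_n => (i <= j)%N) by move=> i j; exact: leq_total.
have [a aE] : exists a, ksub a = Tuple sz_t.
  apply: ksub_surj => /=.
  rewrite ltn_sorted_uniq_leq map_inj_uniq ?sort_uniq ?u_uniq; last exact: val_inj.
  by rewrite sorted_map; apply: sort_sorted.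
have fin i : exists j, tnth (ksub a) j == f i.
  have : f i \in ksub a by rewrite aE memtE /= mem_sort; apply/mapP; exists i; rewrite ?mem_enum.
  by case/tnthP=> j ->; exists j.
pose h i := xchoose (fin i).
have hE i : tnth (ksub a) (h i) = f i by apply/eqP/(xchooseP (fin i)).
have h_inj : injective h by move=> i j /(congr1 (tnth (ksub a))); rewrite !hE => /f_inj.
by exists a, (perm h_inj) => i /=; rewrite permE hE.
Qed.

(** The only form in which the lexicographic enumeration is used afterwards. *)
Lemma ksub_lex n k (a b : 'I_('C(n, k))) : (a < b)%N ->
  exists p : 'I_k, (forall i : 'I_k, (i < p)%N -> tnth (ksub a) i = tnth (ksub b) i) /\
    (tnth (ksub a) p < tnth (ksub b) p)%N.
Proof.
move=> ab.
have le_ab : lexle (ksub a) (ksub b).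
  have lexle_trans : transitive (@lexle n k).
    by move=> y x z; rewrite /lexle; apply: le_trans.
  have lexle_total : total (@lexle n k) by move=> x y; rewrite /lexle; apply: le_total.
  rewrite /ksub !(tnth_nth (ksub a)) /=.
  apply: (sorted_ltn_nth lexle_trans) => //; rewrite ?inE ?(eqP (size_ksubset_seq n k)) //.
  exact: sort_sorted.
have ne_ab : [exists p : 'I_k, tnth (ksub a) p != tnth (ksub b) p].
  apply: contraTT ab => /existsPn eq_ab; suff -> : a = b by rewrite ltnn.
  by apply/ksub_inj/eq_from_tnth => i; apply/eqP; have := eq_ab i; rewrite negbK.
case/existsP: ne_ab => p0 p0P.
case: (arg_minnP (P := [pred p | tnth (ksub a) p != tnth (ksub b) p]) (fun p : 'I_k => val p) p0P).
move=> p /= pP p_min; exists p.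
have eq_lt (i : 'I_k) : (i < p)%N -> tnth (ksub a) i = tnth (ksub b) i.
  by move=> ip; apply/eqP; apply: contraTT ip => /p_min; rewrite -leqNgt.
split=> //; move: pP; rewrite -(inj_eq val_inj) /= => pP.
rewrite ltn_neqAle pP /=; clear p_min p0 p0P ab pP.
move: le_ab eq_lt; rewrite /lexle; move: (ksub a) (ksub b) p.
(* If p is the first position, the comparison of heads is the claim; otherwise the heads agree and
   the comparison passes to the tails. *)
elim: k {a b} => [s t [] //|k IH].
case/tupleP=> x s /tupleP[y t] p /=.
rewrite lexi_cons => /andP[xy sub_st] eq_lt.
case: (unliftP ord0 p) eq_lt => [q ->|-> _]; last by rewrite !tnth0.
move=> eq_lt; rewrite !tnthS; apply: IH => [|i iq].
  have := eq_lt ord0 isT; rewrite !tnth0 => xyE.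
  by move: sub_st; rewrite xyE lexx.
by have := eq_lt (lift ord0 i) iq; rewrite !tnthS.
Qed.

Lemma ksub_bin_gt0 n k (a : 'I_('C(n, k))) : (k <= n)%N.
Proof. by case: a => a a_lt; rewrite leqNgt; apply/negP => /bin_small kn; rewrite kn in a_lt. Qed.

(** The entries of an increasing tuple are at least their positions, so nothing precedes the initial
    segment lexicographically. *)
Lemma ksub0 n k (a : 'I_('C(n, k))) : (a = 0 :> nat) ->
  forall i : 'I_k, tnth (ksub a) i = i :> nat.
Proof.
move=> a0 i; have kn := ksub_bin_gt0 a.
have [b bE] : exists b : 'I_('C(n, k)), ksub b = mktuple (widen_ord kn).
  by apply: ksub_surj; rewrite /= -map_comp (eq_map (g := val)) // val_enum_ord iota_ltn_sorted.
have b0 : b = 0 :> nat.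
  apply/eqP; rewrite -leqn0 leqNgt; apply/negP => b_gt0.
  have ab : (a < b)%N by rewrite a0.
  have [p [eq_p lt_p]] := ksub_lex ab.
  move: lt_p; rewrite bE tnth_mktuple /=; apply/negP; rewrite -leqNgt.
  have : forall p : 'I_k, (p <= tnth (ksub a) p)%N.
    case=> q qk; elim: q qk => [//|q IH] qk /=.
    by apply: leq_ltn_trans (IH (ltnW qk)) _; rewrite ksub_mono /=.
  exact.
have -> : a = b by apply/val_inj; rewrite /= a0 b0.
by rewrite bE tnth_mktuple.
Qed.

(** * Compound matrices *)

Section Compound.
Variable K : comPzRingType.

(** Multilinear expansion gives a sum over all maps from rows to indices. A map that is not
    injective repeats a row of X and contributes 0; an injective one is a subset together with a
    permutation. *)
Lemma Cauchy_Binet n k (A : 'M[K]_(k, n)) (X : 'M[K]_(n, k)) :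
  \det (A *m X) = \sum_a \det (colsub (tnth (ksub a)) A) *
                         \det (rowsub (tnth (ksub a)) X).
Proof.
pose F (f : {ffun 'I_k -> 'I_n}) := (\prod_i A i (f i)) * \det (rowsub f X).
transitivity (\sum_f F f).
  transitivity (\sum_(f : {ffun 'I_k -> 'I_n}) \sum_(s : 'S_k)
      (-1) ^+ s * \prod_i (A i (f i) * X (f i) (s i))).
    rewrite exchange_big; apply: eq_bigr => /= s _; rewrite -big_distrr /=.
    congr (_ * _); rewrite -(bigA_distr_bigA (fun i j => A i j * X j (s i))) /=.
    by apply: eq_bigr => x _; rewrite mxE.
  apply: eq_bigr => f _; rewrite /F big_distrr /=; apply: eq_bigr => s _.
  rewrite mulrCA big_split /=; congr (_ * (_ * _)).
  by apply: eq_bigr => i _; rewrite mxE.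
rewrite (bigID (fun f : {ffun _} => injectiveb f)) /= addrC big1 ?add0r; last first.
  move=> f /injectivePn[i1 [i2 Di12 Ef12]].
  by rewrite /F (determinant_alternate Di12) ?mulr0 //= => j; rewrite !mxE Ef12.
(* [h] is a bijection from pairs (subset, permutation) onto injective maps, and [h'] is its partial
   inverse. *)
pose h (u : 'I_('C(n, k)) * 'S_k) := [ffun i => tnth (ksub u.1) (u.2 i)].
pose h' f := [pick u | h u == f].
have h_inj : injective h.
  move=> [a s] [b t] /ffunP abE.
  have {}abE i : tnth (ksub a) (s i) = tnth (ksub b) (t i) by have := abE i; rewrite !ffunE.
  have ab : a = b.
    apply: ksub_set_inj => x; apply/tnthP/tnthP => -[i ->].
      by exists (t (s^-1%g i)); rewrite -abE permKV.
    by exists (s (t^-1%g i)); rewrite abE permKV.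
  by rewrite -ab in abE *; congr pair; apply/permP => i; apply/(@tnth_ksub_inj _ _ a)/abE.
rewrite (reindex_omap h h') => [|f f_inj]; last first.
  rewrite /h'; case: pickP => [u /eqP hu|no_u]; first by rewrite /= hu.
  have [a [s fE]] := ksub_perm (elimT (injectiveP f) f_inj).
  by move: (no_u (a, s)) => /eqP[]; apply/ffunP => i; rewrite ffunE fE.
under eq_bigl => u.
  have -> : h' (h u) == Some u.
    by rewrite /h'; case: pickP => [v /eqP/h_inj->//|/(_ u)/eqP].
  have -> : injectiveb (h u).
    by apply/injectiveP => i j; rewrite !ffunE => /tnth_ksub_inj/perm_inj.
  over.
rewrite -(pair_bigA _ (fun a s => F (h (a, s)))) /=; apply: eq_bigr => a _.
rewrite big_distrl /=; apply: eq_bigr => s _; rewrite /F.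
have -> : rowsub (h (a, s)) X = row_perm s (rowsub (tnth (ksub a)) X).
  by apply/matrixP => i j; rewrite !mxE ffunE.
rewrite row_permE det_mulmx det_perm mulrCA mulrA; congr (_ * _ * _).
by apply: eq_bigr => i _; rewrite mxE ffunE.
Qed.

Definition compound m n k (A : 'M[K]_(m, n)) : 'M[K]_('C(m, k), 'C(n, k)) :=
  \matrix_(a, b) \det (mxsub (tnth (ksub a)) (tnth (ksub b)) A).

Lemma wedge_mul m n k (A : 'M[K]_(m, n)) (X : 'M[K]_(n, k)) :
  wedge (A *m X) = compound k A *m wedge X.
Proof.
apply/matrixP => a j; rewrite !mxE.
have -> : rowsub (tnth (ksub a)) (A *m X) = rowsub (tnth (ksub a)) A *m X.
  by apply/matrixP => i l; rewrite !mxE; apply: eq_bigr => p _; rewrite !mxE.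
rewrite Cauchy_Binet; apply: eq_bigr => b _; rewrite !mxE; congr (\det _ * _).
by apply/matrixP => i l; rewrite !mxE.
Qed.

Lemma wedge_mulr n k (X : 'M[K]_(n, k)) (C : 'M[K]_k) :
  wedge (X *m C) = \det C *: wedge X.
Proof.
apply/matrixP => a j; rewrite !mxE mulrC -det_mulmx; congr (\det _).
by apply/matrixP => i l; rewrite !mxE; apply: eq_bigr => p _; rewrite !mxE.
Qed.

Lemma compound_mul m n p k (A : 'M[K]_(m, n)) (B : 'M[K]_(n, p)) :
  compound k (A *m B) = compound k A *m compound k B.
Proof.
apply/matrixP => a b; rewrite !mxE.
have -> : mxsub (tnth (ksub a)) (tnth (ksub b)) (A *m B) =
          rowsub (tnth (ksub a)) A *m colsub (tnth (ksub b)) B.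
  by apply/matrixP => i l; rewrite !mxE; apply: eq_bigr => q _; rewrite !mxE.
rewrite Cauchy_Binet; apply: eq_bigr => c _; rewrite !mxE.
by congr (_ * _); congr (\det _); apply/matrixP => i l; rewrite !mxE.
Qed.

Lemma compound_tr m n k (A : 'M[K]_(m, n)) : compound k A^T = (compound k A)^T.
Proof.
by apply/matrixP => a b; rewrite !mxE -det_tr; congr (\det _); apply/matrixP=> i j; rewrite !mxE.
Qed.

(* A triangular matrix is also triangular for the lexicographic order: if a is
   greater than b at the first difference p, then rows i >= p and columns
   j <= p form a block of zeros which is too large for a nonzero determinant. *)
Lemma compound_upper n k (A : 'M[K]_n) :
  (forall i j : 'I_n, (j < i)%N -> A i j = 0) ->
  forall a b : 'I_('C(n, k)), (b < a)%N -> compound k A a b = 0.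
Proof.
move=> A0 a b /ksub_lex[p [_ lt_p]]; rewrite mxE.
apply: big1 => s _.
suff /existsP[i /andP[pi sip]] : [exists i : 'I_k, (p <= i)%N && (s i <= p)%N].
  rewrite (bigD1 i) //= mxE A0 ?mul0r ?mulr0 //.
  apply: leq_ltn_trans (_ : tnth (ksub b) p < _)%N; first by rewrite ksub_le.
  by apply: leq_trans lt_p _; rewrite ksub_le.
apply: contraT => /existsPn no_i.
pose U := [set i : 'I_k | (p <= i)%N]; pose V := [set i : 'I_k | (p < i)%N].
have sUV : s @: U \subset V.
  apply/fintype.subsetP => _ /imsetP[i iU ->]; rewrite inE ltnNge.
  by have := no_i i; rewrite inE in iU; rewrite iU.
have := subset_leq_card sUV; rewrite card_imset; last exact: perm_inj.
have -> : U = p |: V.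
  by apply/setP => i; rewrite !inE leq_eqVlt (inj_eq val_inj) eq_sym.
by rewrite cardsU1 inE ltnn add1n ltnn.
Qed.

Lemma compound_diag_upper n k (A : 'M[K]_n) :
  (forall i j : 'I_n, (j < i)%N -> A i j = 0) ->
  forall a : 'I_('C(n, k)), compound k A a a = \prod_(i <- ksub a) A i i.
Proof.
move=> A0 a; rewrite mxE -det_tr det_trig; last first.
  by apply/is_trig_mxP => i j ij; rewrite !mxE A0 // ksub_mono.
rewrite big_tuple; by apply: eq_bigr => i _; rewrite !mxE.
Qed.

Lemma compound_diag n k (d : 'I_n -> K) :
  compound k (diag_mx (\row_i d i)) = diag_mx (\row_a \prod_(i <- ksub a) d i).
Proof.
set D := diag_mx _.
have diag0 (i j : 'I_n) : (j < i)%N -> D i j = 0.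
  by move=> ji; rewrite !mxE; case: eqP => [ij|//]; rewrite ij ltnn in ji.
have DT : D^T = D by rewrite tr_diag_mx.
apply/matrixP => a b; rewrite [RHS]mxE.
have [ab|ba|/val_inj->] := ltngtP (val a) (val b).
- rewrite -DT compound_tr mxE compound_upper //.
  by case: eqP ab => [->|//]; rewrite ltnn.
- rewrite compound_upper //.
  by case: eqP ba => [->|//]; rewrite ltnn.
- rewrite compound_diag_upper // eqxx mulr1n mxE; apply: eq_bigr => i _.
  by rewrite !mxE eqxx.
Qed.

Lemma compound1 n k : compound k (1%:M : 'M[K]_n) = 1%:M.
Proof.
have one (m : nat) : \row_(i < m) (1 : K) = const_mx 1 by apply/rowP => i; rewrite !mxE.
rewrite -diag_const_mx -one compound_diag -diag_const_mx -one; congr diag_mx.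
by apply/rowP => a; rewrite !mxE big1.
Qed.

Lemma minors_mul n k (A g : 'M[K]_n) : minors k (A *m g) = compound k A *m minors k g.
Proof. by rewrite /minors -mulmxA wedge_mul. Qed.

(** The first k columns of [g *m b] are those of [g] times the leading block [c] of [b]. Hence the
    Plücker coordinates depend on the flag only, up to a scalar. *)
Lemma minors_upper n k (g b : 'M[K]_n) : (k <= n)%N ->
  (forall i j : 'I_n, (j < i)%N -> b i j = 0) ->
  minors k (g *m b) = (\prod_(i < n | (i < k)%N) b i i) *: minors k g.
Proof.
move=> kn b0.
pose c : 'M[K]_k := mxsub (widen_ord kn) (widen_ord kn) b.
have bE : b *m (pid_mx k : 'M_(n, k)) = (pid_mx k : 'M_(n, k)) *m c.
  apply/matrixP => i j; rewrite !mxE.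
  rewrite (bigD1 (widen_ord kn j)) //= big1 ?addr0 => [|l lj]; last first.
    rewrite !mxE; case: eqP => [E|]; last by rewrite mulr0.
    by case/eqP: lj; apply/val_inj.
  rewrite !mxE eqxx /= ltn_ord mulr1.
  case: (ltnP i k) => ik; last first.
    rewrite b0; last exact: leq_trans (ltn_ord j) ik.
    by rewrite big1 // => l _; rewrite !mxE ltnNge ik andbF mul0r.
  rewrite (bigD1 (Ordinal ik)) //= big1 ?addr0 => [|l li]; last first.
    by rewrite !mxE; case: eqP => [E|]; rewrite ?mul0r //; case/eqP: li; apply/val_inj.
  rewrite !mxE eqxx ik mul1r; congr (b _ _); exact/val_inj.
rewrite /minors -mulmxA bE mulmxA wedge_mulr -det_tr det_trig; last first.
  by apply/is_trig_mxP => i j ij; rewrite !mxE b0.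
congr (_ *: _); rewrite (big_ord_narrow kn).
by apply: eq_bigr => i _; rewrite !mxE.
Qed.

(** Since the subset of index 0 is the initial segment, Plücker vectors are first columns of
    compounds. *)
Lemma minorsE n k (g : 'M[K]_n) (a b0 : 'I_('C(n, k))) : b0 = 0 :> nat ->
  minors k g a 0 = compound k g a b0.
Proof.
move=> b00; rewrite !mxE; congr (\det _); apply/matrixP => i j; rewrite !mxE.
rewrite (bigD1 (tnth (ksub b0) j)) //= big1 ?addr0 => [|l lj]; rewrite !mxE.
  by rewrite ksub0 // eqxx ltn_ord mulr1.
by rewrite -(ksub0 b00 j) (inj_eq val_inj) (negPf lj) mulr0.
Qed.

End Compound.

(** * The derivation induced on the exterior power *)

Section ExteriorDerivation.
Variable K : comNzRingType.

Lemma deriv_prod (I : eqType) (s : seq I) (p : I -> {poly K}) : uniq s ->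
  (\prod_(i <- s) p i)^`() =
  \sum_(r <- s) \prod_(i <- s) (if i == r then (p i)^`() else p i).
Proof.
elim: s => [|j s IH] /=; first by rewrite !big_nil derivC.
case/andP=> js us; rewrite !big_cons derivM (IH us) eqxx; congr (_ * _ + _).
  by rewrite !big_seq; apply: eq_bigr => i si; case: eqP si js => [->->|].
rewrite big_distrr /= !big_seq; apply: eq_bigr => r rs; rewrite big_cons.
by case: eqP rs js => [->->|].
Qed.

Lemma deriv_det k (A : 'M[{poly K}]_k) :
  (\det A)^`() =
  \sum_r \det (\matrix_(i, j) (if j == r then (A i j)^`() else A i j)).
Proof.
rewrite /determinant linear_sum /= exchange_big; apply: eq_bigr => s _ /=.
rewrite -big_distrr /= -polyC1 -polyCN -polyC_exp !mul_polyC derivZ.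
congr (_ *: _); rewrite deriv_prod ?index_enum_uniq //.
(* The product is indexed by rows, while r is to name the differentiated column; [s] exchanges the
   two. *)
rewrite (reindex_inj (@perm_inj _ s^-1%g)); apply: eq_bigr => r _.
by apply: eq_bigr => i _; rewrite !mxE -(inj_eq (@perm_inj _ s)) permKV.
Qed.

(** The derivation is the linear term in t of the action of 1 + t M; formal polynomials in t make
    this valid over any ring considered here. *)
Lemma wedge_derivE n k (M : 'M[K]_n) (X : 'M[K]_(n, k)) a :
  (wedge (map_mx polyC X + 'X *: map_mx polyC (M *m X)) a 0)^`().[0] =
  wedge_deriv M X a 0.
Proof.
rewrite mxE deriv_det horner_sum summxE; apply: eq_bigr => r _.
rewrite mxE -horner_evalE -det_map_mx; congr (\det _); apply/matrixP => i j.
rewrite !mxE; case: ifP => _; rewrite /= /horner_eval.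
  by rewrite derivD derivM !derivC derivX mulr0 addr0 mul1r add0r hornerC mxE.
by rewrite hornerD hornerM hornerX mul0r addr0 hornerC.
Qed.

(* Applied to X + t M X, both sides are the derivatives at t = 0 of the two
   sides of the functoriality of the exterior power. *)
Lemma ext_mx_wedge n k (M : 'M[K]_n) (X : 'M[K]_(n, k)) :
  ext_mx M k *m wedge X = wedge_deriv M X.
Proof.
apply/colP => a; rewrite -wedge_derivE.
pose Mt : 'M[{poly K}]_n := 1%:M + 'X *: map_mx polyC M.
have MtE p (Y : 'M[K]_(n, p)) :
    map_mx polyC Y + 'X *: map_mx polyC (M *m Y) = Mt *m map_mx polyC Y.
  by rewrite mulmxDl mul1mx -scalemxAl map_mxM.
rewrite MtE wedge_mul !mxE linear_sum horner_sum; apply: eq_bigr => b _ /=.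
have -> : wedge (map_mx polyC X) b 0 = (wedge X b 0)%:P.
  rewrite !mxE -det_map_mx; congr (\det _).
  by apply/matrixP => i j; rewrite !mxE.
rewrite derivM derivC mulr0 addr0 hornerM hornerC; congr (_ * _).
rewrite mxE -wedge_derivE MtE !mxE; congr (_^`().[0]); congr (\det _).
apply/matrixP => i j; rewrite !mxE (bigD1 (tnth (ksub b) j)) //= !mxE eqxx mulr1.
rewrite big1 ?addr0 // => l lj.
by rewrite !mxE (negPf lj) mulr0.
Qed.

(** Column b of the compound is a wedge of eigenvectors. Replacing one factor by its image
    multiplies the wedge by one eigenvalue, and the sum over the factors gives [ksum d b]. *)
Lemma ext_mx_diag n k (M g : 'M[K]_n) (d : 'I_n -> K) :
  M *m g = g *m diag_mx (\row_i d i) ->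
  ext_mx M k *m compound k g = compound k g *m diag_mx (\row_a ksum d a).
Proof.
move=> Mg; apply/matrixP => a b.
pose X := colsub (tnth (ksub b)) g.
have XE c : compound k g c b = wedge X c 0.
  by rewrite !mxE; congr (\det _); apply/matrixP => i j; rewrite !mxE.
have -> : (ext_mx M k *m compound k g) a b = (ext_mx M k *m wedge X) a 0.
  by rewrite !mxE; apply: eq_bigr => c _; rewrite XE.
rewrite ext_mx_wedge /wedge_deriv.
have MX : M *m X = X *m diag_mx (\row_s d (tnth (ksub b) s)).
  apply/matrixP => i s.
  transitivity ((M *m g) i (tnth (ksub b) s)).
    by rewrite !mxE; apply: eq_bigr => l _; rewrite !mxE.
  by rewrite Mg !mul_mx_diag !mxE.
transitivity (ksum d b * wedge X a 0); last first.
  by rewrite -XE mulrC mul_mx_diag [RHS]mxE [X in _ = _ * X]mxE.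
rewrite summxE /ksum big_tuple big_distrl /=; apply: eq_bigr => r _.
pose D := diag_mx (\row_s (if s == r then d (tnth (ksub b) s) else 1)).
rewrite (_ : \matrix_(i, s) _ = X *m D).
  rewrite wedge_mulr det_diag mxE; congr (_ * _).
  rewrite (bigD1 r) //= big1 ?mulr1 => [|s sr]; rewrite mxE ?eqxx //.
  by rewrite (negPf sr).
apply/matrixP => i s; rewrite MX !mul_mx_diag !mxE.
by case: ifP => _; rewrite !mxE ?mulr1.
Qed.

End ExteriorDerivation.

(** * Gram-Schmidt and the Lanczos tridiagonalization *)

Section GramSchmidt.
Variable R : realType.

Lemma dotE N (u v : 'cV[R]_N) : dot u v = \sum_i u i 0 * v i 0.
Proof. by rewrite /dot mxE; apply: eq_bigr => i _; rewrite mxE. Qed.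

Lemma dotC N (u v : 'cV[R]_N) : dot u v = dot v u.
Proof. by rewrite !dotE; apply: eq_bigr => i _; rewrite mulrC. Qed.

Lemma dotDr N (u v w : 'cV[R]_N) : dot u (v + w) = dot u v + dot u w.
Proof. by rewrite /dot mulmxDr mxE. Qed.

Lemma dotZr N (u v : 'cV[R]_N) c : dot u (c *: v) = c * dot u v.
Proof. by rewrite /dot -scalemxAr mxE. Qed.

Lemma dotNr N (u v : 'cV[R]_N) : dot u (- v) = - dot u v.
Proof. by rewrite /dot mulmxN mxE. Qed.

Lemma dotZl N (u v : 'cV[R]_N) c : dot (c *: u) v = c * dot u v.
Proof. by rewrite dotC dotZr dotC. Qed.

Lemma dot_sumr N I r (P : pred I) (u : 'cV[R]_N) F :
  dot u (\sum_(i <- r | P i) F i) = \sum_(i <- r | P i) dot u (F i).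
Proof. by rewrite /dot mulmx_sumr summxE. Qed.

Lemma dot_ge0 N (u : 'cV[R]_N) : 0 <= dot u u.
Proof. by rewrite dotE sumr_ge0 // => i _; rewrite -expr2 sqr_ge0. Qed.

Lemma dot_gt0 N (u : 'cV[R]_N) : (0 < dot u u) = (u != 0).
Proof.
rewrite lt0r dot_ge0 andbT; apply/idP/idP; apply: contraNN => /eqP.
  by move=> ->; rewrite dotE big1 // => i _; rewrite mxE mul0r.
move=> /eqP; rewrite dotE psumr_eq0 => [/allP u0|i _]; last by rewrite -expr2 sqr_ge0.
apply/eqP/colP => i; rewrite mxE; apply/eqP.
by have := u0 i (mem_index_enum i); rewrite /= mulf_eq0 orbb.
Qed.

Lemma dot_isometry m N (A : 'M[R]_(N, m)) : A^T *m A = 1%:M ->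
  forall u v, dot (A *m u) (A *m v) = dot u v.
Proof. by move=> A1 u v; rewrite /dot trmx_mul -mulmxA (mulmxA A^T) A1 mul1mx. Qed.

(** The j-th output of Gram-Schmidt depends on the first j + 1 inputs only, so it can be indexed by
    j without fixing the length of the list. *)
Definition gsv N (v : nat -> 'cV[R]_N) j : 'cV[R]_N :=
  nth 0 (gram_schmidt (mkseq v j.+1)) j.

Definition gsu N (v : nat -> 'cV[R]_N) j : 'cV[R]_N :=
  v j - \sum_(i < j) dot (gsv v i) (v j) *: gsv v i.

Lemma gram_schmidt_rcons N (s : seq 'cV[R]_N) v :
  gram_schmidt (rcons s v) =
  let u := v - \sum_(a <- gram_schmidt s) dot a v *: a in
  rcons (gram_schmidt s) ((Num.sqrt (dot u u))^-1 *: u).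
Proof. by rewrite /gram_schmidt foldl_rcons. Qed.

Lemma gram_schmidt_mkseq N (v : nat -> 'cV[R]_N) m :
  gram_schmidt (mkseq v m) = mkseq (gsv v) m.
Proof.
elim: m => [//|m IH]; rewrite mkseqS gram_schmidt_rcons IH /= mkseqS.
congr rcons; rewrite [RHS]/gsv mkseqS gram_schmidt_rcons IH /=.
by rewrite nth_rcons size_mkseq ltnn eqxx.
Qed.

Lemma gsvE N (v : nat -> 'cV[R]_N) j :
  gsv v j = (Num.sqrt (dot (gsu v j) (gsu v j)))^-1 *: gsu v j.
Proof.
rewrite {1}/gsv mkseqS gram_schmidt_rcons gram_schmidt_mkseq /=.
rewrite nth_rcons size_mkseq ltnn eqxx /gsu.
suff -> : \sum_(a <- mkseq (gsv v) j) dot a (v j) *: a =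
   \sum_(i < j) dot (gsv v i) (v j) *: gsv v i by [].
by rewrite /mkseq big_map -[X in iota _ X]subn0 -/(index_iota 0 j) big_mkord.
Qed.

Lemma eq_gsv N (v w : nat -> 'cV[R]_N) : v =1 w -> gsv v =1 gsv w.
Proof. by move=> vw j; rewrite /gsv (eq_mkseq vw). Qed.

(** Gram-Schmidt uses only inner products and linear combinations. This transports it from spectral
    coordinates to the original space. *)
Lemma gsv_isometry m N (A : 'M[R]_(N, m)) (v : nat -> 'cV[R]_m) j :
  A^T *m A = 1%:M -> gsv (fun i => A *m v i) j = A *m gsv v j.
Proof.
move=> A1; have [l] := ubnP j; elim: l j => // l IH j /ltnSE jl.
have uE : gsu (fun i => A *m v i) j = A *m gsu v j.
  rewrite /gsu mulmxBr mulmx_sumr; congr (_ - _); apply: eq_bigr => i _.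
  by rewrite IH ?(leq_trans (ltn_ord i)) // dot_isometry // scalemxAr.
by rewrite !gsvE uE dot_isometry // scalemxAr.
Qed.

Section Orthonormality.
Variables (N m : nat) (v : nat -> 'cV[R]_N).
Hypothesis v_free : forall j, (j < m)%N -> gsu v j != 0.

Let norm_gt0 j : (j < m)%N -> 0 < Num.sqrt (dot (gsu v j) (gsu v j)).
Proof. by move=> jm; rewrite sqrtr_gt0 dot_gt0 v_free. Qed.

Lemma gsv_dec j : (j < m)%N ->
  v j = Num.sqrt (dot (gsu v j) (gsu v j)) *: gsv v j +
        \sum_(i < j) dot (gsv v i) (v j) *: gsv v i.
Proof.
move=> jm; rewrite gsvE scalerA divff ?scale1r; last by rewrite gt_eqF ?norm_gt0.
by rewrite /gsu subrK.
Qed.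

Lemma gsv_orthonormal i j : (i < m)%N -> (j < m)%N ->
  dot (gsv v i) (gsv v j) = (i == j)%:R.
Proof.
have [l] := ubnP (maxn i j); elim: l i j => // l IH i j.
wlog ij : i j / (i <= j)%N => [wl|].
  case/orP: (leq_total i j) => [ij|ji]; first exact: wl.
  by rewrite dotC eq_sym maxnC => ? ? ?; apply: wl.
rewrite (maxn_idPr ij) => /ltnSE jl im jm.
have nj := norm_gt0 jm.
move: ij; rewrite leq_eqVlt => /orP[/eqP ->|ij].
  rewrite eqxx gsvE dotZl dotZr mulrA -expr2 exprVn sqr_sqrtr ?dot_ge0 //.
  by rewrite mulVf // gt_eqF ?dot_gt0 ?v_free.
rewrite (ltn_eqF ij) (gsvE v j) dotZr.
suff -> : dot (gsv v i) (gsu v j) = 0 by rewrite mulr0.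
rewrite /gsu dotDr dotNr dot_sumr.
rewrite (bigD1 (Ordinal ij)) //= dotZr IH ?eqxx ?maxnn ?mulr1; first last.
- by [].
- by [].
- exact: leq_trans ij jl.
rewrite big1 ?addr0 ?subrr // => a ai.
rewrite dotZr IH ?(ltn_trans (ltn_ord a)) //.
  by rewrite eq_sym (negPf (_ : (a : nat) != i)) ?mulr0.
by rewrite gtn_max (leq_trans ij jl) (leq_trans (ltn_ord a) jl).
Qed.

(** With [gsv_diag], this describes the triangular factor of the QR factorization of the vectors
    [v j]. *)
Lemma gsv_tri i j : (i < m)%N -> (j < i)%N -> dot (gsv v i) (v j) = 0.
Proof.
move=> im ji; rewrite gsv_dec ?(ltn_trans ji) // dotDr dotZr dot_sumr.
rewrite gsv_orthonormal ?(ltn_trans ji) // gtn_eqF // mulr0 add0r.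
rewrite big1 // => a _; rewrite dotZr gsv_orthonormal //; last first.
  by rewrite (ltn_trans (ltn_ord a)) // (ltn_trans ji).
by rewrite gtn_eqF ?mulr0 // (ltn_trans _ ji).
Qed.

Lemma gsv_diag j : (j < m)%N ->
  dot (gsv v j) (v j) = Num.sqrt (dot (gsu v j) (gsu v j)).
Proof.
move=> jm; rewrite gsv_dec // dotDr dotZr dot_sumr.
rewrite gsv_orthonormal // eqxx mulr1 big1 ?addr0 // => a _.
rewrite dotZr gsv_orthonormal ?(ltn_trans (ltn_ord a)) //.
by rewrite gtn_eqF ?mulr0.
Qed.

End Orthonormality.
End GramSchmidt.

(** * Orthonormal polynomials and Jacobi matrices *)

Section Lanczos.
Variables (R : realType) (m : nat) (nu f : 'I_m -> R).

(** The coordinates of p(S) e_1 in an eigenbasis of S, when e_1 has coordinates f; [pkrylov j] is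
    the case of the monomial of degree j. *)
Definition peval (p : {poly R}) : 'cV[R]_m := \col_i (p.[nu i] * f i).

Definition pkrylov j : 'cV[R]_m := \col_i (nu i ^+ j * f i).

Definition lanczos : 'M[R]_m := \matrix_(i, j) gsv pkrylov j i 0.

(** Multiplication by X in the basis of orthonormal polynomials for the weights [f i ^+ 2] at the
    nodes [nu i]. *)
Definition lanczos_tridiag : 'M[R]_m :=
  lanczos^T *m diag_mx (\row_i nu i) *m lanczos.

Lemma peval_sum i (p : {poly R}) : (size p <= i.+1)%N ->
  peval p = \sum_(l < i.+1) p`_l *: pkrylov l.
Proof.
move=> sp; apply/colP => a; rewrite mxE summxE (horner_coef_wide _ sp) big_distrl.
by apply: eq_bigr => l _; rewrite !mxE mulrA.
Qed.

(** Keeps the orthogonal polynomials visible behind Gram-Schmidt: q is the monic one and p its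
    normalization, so later steps can compare degrees and leading coefficients. *)
Lemma peval_gs j :
  exists p q : {poly R}, [/\ (size p <= j.+1)%N, (size q <= j.+1)%N, q`_j = 1,
    gsu pkrylov j = peval q & gsv pkrylov j = peval p /\
      p`_j = (Num.sqrt (dot (gsu pkrylov j) (gsu pkrylov j)))^-1].
Proof.
have [l] := ubnP j; elim: l j => // l IH j /ltnSE jl.
have /fin_all_exists[p pP] : forall i : 'I_j, exists p : {poly R},
    (size p <= i.+1)%N /\ gsv pkrylov i = peval p.
  by move=> i; have [p [q [sp _ _ _ [pE _]]]] := IH i (leq_trans (ltn_ord i) jl); exists p.
pose r : {poly R} := \sum_(i < j) dot (gsv pkrylov i) (pkrylov j) *: p i.
pose q := 'X^j - r.
have small : (size r <= j)%N.
  apply: leq_trans (size_sum _ _ _) _; apply/bigmax_leqP => i _.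
  apply: leq_trans (size_scale_leq _ _) _.
  exact: leq_trans (pP i).1 (ltn_ord i).
have qE : gsu pkrylov j = peval q.
  apply/colP => a; rewrite /gsu !mxE hornerD hornerN hornerXn horner_sum summxE.
  rewrite mulrDl mulNr big_distrl; congr (_ - _); apply: eq_bigr => i _ /=.
  by rewrite (pP i).2 !mxE hornerZ mulrA.
have sq : (size q <= j.+1)%N.
  rewrite (leq_trans (size_polyD _ _)) // size_polyXn size_polyN geq_max leqnn /=.
  exact: leqW.
have q1 : q`_j = 1.
  by rewrite coefD coefN coefXn eqxx (nth_default _ small) subr0.
exists ((Num.sqrt (dot (gsu pkrylov j) (gsu pkrylov j)))^-1 *: q), q; split=> //.
  exact: leq_trans (size_scale_leq _ _) sq.
split; last by rewrite coefZ q1 mulr1.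
by rewrite gsvE [X in _ *: X = _]qE; apply/colP => i; rewrite !mxE hornerZ mulrA.
Qed.

Hypothesis nu_inj : injective nu.
Hypothesis f_neq0 : forall i, f i != 0.

(** The residual consists of the values of a monic polynomial of degree j < m, which cannot vanish
    at all m distinct nodes. *)
Lemma gsu_pkrylov_neq0 j : (j < m)%N -> gsu pkrylov j != 0.
Proof.
move=> jm; have [_ [q [_ sq q1 -> _]]] := peval_gs j.
apply/eqP => /colP q0.
have q_neq0 : q != 0 by apply: contra_eq_neq q1 => ->; rewrite coef0 eq_sym oner_neq0.
have rs : all (root q) (map nu (enum 'I_m)).
  apply/allP => _ /mapP[i _ ->]; apply/rootP.
  by have := q0 i; rewrite !mxE => /eqP; rewrite mulf_eq0 (negPf (f_neq0 i)) orbF => /eqP.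
have := max_poly_roots q_neq0 rs; rewrite map_inj_uniq // enum_uniq => /(_ isT).
by rewrite size_map size_enum_ord => /leq_trans/(_ sq); rewrite ltnS leqNgt jm.
Qed.

Lemma dot_gsv_peval i (p : {poly R}) : (i < m)%N -> (size p <= i.+1)%N ->
  dot (gsv pkrylov i) (peval p) =
  p`_i * Num.sqrt (dot (gsu pkrylov i) (gsu pkrylov i)).
Proof.
move=> im /peval_sum->; rewrite dot_sumr big_ord_recr /= dotZr.
rewrite (gsv_diag gsu_pkrylov_neq0) // big1 ?add0r // => l _.
by rewrite dotZr (gsv_tri gsu_pkrylov_neq0) ?mulr0.
Qed.

Lemma lanczos_orth : lanczos^T *m lanczos = 1%:M.
Proof.
apply/matrixP => i j; rewrite !mxE.
rewrite -(gsv_orthonormal gsu_pkrylov_neq0 (ltn_ord i) (ltn_ord j)) dotE.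
by apply: eq_bigr => l _; rewrite !mxE.
Qed.

Lemma lanczos_orthV : lanczos *m lanczos^T = 1%:M.
Proof. exact/mulmx1C/lanczos_orth. Qed.

(** X times the i-th orthonormal polynomial has degree i + 1, so it is orthogonal to those of index
    above i + 1; its leading coefficient gives the positive entry next to the diagonal. *)
Lemma lanczos_jacobi : jacobi lanczos_tridiag.
Proof.
have sym : lanczos_tridiag^T = lanczos_tridiag.
  by rewrite /lanczos_tridiag !trmx_mul trmxK tr_diag_mx mulmxA.
split=> // i j; rewrite -sym [lanczos_tridiag^T i j]mxE.
have [p [_ [sp _ _ _ [pE p_lead]]]] := peval_gs i.
have TE : lanczos_tridiag j i = dot (gsv pkrylov j) (peval (p * 'X)).
  rewrite /lanczos_tridiag -mulmxA !mxE dotE; apply: eq_bigr => l _.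
  rewrite mul_diag_mx !mxE pE !mxE hornerM hornerX.
  by rewrite [p.[_] * nu l]mulrC -[nu l * _ * _]mulrA.
have spX : (size (p * 'X)%R <= i.+2)%N.
  by apply: leq_trans (size_polyMleq _ _) _; rewrite size_polyX addn2.
split=> [ij|ij]; rewrite TE.
  rewrite dot_gsv_peval ?(leq_trans spX) //; last exact: ltnW.
  by rewrite (nth_default _ (leq_trans spX ij)) mul0r.
rewrite dot_gsv_peval; [|by []|by rewrite ij].
rewrite coefMX ij /= p_lead -ij.
by rewrite mulr_gt0 ?invr_gt0 // sqrtr_gt0 dot_gt0 gsu_pkrylov_neq0.
Qed.

End Lanczos.

(** * Moser's map: existence and uniqueness *)

Section Moser.
Variable R : realType.

Lemma diag_conj_eigenvalue m (nu : 'I_m -> R) (Q : 'M[R]_m) : Q^T *m Q = 1%:M ->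
  forall a, eigenvalue (Q *m diag_mx (\row_i nu i) *m Q^T) a <-> exists i, a = nu i.
Proof.
move=> Q1 a; split=> [/eigenvalueP[v vM v0]|[i ->]].
  pose w := v *m Q.
  have w0 : w != 0.
    apply: contraNneq v0 => w0; apply/eqP.
    by rewrite -[v]mulmx1 -(mulmx1C Q1) mulmxA -/w w0 mul0mx.
  case/rV0Pn: w0 => i wi; exists i; apply/(mulIf wi).
  have : w *m diag_mx (\row_i nu i) = a *: w.
    by rewrite scalemxAl -vM -!mulmxA Q1 mulmx1 !mulmxA.
  by move/rowP/(_ i); rewrite mul_mx_diag !mxE mulrC => ->.
apply/eigenvalueP; exists (row i Q^T).
  rewrite -mulmxA -row_mul !mulmxA Q1 mul1mx.
  by apply/rowP => j; rewrite mxE mul_diag_mx !mxE.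
apply/eqP => /(congr1 (mulmx^~ Q)); rewrite -row_mul Q1 mul0mx => /rowP/(_ i).
by rewrite !mxE eqxx => /eqP; rewrite oner_eq0.
Qed.

(** U fixes e_1, and each column of the intertwining relation determines the next column of U from
    the previous ones, as in the Lanczos recursion. *)
Lemma jacobi_rigid m (T T' U : 'M[R]_m) : jacobi T -> jacobi T' ->
  U^T *m U = 1%:M -> U *m T = T' *m U ->
  (forall i j : 'I_m, j = 0 :> nat -> U i j = (i == j)%:R) -> U = 1%:M.
Proof.
move=> [symT jT] [symT' jT'] U1 UT Ue.
have low (S : 'M[R]_m) (i j : 'I_m) : jacobi S -> (j.+1 < i)%N -> S i j = 0.
  by case=> symS jS ji; rewrite -symS mxE; apply: (jS j i).1.
have sub (S : 'M[R]_m) (i j : 'I_m) : jacobi S -> i = j.+1 :> nat -> 0 < S i j.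
  by case=> symS jS ji; rewrite -symS mxE; apply: (jS j i).2.
have row_of_col (j : 'I_m) : (forall i, U i j = (i == j)%:R) -> forall i, U j i = (j == i)%:R.
  move=> cj i; have := congr1 (fun A : 'M_m => A j i) U1; rewrite !mxE => <-.
  rewrite (bigD1 j) //= !mxE cj eqxx mul1r big1 ?addr0 // => l lj.
  by rewrite !mxE cj (negPf lj) mul0r.
have col_ok (j : 'I_m) : forall i, U i j = (i == j)%:R.
  case: j => l; elim/ltn_ind: l => -[|l] IH lm i; first exact: Ue.
  set j1 := Ordinal lm.
  pose j := Ordinal (ltnW lm).
  have cj (b : 'I_m) : (b <= j)%N -> forall i, U i b = (i == b)%:R.
    by case: b => b bm bj k; apply: IH.
  (* In column j of [U *m T = T' *m U], the known columns of U and the shape of T leave one unknown.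
     This settles the rows below j; the rows up to j of column j1 come from [row_of_col]. *)
  have eqs (a : 'I_m) : (j < a)%N -> U a j1 * T j1 j = T' a j.
    move=> ja; have := congr1 (fun A : 'M_m => A a j) UT; rewrite !mxE.
    rewrite (bigD1 j1) //= big1 ?addr0 => [->|b bj1].
      rewrite (bigD1 j) //= cj // eqxx mulr1 big1 ?addr0 // => b bj.
      by rewrite cj // (negPf bj) mulr0.
    have [bj|jb] := leqP b j.
      by rewrite cj // (gtn_eqF (leq_ltn_trans bj ja) : (a == b) = false) mul0r.
    rewrite (low T b j) ?mulr0 //; rewrite ltn_neqAle jb andbT.
    by rewrite eq_sym; rewrite -(inj_eq val_inj) /= in bj1.
  have Tj : 0 < T j1 j by apply: sub.
  have big_zero (a : 'I_m) : (j1 < a)%N -> U a j1 = 0.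
    move=> ja; have /eqP := eqs a (ltnW ja).
    by rewrite (low T' a j) // mulf_eq0 (gt_eqF Tj) orbF => /eqP.
  have small_zero (a : 'I_m) : (a < j1)%N -> U a j1 = 0.
    move=> aj; rewrite (row_of_col a (cj a aj)).
    by rewrite -(inj_eq val_inj) /= ltn_eqF.
  have Ujj : 0 < U j1 j1.
    by rewrite -(pmulr_lgt0 _ Tj) eqs //; apply: sub.
  have Uj1 : U j1 j1 = 1.
    have := congr1 (fun A : 'M_m => A j1 j1) U1; rewrite !mxE eqxx (bigD1 j1) //=.
    rewrite mxE big1 ?addr0 => [/eqP|a]; last first.
      rewrite mxE neq_lt => /orP[] aj; first by rewrite small_zero ?mulr0.
      by rewrite big_zero ?mulr0.
    by rewrite -expr2 sqrf_eq1 => /orP[/eqP//|/eqP E]; rewrite E ltr0N1 in Ujj.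
  have [aj|ja|/val_inj->] := ltngtP i j1; last by rewrite eqxx Uj1.
    by rewrite small_zero // -(inj_eq val_inj) ltn_eqF.
  by rewrite big_zero // -(inj_eq val_inj) gtn_eqF.
by apply/matrixP => i j; rewrite col_ok mxE.
Qed.

Lemma basis1_dot m (u : 'cV[R]_m) (i0 : 'I_m) : i0 = 0 :> nat ->
  dot (basis1 R m) u = u i0 0.
Proof.
move=> i00; rewrite dotE (bigD1 i0) //= mxE i00 eqxx mul1r big1 ?addr0 // => i.
by rewrite -(inj_eq val_inj) /= i00 mxE => /negPf->; rewrite mul0r.
Qed.

(** The first row of the orthogonal matrix V is a unit vector proportional to x. Positivity fixes
    the sign of the factor, so x determines this row completely. *)
Lemma moser_spec_diag m (nu x : 'I_m -> R) (T : 'M[R]_m) (i0 : 'I_m) :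
  i0 = 0 :> nat -> injective nu -> moser_spec nu x T -> (forall i, 0 < x i) ->
  exists2 V : 'M[R]_m, [/\ V^T *m V = 1%:M, T = V *m diag_mx (\row_i nu i) *m V^T &
     forall i, V i0 i = (Num.sqrt (\sum_i x i ^+ 2))^-1 * x i] &
     jacobi T.
Proof.
move=> i00 nu_inj [jT [[symT _] [v [vP [c c0 xE]]]]] x_gt0.
pose V := \matrix_(a, i) v i a 0.
have VV : V^T *m V = 1%:M.
  apply/matrixP => i j; transitivity (dot (v i) (v j)).
    by rewrite !mxE dotE; apply: eq_bigr => a _; rewrite !mxE.
  rewrite mxE; case: eqP => [->|/eqP ij]; first by case: (vP j).
  have [Tvi _ _] := vP i; have [Tvj _ _] := vP j.
  have : nu i * dot (v i) (v j) = nu j * dot (v i) (v j).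
    rewrite -dotZl -dotZr -Tvi -Tvj /dot trmx_mul symT.
    by rewrite mulmxA.
  move/eqP; rewrite -subr_eq0 -mulrBl mulf_eq0 subr_eq0 (inj_eq nu_inj) (negPf ij).
  by move/eqP.
have TV : T *m V = V *m diag_mx (\row_i nu i).
  apply/matrixP => a i; have [/colP/(_ a) Tvi _ _] := vP i.
  rewrite mul_mx_diag !mxE mulrC.
  move: Tvi; rewrite !mxE => <-; by apply: eq_bigr => l _; rewrite !mxE.
have VVt := mulmx1C VV.
have V0 i : dot (basis1 R m) (v i) = V i0 i by rewrite (basis1_dot _ i00) mxE.
have c_gt0 : 0 < c.
  have [_ _ vi] := vP i0; have := x_gt0 i0.
  by rewrite xE pmulr_lgt0.
have xV i : x i = c * V i0 i by rewrite xE V0.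
exists V => //; split=> // [|i]; first by rewrite -TV -mulmxA VVt mulmx1.
have -> : \sum_i x i ^+ 2 = c ^+ 2.
  under eq_bigr do rewrite xV exprMn.
  rewrite -big_distrr /=.
  have := congr1 (fun A : 'M_m => A i0 i0) VVt; rewrite !mxE eqxx => E.
  rewrite -[RHS]mulr1; congr (_ * _); apply: etrans E.
  by apply: eq_bigr => l _; rewrite !mxE expr2.
by rewrite sqrtr_sqr gtr0_norm // xV mulKf.
Qed.

(** The two eigenvector matrices have the same first row, so [V' *m V^T] intertwines T and T' and
    fixes e_1; [jacobi_rigid] applies. *)
Lemma moser_unique m (nu x : 'I_m -> R) (T T' : 'M[R]_m) :
  injective nu -> (forall i, 0 < x i) ->
  moser_spec nu x T -> moser_spec nu x T' -> T' = T.
Proof.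
case: m nu x T T' => [|m] nu x T T' nu_inj x_gt0 mT mT'.
  by apply/matrixP => -[].
have [V [VV TE V0] jT] := moser_spec_diag (erefl : ord0 = 0 :> nat) nu_inj mT x_gt0.
have [V' [VV' TE' V0'] jT'] := moser_spec_diag (erefl : ord0 = 0 :> nat) nu_inj mT' x_gt0.
have VVt := mulmx1C VV; have VVt' := mulmx1C VV'.
pose U := V' *m V^T.
have UU : U^T *m U = 1%:M.
  by rewrite /U trmx_mul trmxK mulmxA -(mulmxA V) VV' mulmx1.
have UT : U *m T = T' *m U.
  rewrite TE TE' /U !mulmxA -(mulmxA V' V^T V) VV mulmx1.
  by rewrite -[in RHS](mulmxA _ V'^T V') VV' mulmx1.
have U1 : U = 1%:M.
  apply: jacobi_rigid jT jT' UU UT _ => i j j0.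
  have {j0} -> : j = ord0 by apply/val_inj.
  have := congr1 (fun A : 'M_m.+1 => A i ord0) VVt'; rewrite !mxE => <-.
  by apply: eq_bigr => l _; rewrite !mxE V0 V0'.
by move: UT; rewrite U1 mul1mx mulmx1.
Qed.

(** The rows of [lanczos] are the unit eigenvectors. Their first entries are the values of the
    degree 0 orthonormal polynomial weighted by f, that is, f divided by its norm. *)
Lemma lanczos_moser m (nu f : 'I_m -> R) : (0 < m)%N -> injective nu ->
  (forall i, 0 < f i) -> moser_spec nu f (lanczos_tridiag nu f).
Proof.
move=> m0 nu_inj f_gt0.
have f_neq0 i : f i != 0 by rewrite gt_eqF.
have WW := lanczos_orth nu_inj f_neq0; have WWt := lanczos_orthV nu_inj f_neq0.
set W := lanczos nu f in WW WWt.
have TE : lanczos_tridiag nu f = W^T *m diag_mx (\row_i nu i) *m W^T^T by rewrite trmxK.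
pose i0 := Ordinal m0.
have norm_gt0 : 0 < Num.sqrt (dot (gsu (pkrylov nu f) 0) (gsu (pkrylov nu f) 0)).
  by rewrite sqrtr_gt0 dot_gt0 (gsu_pkrylov_neq0 nu_inj).
have W0 i : W i i0 = (Num.sqrt (dot (gsu (pkrylov nu f) 0) (gsu (pkrylov nu f) 0)))^-1 * f i.
  have -> : W i i0 = gsv (pkrylov nu f) 0 i 0 by rewrite mxE.
  rewrite gsvE mxE; congr (_ * _).
  by rewrite /gsu big_ord0 subr0 mxE expr0 mul1r.
split; first exact: lanczos_jacobi.
split.
  split; first by have [] := lanczos_jacobi nu_inj f_neq0.
  by move=> a; rewrite TE; apply: diag_conj_eigenvalue; rewrite trmxK.
exists (fun i => col i W^T); split=> [i|].
  split.
  - rewrite colE /lanczos_tridiag -/W -!mulmxA (mulmxA W) WWt mul1mx scalemxAr.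
    congr (_ *m _); apply/colP => a; rewrite mul_diag_mx !mxE.
    by case: eqP => [->|]; rewrite ?mulr0.
  - have := congr1 (fun A : 'M_m => A i i) WWt; rewrite !mxE eqxx dotE; apply: etrans.
    by apply: eq_bigr => l _; rewrite !mxE.
  - rewrite (basis1_dot _ (erefl : i0 = 0 :> nat)) 2!mxE.
    by rewrite W0 mulr_gt0 ?invr_gt0.
exists (Num.sqrt (dot (gsu (pkrylov nu f) 0) (gsu (pkrylov nu f) 0))).
  by rewrite gt_eqF.
move=> i; rewrite (basis1_dot _ (erefl : i0 = 0 :> nat)) 2!mxE W0.
by rewrite mulVKf // gt_eqF.
Qed.

End Moser.

(** * Tridiagonalization in spectral coordinates *)

Section Tridiagonalization.
Variable R : realType.

Lemma tridiagE N (S : 'M[R]_N) m : krylov_dim S = m ->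
  tridiag S = Sqmx (let A : 'M_(N, m) := \matrix_(i, j) gsv (krylov S) j i 0 in
                    A^T *m S *m A).
Proof.
move<-; rewrite /tridiag; congr Sqmx.
have -> : \matrix_(i, j) (nth 0 (gram_schmidt (mkseq (krylov S) (krylov_dim S))) j) i 0
   = \matrix_(i < N, j < krylov_dim S) gsv (krylov S) j i 0 => //.
by apply/matrixP => i j; rewrite !mxE gram_schmidt_mkseq nth_mkseq.
Qed.

Section Spectral.
Variables (N m : nat) (S G : 'M[R]_N) (mu : 'I_N -> R) (i0 : 'I_N) (s : 'I_m -> 'I_N).
Hypotheses (i00 : i0 = 0 :> nat) (GG : G^T *m G = 1%:M).
Hypothesis SE : S *m G = G *m diag_mx (\row_a mu a).
Hypotheses (s_inj : injective s) (mu_inj : injective mu).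
Hypothesis s_supp : forall a, G i0 a != 0 <-> exists i, a = s i.

Let nu i := mu (s i).
Let f i := `|G i0 (s i)|.
(** The eigenvectors not orthogonal to e_1, with signs chosen to make their first entries the
    positive numbers [f i]. *)
Let E : 'M[R]_(N, m) := \matrix_(b, i) (G b (s i) * Num.sg (G i0 (s i))).

Let nu_inj : injective nu. Proof. by move=> i j /mu_inj/s_inj. Qed.

Let f_neq0 i : f i != 0.
Proof. by rewrite normr_eq0; apply/s_supp; exists i. Qed.

Let EE : E^T *m E = 1%:M.
Proof.
apply/matrixP => i j; rewrite !mxE.
transitivity (Num.sg (G i0 (s i)) * Num.sg (G i0 (s j)) * (G^T *m G) (s i) (s j)).
  rewrite mxE big_distrr /=; apply: eq_bigr => b _; rewrite !mxE.
  by rewrite mulrACA mulrC [G b _ * _]mulrC.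
rewrite GG mxE (inj_eq s_inj); case: eqP => [<-|]; last by rewrite mulr0.
by rewrite mulr1 -expr2 sqr_sg (s_supp _).2 //; exists i.
Qed.

Let SEE : S *m E = E *m diag_mx (\row_i nu i).
Proof.
apply/matrixP => b i; have := congr1 (fun A : 'M_N => A b (s i)) SE.
rewrite !mul_mx_diag !mxE => SGi.
under eq_bigr do rewrite mxE mulrA.
by rewrite -big_distrl /= SGi mulrAC.
Qed.

Let krylovE j : krylov S j = E *m pkrylov nu f j.
Proof.
elim: j => [|j IH]; last first.
  rewrite /krylov iterS -/(krylov S j) IH mulmxA SEE -mulmxA; congr (_ *m _).
  by apply/colP => i; rewrite mul_diag_mx !mxE exprS mulrA.
apply/colP => b; rewrite /= !mxE.
have GGt := mulmx1C GG.
(* Completeness of the eigenbasis expands e_1; the columns of G outside the range of s have first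
   entry 0 and drop out. *)
transitivity ((G *m G^T) b i0).
  by rewrite GGt mxE -(inj_eq val_inj) /= i00.
rewrite mxE (bigID (mem (s @: 'I_m))) /= addrC big1 ?add0r => [|a ns]; last first.
  rewrite mxE; case: (eqVneq (G i0 a) 0) => [->|/s_supp[i aE]]; first by rewrite mulr0.
  by rewrite aE imset_f ?inE in ns.
rewrite big_imset /=; last by move=> i j _ _ /s_inj.
apply: eq_big => [i|i _]; first by rewrite inE.
by rewrite !mxE expr0 mul1r /f -mulrA -numEsg.
Qed.

Let le_mN : (m <= N)%N.
Proof. by have := max_card (mem (codom s)); rewrite card_codom // !card_ord. Qed.

Lemma krylov_dim_spectral : krylov_dim S = m.
Proof.
pose P : 'M[R]_(N, m) := \matrix_(j, i) pkrylov nu f j i 0.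
have -> : krylov_dim S = \rank (P *m E^T).
  congr (\rank _); apply/matrixP => j b.
  rewrite mxE [in LHS]mxE krylovE !mxE; apply: eq_bigr => i _.
  by rewrite !mxE mulrC.
rewrite mxrankMfree; last by apply/row_freeP; exists E.
apply/eqP/row_fullP.
have /fin_all_exists[p pP] (j : 'I_m) : exists p : {poly R},
    (size p <= N)%N /\ gsv (pkrylov nu f) j = peval nu f p.
  have [p [_ [sp _ _ _ [pE _]]]] := peval_gs nu f j.
  by exists p; split=> //; apply: leq_trans sp (leq_trans (ltn_ord j) le_mN).
(* A left inverse of P: the coefficients of the orthonormal polynomials turn the monomial values P
   into the transpose of [lanczos]. *)
exists (lanczos nu f *m \matrix_(j, l) (p j)`_l).
rewrite -mulmxA -[RHS](lanczos_orthV nu_inj f_neq0); congr (_ *m _).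
apply/matrixP => j i; rewrite !mxE (pP j).2 mxE (horner_coef_wide _ (pP j).1).
by rewrite big_distrl; apply: eq_bigr => l _; rewrite !mxE mulrA.
Qed.

Lemma tridiag_spectral :
  tridiag S = Sqmx (lanczos_tridiag (fun i => mu (s i)) (fun i => `|G i0 (s i)|)).
Proof.
rewrite (tridiagE krylov_dim_spectral) /=; congr Sqmx.
have -> : \matrix_(i, j) gsv (krylov S) j i 0 = E *m lanczos nu f.
  apply/matrixP => b j; rewrite mxE (eq_gsv krylovE) gsv_isometry // !mxE.
  by apply: eq_bigr => i _; rewrite !mxE.
rewrite trmx_mul -!mulmxA (mulmxA S) SEE (mulmxA E^T) (mulmxA E^T) EE mul1mx.
by rewrite /lanczos_tridiag -!mulmxA.
Qed.

End Spectral.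

Lemma moser_spec_scale m (nu x y : 'I_m -> R) (T : 'M[R]_m) c : c != 0 ->
  (forall i, y i = c * x i) -> moser_spec nu x T -> moser_spec nu y T.
Proof.
move=> c0 yE [jT [sT [v [vP [d d0 xE]]]]]; split=> //; split=> //.
exists v; split=> //; exists (c * d); first by rewrite mulf_neq0.
by move=> i; rewrite yE xE mulrA.
Qed.

Lemma mem_support_by N (mu : 'I_N -> R) (x : 'cV[R]_N) a :
  (a \in support_by mu x) = (x a 0 != 0).
Proof. by rewrite mem_sort mem_filter mem_enum andbT. Qed.

Lemma support_by_uniq N (mu : 'I_N -> R) (x : 'cV[R]_N) : uniq (support_by mu x).
Proof. by rewrite sort_uniq filter_uniq ?enum_uniq. Qed.

Lemma tnth_support_inj N (mu : 'I_N -> R) (x : 'cV[R]_N) :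
  injective (tnth (in_tuple (support_by mu x))).
Proof. exact/tuple_uniqP/support_by_uniq. Qed.

Lemma tnth_support N (mu : 'I_N -> R) (x : 'cV[R]_N) a :
  x a 0 != 0 <-> exists i, a = tnth (in_tuple (support_by mu x)) i.
Proof.
rewrite -(mem_support_by mu).
by split=> [/(tnthP (in_tuple _))|[i ->]]; last exact: mem_tnth.
Qed.

Lemma is_moser_abs_spectral N (S G : 'M[R]_N) mu (i0 : 'I_N) (x : 'cV[R]_N) c :
  i0 = 0 :> nat -> G^T *m G = 1%:M -> S *m G = G *m diag_mx (\row_a mu a) ->
  injective mu -> 0 < c -> (forall a, `|x a 0| = c * `|G i0 a|) ->
  is_moser_abs mu x (tridiag S).
Proof.
move=> i00 GG SG mu_inj c_gt0 xE.
set s := tnth (in_tuple (support_by mu x)).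
have s_inj : injective s by apply: tnth_support_inj.
have x_supp a : x a 0 != 0 <-> exists i, a = s i by apply: tnth_support.
have G_supp a : G i0 a != 0 <-> exists i, a = s i.
  rewrite -x_supp -[x a 0 == 0]normr_eq0 xE mulf_eq0 (gt_eqF c_gt0) normr_eq0.
  by [].
exists (lanczos_tridiag (fun i => mu (s i)) (fun i => `|G i0 (s i)|)).
  exact: tridiag_spectral.
have nu_inj : injective (mu \o s) by apply: inj_comp.
have x_gt0 i : 0 < `|x (s i) 0| by rewrite normr_gt0; apply/x_supp; exists i.
have G_gt0 i : 0 < `|G i0 (s i)| by rewrite normr_gt0; apply/G_supp; exists i.
(* A row of an orthogonal matrix is not zero, so the support is nonempty. *)
have m_gt0 : (0 < size (support_by mu x))%N.
  suff [a /G_supp[i _]] : exists a, G i0 a != 0 by apply: leq_ltn_trans (ltn_ord i).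
  apply/existsP; apply: contraT => /existsPn G0.
  have := congr1 (fun A : 'M_N => A i0 i0) (mulmx1C GG).
  rewrite !mxE eqxx big1 => [/eqP|a _]; first by rewrite eq_sym oner_eq0.
  by have := G0 a; rewrite negbK => /eqP->; rewrite mul0r.
have spec : moser_spec (mu \o s) (fun i => `|x (s i) 0|)
    (lanczos_tridiag (fun i => mu (s i)) (fun i => `|G i0 (s i)|)).
  apply: moser_spec_scale (lt0r_neq0 c_gt0) (fun i => xE (s i)) _.
  exact: lanczos_moser.
split=> // T'; apply: moser_unique nu_inj x_gt0 spec.
Qed.

Definition sqmx_eigenvalue (S : sqmx R) (a : R) : Prop := eigenvalue (tagged S) a.

Lemma Sqmx_inj m : injective (@Sqmx R m).
Proof. by move=> T T' /eqP; rewrite eq_Tagged => /eqP. Qed.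

(* The eigenvalues of S determine the support, and its unit eigenvectors the
   nonzero coordinates up to sign and scaling. *)
Lemma is_moser_abs_determines N (mu : 'I_N -> R) (x x' : 'cV[R]_N) (S : sqmx R) :
  injective mu -> is_moser_abs mu x S -> is_moser_abs mu x' S ->
  exists2 c, 0 < c & forall a, `|x a 0| = c * `|x' a 0|.
Proof.
move=> mu_inj mx mx'.
have supp (y : 'cV[R]_N) : is_moser_abs mu y S ->
    forall a, y a 0 != 0 <-> sqmx_eigenvalue S (mu a).
  case=> T -> [[_ [[_ eigT] _]] _] a; rewrite /sqmx_eigenvalue /= eigT.
  split=> [/(tnth_support mu)[i ->]|[i /mu_inj aE]]; first by exists i.
  by apply/(tnth_support mu); exists i.
have supp_eq : support_by mu x = support_by mu x'.
  congr sort; apply: eq_filter => a; apply/idP/idP.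
    by move=> /(supp _ mx)/(supp _ mx').
  by move=> /(supp _ mx')/(supp _ mx).
have x_gt0 i : 0 < `|x (tnth (in_tuple (support_by mu x)) i) 0|.
  by rewrite normr_gt0; apply/(tnth_support mu); exists i.
have x'_gt0 i : 0 < `|x' (tnth (in_tuple (support_by mu x)) i) 0|.
  by rewrite normr_gt0; apply/(tnth_support mu); rewrite -supp_eq; exists i.
move: mx mx'; rewrite /is_moser_abs -supp_eq => -[T ->] [spec _] [T'] /Sqmx_inj TT' [spec' _].
rewrite -{}TT' in spec' => {supp T'}.
have nu_inj := inj_comp mu_inj (@tnth_support_inj _ mu x).
have zero a : x a 0 == 0 -> x' a 0 == 0.
  move=> xa0; apply: contraLR xa0 => xa'.
  by rewrite -(mem_support_by mu) supp_eq mem_support_by.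
have := @tnth_support _ mu x; move: supp_eq x_gt0 x'_gt0 spec spec' nu_inj => _.
set s := tnth _; set m := size _ in s T * => x_gt0 x'_gt0 spec spec' nu_inj s_supp.
(* With empty support both vectors vanish and the constant 1 will do. *)
have [m0|m0] := posnP m.
  exists 1 => // a.
  have xa0 : x a 0 == 0.
    by apply/negPn/negP => /s_supp[i _]; have := ltn_ord i; rewrite {2}m0.
  by rewrite (eqP xa0) (eqP (zero _ xa0)) normr0 mulr0.
pose i0 := Ordinal m0.
have [V [VV TE V0] _] := moser_spec_diag (erefl : i0 = 0 :> nat) nu_inj spec x_gt0.
have [V' [VV' TE' V0'] _] := moser_spec_diag (erefl : i0 = 0 :> nat) nu_inj spec' x'_gt0.
pose norm (y : 'cV[R]_N) := Num.sqrt (\sum_i `|y (s i) 0| ^+ 2).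
have norm_gt0 (y : 'cV[R]_N) : (forall i, 0 < `|y (s i) 0|) -> 0 < norm y.
  move=> y_gt0; rewrite sqrtr_gt0 (bigD1 i0) //= ltr_pwDl ?exprn_gt0 //.
  by rewrite sumr_ge0 // => i _; rewrite exprn_ge0.
have nx := norm_gt0 _ x_gt0; have nx' := norm_gt0 _ x'_gt0.
(* V and V' diagonalize the same matrix with simple spectrum, so they differ by signs of columns;
   these are trivial because both first rows are positive. *)
have VV0 i : V i0 i = V' i0 i.
  pose U := V^T *m V'; pose D : 'M[R]_m := diag_mx (\row_i mu (s i)).
  have DU : D *m U = U *m D.
    have TV : T *m V' = V' *m D by rewrite TE' -mulmxA VV' mulmx1.
    have VT : V^T *m T = D *m V^T by rewrite TE !mulmxA VV mul1mx.
    by rewrite /U mulmxA -VT -mulmxA TV mulmxA.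
  have U0 j l : j != l -> U j l = 0.
    move=> jl; have := congr1 (fun A : 'M_m => A j l) DU.
    rewrite mul_diag_mx mul_mx_diag !mxE mulrC => /eqP.
    rewrite -subr_eq0 -mulrBr mulf_eq0 subr_eq0 => /orP[/eqP//|/eqP/nu_inj jlE].
    by rewrite jlE eqxx in jl.
  have V'E : V' i0 i = V i0 i * U i i.
    have -> : V' i0 i = (V *m U) i0 i by rewrite mulmxA (mulmx1C VV) mul1mx.
    rewrite mxE (bigD1 i) //= big1 ?addr0 // => l li.
    by rewrite U0 ?mulr0.
  have Ui : U i i ^+ 2 = 1.
    have UU : U^T *m U = 1%:M.
      by rewrite /U trmx_mul trmxK mulmxA -(mulmxA V'^T) (mulmx1C VV) mulmx1.
    have := congr1 (fun A : 'M_m => A i i) UU.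
    rewrite [X in X = _ -> _]mxE [X in _ = X -> _]mxE eqxx.
    rewrite (bigD1 i) //= big1 ?addr0 => [|l li]; last by rewrite U0 ?mulr0.
    by rewrite [U^T _ _]mxE -expr2.
  have Vp : 0 < V i0 i by rewrite V0 mulr_gt0 ?invr_gt0.
  have V'p : 0 < V' i0 i by rewrite V0' mulr_gt0 ?invr_gt0.
  have Up : 0 < U i i by rewrite -(pmulr_rgt0 _ Vp) -V'E.
  move/eqP: Ui; rewrite sqrf_eq1 => /orP[/eqP Ui|/eqP Ui].
    by rewrite V'E Ui mulr1.
  by rewrite Ui ltr0N1 in Up.
exists (norm x / norm x'); first by rewrite divr_gt0.
move=> a; case: (boolP (x a 0 == 0)) => [xa0|/s_supp[i ->]].
  by rewrite (eqP xa0) (eqP (zero _ xa0)) normr0 mulr0.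
have := VV0 i; rewrite V0 V0' => /(congr1 ( *%R (norm x))).
by rewrite mulVKf ?gt_eqF // mulrA.
Qed.

End Tridiagonalization.

(** * Bruhat decomposition *)

Section Upper.
Variable F : fieldType.

Definition upper n (b : 'M[F]_n) := forall i j : 'I_n, (j < i)%N -> b i j = 0.

Lemma upper_det n (b : 'M[F]_n) : upper b -> \det b = \prod_i b i i.
Proof.
move=> ub; rewrite -det_tr det_trig; last first.
  by apply/is_trig_mxP => i j ij; rewrite mxE ub.
by apply: eq_bigr => i _; rewrite mxE.
Qed.

Lemma upper_unit n (b : 'M[F]_n) : upper b ->
  b \in unitmx <-> forall i, b i i != 0.
Proof.
move=> ub; rewrite unitmxE unitfE upper_det //.
split=> [/prodf_neq0 bn0 i|bn0]; first exact: bn0.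
by apply/prodf_neq0 => i _; apply: bn0.
Qed.

Lemma upper1 n : upper (1%:M : 'M[F]_n).
Proof. by move=> i j ji; rewrite mxE -(inj_eq val_inj) gtn_eqF. Qed.

Lemma upper_diag n (d : 'I_n -> F) : upper (diag_mx (\row_i d i)).
Proof. by move=> i j ji; rewrite !mxE -(inj_eq val_inj) gtn_eqF. Qed.

Lemma upper_mul n (b c : 'M[F]_n) : upper b -> upper c -> upper (b *m c).
Proof.
move=> ub uc i j ji; rewrite mxE big1 // => l _.
have [il|li] := leqP i l; first by rewrite uc ?mulr0 // (leq_trans ji).
by rewrite ub ?mul0r.
Qed.

(** Back substitution from the last row: below the diagonal, only the term l = i survives in entry
    (i, j) of [b *m invmx b]. *)
Lemma upper_inv n (b : 'M[F]_n) : upper b -> b \in unitmx -> upper (invmx b).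
Proof.
move=> ub bu; have bn0 := (upper_unit ub).1 bu.
have claim k : forall i j : 'I_n, (n - i <= k)%N -> (j < i)%N -> invmx b i j = 0.
  elim: k => [|k IH] i j ik ji.
    by move: ik; rewrite leqn0 subn_eq0 leqNgt ltn_ord.
  have := congr1 (fun A : 'M_n => A i j) (mulmxV bu).
  rewrite [X in X = _ -> _]mxE [X in _ = X -> _]mxE -(inj_eq val_inj) gtn_eqF //.
  rewrite (bigD1 i) //= big1 ?addr0 => [/eqP|l].
    by rewrite mulf_eq0 (negPf (bn0 i)) => /eqP.
  rewrite -(inj_eq val_inj) neq_lt => /orP[] li; first by rewrite ub ?mul0r.
  rewrite IH ?mulr0 ?(ltn_trans ji) // -ltnS; apply: leq_trans ik.
  by rewrite ltn_sub2l.
by move=> i j; apply: claim (leqnn _).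
Qed.

(** Gaussian elimination with the lowest nonzero entry of column k as pivot: clearing the column
    then affects only rows above the pivot, and clearing the pivot row only columns to the right of
    k, so both factors are upper triangular. *)
Lemma Bruhat_step n (h : 'M[F]_n) (w : 'I_n -> 'I_n) (k : 'I_n) : h \in unitmx ->
  (forall (i j : 'I_n), (j < k)%N -> h i j = (i == w j)%:R) ->
  (forall (j l : 'I_n), (j < k)%N -> h (w j) l = (l == j)%:R) ->
  exists b c w', [/\ upper b /\ b \in unitmx, upper c /\ c \in unitmx,
    (forall (i j : 'I_n), (j <= k)%N -> (b *m h *m c) i j = (i == w' j)%:R) &
    (forall (j l : 'I_n), (j <= k)%N -> (b *m h *m c) (w' j) l = (l == j)%:R)].
Proof.
move=> hu hc hr.
have [r0 r0P] : exists r, h r k != 0.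
  apply/existsP; apply: contraT => /existsPn h0.
  have : h *m delta_mx k (0 : 'I_1) = 0.
    apply/colP => i; rewrite -colE !mxE.
    by apply/eqP; have := h0 i; rewrite negbK.
  move/(congr1 (mulmx (invmx h))); rewrite mulKmx // mulmx0 => /colP/(_ k)/eqP.
  by rewrite !mxE !eqxx oner_eq0.
case: (arg_maxnP (P := [pred r | h r k != 0]) val r0P) => r /= x_neq0 r_max.
set x := h r k in x_neq0.
have below (i : 'I_n) : (r < i)%N -> h i k = 0.
  by move=> ri; apply/eqP; apply: contraTT ri => /r_max; rewrite -leqNgt.
have rw (j : 'I_n) : (j < k)%N -> r != w j.
  move=> jk; apply: contraNneq x_neq0 => rE.
  by rewrite /x rE hr // -(inj_eq val_inj) gtn_eqF.
pose u i := if i == r then 0 else h i k / x.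
pose b := 1%:M - (\col_i u i) *m delta_mx (0 : 'I_1) r.
(* [c] normalizes the pivot and clears its row to the right of k; to the left of k, that row is
   already zero. *)
pose c := \matrix_(a, l) (if a == l then (if l == k then x^-1 else 1)
                          else if (a == k) && (k < l)%N then - (h r l / x) else 0).
have bE i l : b i l = (i == l)%:R - u i * (l == r)%:R.
  by rewrite !mxE big_ord1 !mxE eqxx.
have ub : upper b.
  move=> i j ji; rewrite bE -(inj_eq val_inj) gtn_eqF // /u.
  case: (eqVneq j r) => [jr|]; last by rewrite mulr0 subrr.
  by rewrite ifN ?below ?mul0r ?subrr -?jr // -(inj_eq val_inj) gtn_eqF.
have uc : upper c.
  move=> i j ji; rewrite mxE -(inj_eq val_inj) gtn_eqF //.
  by case: (eqVneq i k) => //= ik; rewrite -ik ltnNge (ltnW ji).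
have bu : b \in unitmx.
  apply/(upper_unit ub) => i; rewrite bE eqxx /u.
  by case: (eqVneq i r) => _ /=; rewrite ?mul0r ?mulr0 subr0 oner_neq0.
have cu : c \in unitmx.
  apply/(upper_unit uc) => i; rewrite mxE eqxx.
  by case: (eqVneq i k) => _; rewrite ?invr_eq0 ?oner_neq0.
have bh (y : 'M[F]_n) i l : (b *m y) i l = y i l - u i * y r l.
  by rewrite mulmxBl mul1mx -mulmxA -rowE !mxE big_ord1 !mxE.
have hcE i l : (h *m c) i l =
    if l == k then h i k / x
    else h i l + (if (k < l)%N then - (h i k * (h r l / x)) else 0).
  rewrite mxE (bigD1 l) //= mxE eqxx; case: (eqVneq l k) => [->|lk].
    rewrite big1 ?addr0 // => a ak.
    by rewrite mxE (negPf ak) ltnn andbF mulr0.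
  rewrite mulr1 (bigD1 k) 1?eq_sym //= big1 ?addr0 => [|a /andP[al ak]].
    rewrite mxE eqxx eq_sym (negPf lk) /=.
    by case: ifP => _; rewrite ?mulr0 // mulrN.
  by rewrite mxE (negPf al) (negPf ak) mulr0.
pose w' j := if j == k then r else w j.
have w'k : w' k = r by rewrite /w' eqxx.
have w'j (j : 'I_n) : (j < k)%N -> w' j = w j.
  by move=> jk; rewrite /w' -(inj_eq val_inj) ltn_eqF.
exists b, c, w'; split=> // [i j|j l].
  rewrite leq_eqVlt => /orP[/eqP/val_inj->|jk].
    rewrite w'k -mulmxA bh !hcE eqxx divff // mulr1 /u.
    by case: eqP => [->|_]; rewrite ?divff ?subr0 ?subrr.
  have jk' : (j == k) = false by rewrite -(inj_eq val_inj) ltn_eqF.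
  rewrite w'j // -mulmxA bh !hcE jk' ltnNge (ltnW jk) /= !addr0 !hc //.
  by rewrite (negPf (rw j jk)) mulr0 subr0.
rewrite leq_eqVlt => /orP[/eqP/val_inj->|jk].
  rewrite w'k -mulmxA bh /u eqxx mul0r subr0 hcE.
  case: (eqVneq l k) => [_|lk]; first by rewrite divff.
  have [kl|lk'|/val_inj E] := ltngtP k l; last by rewrite E eqxx in lk.
    by rewrite mulrC divfK // subrr.
  by rewrite addr0 hc // (negPf (rw l lk')).
have kj : (k == j) = false by rewrite -(inj_eq val_inj) gtn_eqF.
rewrite w'j // -mulmxA bh /u eq_sym (negPf (rw j jk)) hr // kj mul0r mul0r subr0.
rewrite hcE !hr // kj !mul0r oppr0 if_same addr0.
by case: eqP => // ->; rewrite kj.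
Qed.

Lemma Bruhat_decomposition n (g : 'M[F]_n) : g \in unitmx ->
  exists b (w : {perm 'I_n}) c, [/\ upper b /\ b \in unitmx, upper c /\ c \in unitmx &
    g = b *m (\matrix_(i, j) (i == w j)%:R) *m c].
Proof.
move=> gu.
have [k kn] : exists k, k = n by exists n.
have : exists b c (w : 'I_n -> 'I_n), [/\ upper b /\ b \in unitmx, upper c /\ c \in unitmx,
    (forall (i j : 'I_n), (j < k)%N -> (b *m g *m c) i j = (i == w j)%:R) &
    (forall (j l : 'I_n), (j < k)%N -> (b *m g *m c) (w j) l = (l == j)%:R)].
  have : (k <= n)%N by rewrite kn.
  elim: {kn} k => [_|k IH kn].
    exists 1%:M, 1%:M, id; split=> //; split; rewrite ?unitmx1 //; exact: upper1.
  have [b [c [w [[ub bu] [uc cu] hc hr]]]] := IH (ltnW kn).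
  have hu : b *m g *m c \in unitmx by rewrite !unitmx_mul bu gu cu.
  have [b' [c' [w' [[ub' bu'] [uc' cu'] hc' hr']]]] :=
    @Bruhat_step n _ w (Ordinal kn) hu hc hr.
  exists (b' *m b), (c *m c'), w'; split.
  - by split; [apply: upper_mul|rewrite unitmx_mul bu' bu].
  - by split; [apply: upper_mul|rewrite unitmx_mul cu' cu].
  - by move=> i j jk; rewrite -hc' // !mulmxA.
  - by move=> j l jk; rewrite -hr' // !mulmxA.
rewrite {}kn => -[b [c [w [[ub bu] [uc cu] hc hr]]]].
have w_inj : injective w.
  move=> j l jl; have := hr j l (ltn_ord j); rewrite hc // -jl eqxx.
  by case: (eqVneq l j) => [->//|_ /eqP]; rewrite oner_eq0.
exists (invmx b), (perm w_inj), (invmx c).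
split; rewrite ?unitmx_inv; do ?[by split=> //; apply: upper_inv].
have -> : \matrix_(i, j) (i == perm w_inj j)%:R = b *m g *m c.
  by apply/matrixP => i j; rewrite mxE permE hc.
by rewrite -mulmxA mulmxK // mulKmx.
Qed.

End Upper.

Section Minors.
Variable K : comPzRingType.

Lemma wedge_col_perm n k (X : 'M[K]_(n, k)) (s : {perm 'I_k}) :
  wedge (colsub s X) = (-1) ^+ s *: wedge X.
Proof.
have -> : colsub s X = X *m (perm_mx s)^T.
  by rewrite tr_perm_mx -col_permE; apply/matrixP => i j; rewrite !mxE.
by rewrite wedge_mulr det_tr det_perm.
Qed.

Lemma mul_pid n k (g : 'M[K]_n) (kn : (k <= n)%N) :
  g *m (pid_mx k : 'M_(n, k)) = colsub (widen_ord kn) g.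
Proof.
apply/matrixP => i j; rewrite !mxE (bigD1 (widen_ord kn j)) //= big1 ?addr0.
  by rewrite !mxE eqxx /= ltn_ord mulr1.
by move=> l lj; rewrite mxE (_ : (l == j :> nat) = false) ?mulr0 //; apply/negbTE.
Qed.

(** The first k columns of the permutation matrix wedge to a signed basis vector, c contributes a
    scalar, and b acts by its compound. *)
Lemma minors_cell n k (w : {perm 'I_n}) (b c : 'M[K]_n) : (k <= n)%N ->
  (forall i j : 'I_n, (j < i)%N -> c i j = 0) ->
  exists a (e : bool),
    [set i in ksub a]%SET = [set w j | j : 'I_n & (j < k)%N]%SET /\
    minors k (b *m (\matrix_(i, j) (i == w j)%:R) *m c) =
    (\prod_(i < n | (i < k)%N) c i i * (-1) ^+ e) *: col a (compound k b).
Proof.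
move=> kn c0.
have [|a [s wE]] := @ksub_perm n k (w \o widen_ord kn).
  by move=> i j /= /perm_inj /(congr1 val) /= ij; apply/val_inj.
exists a, (s : bool); split.
  apply/setP => x; rewrite inE; apply/idP/idP => [/tnthP[i ->]|/imsetP[j]].
    apply/imsetP; exists (widen_ord kn (s^-1%g i)); first by rewrite inE /=.
    by have /= -> := wE (s^-1%g i); rewrite permKV.
  rewrite inE => jk ->; have /= := wE (Ordinal jk).
  have -> : widen_ord kn (Ordinal jk) = j by apply/val_inj.
  by move=> ->; apply: mem_tnth.
rewrite minors_upper // -scalerA; congr (_ *: _).
rewrite minors_mul /minors (mul_pid _ kn).
have -> : colsub (widen_ord kn) (\matrix_(i, j) (i == w j)%:R) =
    colsub s (colsub (tnth (ksub a)) (1%:M : 'M[K]_n)).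
  by apply/matrixP => i j; rewrite !mxE; have /= -> := wE j.
rewrite wedge_col_perm -scalemxAr; congr (_ *: _).
have -> : wedge (colsub (tnth (ksub a)) (1%:M : 'M[K]_n)) = col a (compound k 1%:M).
  apply/colP => d; rewrite !mxE; congr (\det _).
  by apply/matrixP => i j; rewrite !mxE.
by rewrite !colE compound1 mul1mx.
Qed.

End Minors.

(** * Canonical representatives of unitary matrices *)

Section CanonicalRep.
Variable R : realType.
Local Notation C := R[i].

Lemma cplxM m n p (A : 'M[R]_(m, n)) (B : 'M[R]_(n, p)) :
  cplx (A *m B) = cplx A *m cplx B.
Proof. exact: map_mxM. Qed.

Lemma cplx1 n : cplx (1%:M : 'M[R]_n) = 1%:M.
Proof. exact: map_mx1. Qed.

Lemma cplx_tr m n (A : 'M[R]_(m, n)) : cplx A^T = (cplx A)^T.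
Proof. by rewrite /cplx map_trmx. Qed.

Lemma cplx_diag n (d : 'I_n -> R) :
  cplx (diag_mx (\row_i d i)) = diag_mx (\row_i (d i)%:C%C).
Proof.
by apply/matrixP => i j; rewrite !mxE rmorphMn.
Qed.

Lemma minors_cplx n k (g : 'M[R]_n) : minors k (cplx g) = cplx (minors k g).
Proof.
apply/colP => a; rewrite !mxE -det_map_mx; congr (\det _).
apply/matrixP => i j; rewrite !mxE rmorph_sum; apply: eq_bigr => l _.
by rewrite !mxE rmorphM /= rmorph_nat.
Qed.

Lemma unitarymx_cplx n (Q : 'M[R]_n) : Q^T *m Q = 1%:M -> cplx Q \is unitarymx.
Proof.
move=> QQ; apply/unitarymxP.
have -> : ((cplx Q)^t* )%sesqui = (cplx Q)^T.
  by apply/matrixP => i j; rewrite !mxE; apply/CrealP; rewrite complex_real.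
by rewrite -cplx_tr -cplxM (mulmx1C QQ) cplx1.
Qed.

Lemma invmx_orth (F : fieldType) n (Q : 'M[F]_n) : Q^T *m Q = 1%:M -> invmx Q = Q^T.
Proof.
move=> QQ; have [_ Qu] := mulmx1_unit QQ.
by rewrite -[LHS]mul1mx -QQ mulmxK.
Qed.

Lemma minors_neq0 (F : fieldType) n k (g : 'M[F]_n) : (k <= n)%N -> g \in unitmx ->
  minors k g != 0.
Proof.
move=> kn gu; apply/eqP => g0.
have bin0 : (0 < 'C(n, k))%N by rewrite bin_gt0.
have := minors_mul k (invmx g) g; rewrite mulVmx // g0 mulmx0.
move/colP/(_ (Ordinal bin0)) => /eqP.
by rewrite (@minorsE _ _ _ _ _ (Ordinal bin0) erefl) compound1 !mxE eqxx oner_eq0.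
Qed.

(** By [minors_cell] the minors form a multiple of a column of an upper triangular compound, which
    ends at its nonzero diagonal entry. *)
Lemma schubert_cell_minors n k (w : {perm 'I_n}) (g : 'M[C]_n) : (k <= n)%N ->
  schubert_cell w g ->
  exists2 a, [set i in ksub a]%SET = [set w j | j : 'I_n & (j < k)%N]%SET &
    minors k g a 0 != 0 /\
    forall b : 'I_('C(n, k)), (a < b)%N -> minors k g b 0 = 0.
Proof.
move=> kn [b [c [[bu ub] [cu uc] ->]]].
have [a [e [aE ->]]] := minors_cell w b kn uc.
exists a => //; split=> [|d ad]; rewrite !mxE; last first.
  by have := compound_upper ub ad; rewrite mxE => ->; rewrite mulr0.
have := compound_diag_upper ub a; rewrite mxE => ->.
have bn0 := (upper_unit ub).1 bu; have cn0 := (upper_unit uc).1 cu.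
rewrite !mulf_neq0 ?signr_eq0 ?prodf_seq_neq0 //.
  by apply/allP => i _; apply/implyP.
by apply/allP => i _ /=; apply: bn0.
Qed.

Lemma canonical_rep_minors n k (g : 'M[C]_n) : (0 < k <= n)%N -> canonical_rep g ->
  exists a, 0 < minors k g a 0 /\
    forall b : 'I_('C(n, k)), (a < b)%N -> minors k g b 0 = 0.
Proof.
move=> /andP[k0 kn] [_ [w [cell pos]]].
have [a aE _] := schubert_cell_minors kn cell.
by exists a; apply: pos aE; rewrite k0.
Qed.

(** Proportional vectors have their last nonzero entry at the same place, where both are
    positive. *)
Lemma lead_minor_unique N (x y : 'cV[C]_N) (a b : 'I_N) (d : C) : d != 0 ->
  y = d *: x -> 0 < x a 0 -> (forall l : 'I_N, (a < l)%N -> x l 0 = 0) ->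
  0 < y b 0 -> (forall l : 'I_N, (b < l)%N -> y l 0 = 0) -> 0 < d.
Proof.
move=> d0 yE xa x0 yb y0.
have ab : a = b.
  apply/val_inj; case: (ltngtP a b) => // lt_ab.
    by move: yb; rewrite yE mxE x0 // mulr0 ltxx.
  have /eqP := y0 a lt_ab; rewrite yE mxE mulf_eq0 (negPf d0) => /eqP xa0.
  by rewrite xa0 ltxx in xa.
by move: yb; rewrite yE mxE -ab pmulr_lgt0.
Qed.

Lemma pos_norm1 (d : C) : 0 < d -> `|d| = 1 -> d = 1.
Proof. by move=> d_gt0; rewrite gtr0_norm. Qed.

Lemma partial_prod_eq1 (F : idomainType) n (d : 'I_n -> F) :
  (forall k, (0 < k <= n)%N -> \prod_(i < n | (i < k)%N) d i = 1) ->
  forall i, d i = 1.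
Proof.
move=> prod1 i.
have prod1' k : (k <= n)%N -> \prod_(i < n | (i < k)%N) d i = 1.
  by case: k => [|k] kn; [rewrite big_pred0|apply: prod1].
have := prod1' i.+1 (ltn_ord i); rewrite (bigD1 i) ?leqnn //=.
rewrite (eq_bigl (fun j : 'I_n => (j < i)%N)) => [|j].
  by rewrite prod1' ?mulr1 // ltnW.
by rewrite ltnS andbC [RHS]ltn_neqAle.
Qed.

(** The k-th Plücker vector is multiplied by the product of the first k phases. This product is
    positive by [lead_minor_unique] and has modulus 1. *)
Lemma canonical_rep_unique n (g : 'M[C]_n) (d : 'I_n -> C) :
  (forall i, `|d i| = 1) -> canonical_rep g ->
  canonical_rep (g *m diag_mx (\row_i d i)) -> forall i, d i = 1.
Proof.
move=> d1 cg cg'; apply: partial_prod_eq1 => k kn; have /andP[_ kn'] := kn.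
have [a [xa x0]] := canonical_rep_minors kn cg.
have [b [yb y0]] := canonical_rep_minors kn cg'.
have normd : `|\prod_(i < n | (i < k)%N) d i| = 1.
  by rewrite normr_prod big1.
apply: pos_norm1 => //.
apply: (lead_minor_unique _ _ xa x0 yb y0); first by rewrite -normr_eq0 normd oner_eq0.
rewrite minors_upper //; last exact: upper_diag.
by congr (_ *: _); apply: eq_bigr => i _; rewrite !mxE eqxx.
Qed.

Lemma schubert_cell_mulr n (w : {perm 'I_n}) (g c : 'M[C]_n) : schubert_cell w g ->
  upper c -> c \in unitmx -> schubert_cell w (g *m c).
Proof.
move=> [b [c' [bb [cu' uc'] ->]]] uc cu; exists b, (c' *m c); split=> //.
  by split; [rewrite unitmx_mul cu'|apply: upper_mul].
by rewrite mulmxA.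
Qed.

Lemma schubert_cell_mull n (w : {perm 'I_n}) (g c : 'M[C]_n) : schubert_cell w g ->
  upper c -> c \in unitmx -> schubert_cell w (c *m g).
Proof.
move=> [b [c' [[bu ub] cc ->]]] uc cu; exists (c *m b), c'; split=> //.
  by split; [rewrite unitmx_mul cu|apply: upper_mul].
by rewrite !mulmxA.
Qed.

(** For a real matrix the phases to be corrected are signs, so the canonical representative stays
    real. *)
Lemma orthogonal_canonical n (Q : 'M[R]_n) : Q^T *m Q = 1%:M ->
  exists2 e : 'I_n -> R, (forall i, e i ^+ 2 = 1) &
    canonical_rep (cplx (Q *m diag_mx (\row_i e i))).
Proof.
move=> QQ; have Qu := unitarymx_unit (unitarymx_cplx QQ).
have [b [w [c [[ub bu] [uc cu] QE]]]] := Bruhat_decomposition Qu.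
have cell : schubert_cell w (cplx Q) by exists b, c.
pose W k := [set w j | j : 'I_n & (j < k)%N]%SET.
(* The last nonzero minor of size k, written as a sum over the single subset w([k]); d 0 = 1 is the
   empty minor. *)
pose d k := if k == 0%N then 1 else
  \sum_(a : 'I_('C(n, k)) | [set i in ksub a]%SET == W k) minors k Q a 0.
have dE k (a : 'I_('C(n, k))) : (0 < k)%N -> [set i in ksub a]%SET = W k -> d k = minors k Q a 0.
  case: k a => // k a _ aE; rewrite /d /= (bigD1 a) ?aE //= big1 ?addr0 // => a'.
  case/andP=> /eqP; rewrite -aE => /setP aa' /eqP[]; apply: ksub_set_inj => x.
  by have := aa' x; rewrite !inE.
have d0 k : (k <= n)%N -> d k != 0.
  case: k => [|k] kn; first by rewrite /d /= oner_neq0.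
  have [a aE [Qa _]] := schubert_cell_minors kn cell.
  by rewrite (dE _ a) //; move: Qa; rewrite minors_cplx mxE fmorph_eq0.
(* Quotients of consecutive signs, so that the product of the first k of them telescopes to the sign
   of [d k]. *)
pose e (i : 'I_n) := Num.sg (d i.+1) * Num.sg (d i).
have prode k : (k <= n)%N -> \prod_(i < n | (i < k)%N) e i = Num.sg (d k).
  elim: k => [|k IH] kn; first by rewrite big_pred0 // /d /= sgr1.
  rewrite (bigD1 (Ordinal kn)) /= ?leqnn // (eq_bigl (fun j : 'I_n => (j < k)%N)).
    by rewrite IH ?(ltnW kn) // /e -mulrA -expr2 sqr_sg (d0 k (ltnW kn)) mulr1.
  by move=> j; rewrite ltnS andbC [RHS]ltn_neqAle.
have e1 i : e i ^+ 2 = 1.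
  by rewrite exprMn !sqr_sg (d0 i.+1) ?(d0 i) ?mul1r // ltnW.
exists e => //.
have ue : upper (cplx (diag_mx (\row_i e i))) by rewrite cplx_diag; apply: upper_diag.
have cell' : schubert_cell w (cplx (Q *m diag_mx (\row_i e i))).
  rewrite cplxM; apply: (schubert_cell_mulr cell ue); apply/(upper_unit ue) => i.
  rewrite !mxE eqxx mulr1n fmorph_eq0; apply/eqP => ei0.
  by move: (e1 i); rewrite ei0 expr0n => /eqP; rewrite eq_sym oner_eq0.
split.
  apply: unitarymx_cplx; rewrite trmx_mul tr_diag_mx -mulmxA (mulmxA Q^T) QQ mul1mx.
  rewrite mulmx_diag; apply/matrixP => i j; rewrite !mxE -expr2 e1.
  by case: eqP.
exists w; split=> // k kn a aE; have /andP[k0 kn'] := kn.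
have [a' a'E [_ a'0]] := schubert_cell_minors kn' cell'.
have aa' : a = a'.
  apply: ksub_set_inj => x; have /setP/(_ x) : [set i in ksub a]%SET = [set i in ksub a']%SET.
    by rewrite aE a'E.
  by rewrite !inE.
rewrite aa'; split=> //; rewrite -{}aa' {a' a'E a'0}.
rewrite minors_cplx mxE minors_upper //; last exact: upper_diag.
rewrite (eq_bigr e) => [|i _]; last by rewrite !mxE eqxx.
rewrite prode // mxE -(dE _ a) // ltcR -normrEsg normr_gt0.
exact: d0.
Qed.

End CanonicalRep.

(** * The twisted flag of a symmetric matrix *)

Lemma unitary_diag_conj (C : numClosedFieldType) n (D : 'I_n -> C) (g h : 'M[C]_n) :
  injective D -> g \is unitarymx -> h \is unitarymx ->
  g *m diag_mx (\row_i D i) *m invmx g = h *m diag_mx (\row_i D i) *m invmx h ->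
  exists2 d : 'I_n -> C, (forall i, `|d i| = 1) & h = g *m diag_mx (\row_i d i).
Proof.
move=> D_inj gU hU gh; have gu := unitarymx_unit gU; have hu := unitarymx_unit hU.
pose U := invmx g *m h.
have hE : h = g *m U by rewrite mulKVmx.
have DU : diag_mx (\row_i D i) *m U = U *m diag_mx (\row_i D i).
  have <- : invmx g *m (g *m diag_mx (\row_i D i) *m invmx g) *m h =
      diag_mx (\row_i D i) *m U.
    by rewrite /U !mulmxA mulVmx // mul1mx.
  by rewrite gh /U -[LHS]mulmxA mulmxKV // mulmxA.
have U0 i j : i != j -> U i j = 0.
  move=> ij; have := congr1 (fun A : 'M_n => A i j) DU.
  rewrite mul_diag_mx mul_mx_diag !mxE mulrC => /eqP.
  rewrite -subr_eq0 -mulrBr mulf_eq0 subr_eq0 (inj_eq D_inj) (negPf ij) orbF.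
  by move=> /eqP.
have UU : U \is unitarymx.
  by rewrite /U invmx_unitary // mul_unitarymx ?trmxC_unitary.
have UE : U = diag_mx (\row_i U i i).
  apply/matrixP => i j; rewrite [RHS]mxE [X in X *+ _]mxE.
  by case: (eqVneq i j) => [->//|/U0].
exists (fun i => U i i); last by rewrite -UE.
move=> i; have /unitarymxP/(congr1 (fun A : 'M_n => A i i)) := UU.
rewrite [X in X = _ -> _]mxE [X in _ = X -> _]mxE eqxx.
rewrite (bigD1 i) //= big1 ?addr0 => [|l li]; last by rewrite U0 1?eq_sym ?mul0r.
rewrite [X in _ * X]mxE [X in _ * X^*]mxE -normCK => /eqP.
by rewrite sqrf_eq1 => /orP[/eqP//|/eqP E]; have := normr_ge0 (U i i); rewrite E ler0N1.
Qed.

Section Frame.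
Variable R : realType.
Local Notation C := R[i].

(** Eigenvectors of a symmetric matrix for distinct eigenvalues are orthogonal, so one unit
    eigenvector for each of the n values suffices. *)
Lemma orthogonal_eigenbasis n (lam : 'I_n -> R) (M : 'M[R]_n) : injective lam ->
  sym_with_eigenvalues lam M ->
  exists Q : 'M[R]_n, Q^T *m Q = 1%:M /\ M *m Q = Q *m diag_mx (\row_i lam i).
Proof.
move=> lam_inj [symM eigM].
have /fin_all_exists[v vP] i : exists v : 'cV[R]_n, M *m v = lam i *: v /\ v != 0.
  have /eigenvalueP[v vM v0] := (eigM (lam i)).2 (ex_intro _ i erefl).
  exists v^T; split; last by rewrite trmx_eq0.
  by rewrite -[M in LHS]symM -trmx_mul vM linearZ.
pose q i := (Num.sqrt (dot (v i) (v i)))^-1 *: v i.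
have qM i : M *m q i = lam i *: q i.
  by rewrite /q -scalemxAr (vP i).1 !scalerA mulrC.
have qq i : dot (q i) (q i) = 1.
  have vi : 0 < dot (v i) (v i) by rewrite dot_gt0 (vP i).2.
  by rewrite dotZl dotZr mulrA -expr2 exprVn sqr_sqrtr ?ltW // mulVf // gt_eqF.
have qo i j : i != j -> dot (q i) (q j) = 0.
  move=> ij; have : lam i * dot (q i) (q j) = lam j * dot (q i) (q j).
    by rewrite -dotZl -dotZr -!qM /dot trmx_mul symM mulmxA.
  move/eqP; rewrite -subr_eq0 -mulrBl mulf_eq0 subr_eq0 (inj_eq lam_inj).
  by rewrite (negPf ij) => /eqP.
exists (\matrix_(a, i) q i a 0); split.
  apply/matrixP => i j; transitivity (dot (q i) (q j)).
    by rewrite dotE !mxE; apply: eq_bigr => a _; rewrite !mxE.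
  by rewrite mxE; case: (eqVneq i j) => [->|/qo].
apply/matrixP => a i; rewrite mul_mx_diag !mxE mulrC.
have := congr1 (fun u : 'cV_n => u a 0) (qM i); rewrite !mxE => <-.
by apply: eq_bigr => l _; rewrite !mxE.
Qed.

(* Q is the canonical representative of iM; it turns out to be real. *)
Definition toda_frame n (lam : 'I_n -> R) (M Q : 'M[R]_n) : Prop :=
  [/\ Q^T *m Q = 1%:M, M *m Q = Q *m diag_mx (\row_i lam i) & canonical_rep (cplx Q)].

Definition altsign n : 'M[R]_n := diag_mx (\row_j (-1) ^+ j).

Lemma cplx_altsign n : cplx (altsign n) = altsign_mx R n.
Proof. by rewrite cplx_diag; congr diag_mx; apply/rowP => j; rewrite !mxE rmorph_sign. Qed.

Lemma altsign_sqr n : altsign n *m altsign n = 1%:M.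
Proof.
rewrite mulmx_diag; apply/matrixP => i j; rewrite !mxE -expr2 sqrr_sign.
by case: eqP.
Qed.

Lemma altsign_tr n : (altsign n)^T = altsign n.
Proof. exact: tr_diag_mx. Qed.

Lemma altsign_tr_orth n (Q : 'M[R]_n) : Q^T *m Q = 1%:M ->
  (altsign n *m Q^T)^T *m (altsign n *m Q^T) = 1%:M.
Proof.
move=> QQ; rewrite trmx_mul trmxK altsign_tr mulmxA -(mulmxA Q) altsign_sqr mulmx1.
exact: mulmx1C.
Qed.

Lemma altsign_tr_unit n (Q : 'M[R]_n) : Q^T *m Q = 1%:M -> altsign n *m Q^T \in unitmx.
Proof. by move=> /altsign_tr_orth/mulmx1_unit[]. Qed.

Section Fixed.
Variables (n : nat) (lam : 'I_n -> R).
Hypothesis lam_inj : injective lam.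

Lemma toda_frame_exists M : sym_with_eigenvalues lam M -> exists Q, toda_frame lam M Q.
Proof.
move=> symM; have [Q [QQ MQ]] := orthogonal_eigenbasis lam_inj symM.
have [e e1 cQ] := orthogonal_canonical QQ.
exists (Q *m diag_mx (\row_i e i)); split=> //.
  rewrite trmx_mul tr_diag_mx -mulmxA (mulmxA Q^T) QQ mul1mx mulmx_diag.
  by apply/matrixP => i j; rewrite !mxE -expr2 e1; case: eqP.
rewrite mulmxA MQ -!mulmxA; congr (_ *m _); exact: diag_mxC.
Qed.

Lemma orbit_pt_cplx (A Q : 'M[R]_n) : Q^T *m Q = 1%:M ->
  A *m Q = Q *m diag_mx (\row_i lam i) -> 'i *: cplx A = orbit_pt lam (cplx Q).
Proof.
move=> QQ AQ; have Qu := unitarymx_unit (unitarymx_cplx QQ).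
rewrite /orbit_pt /ilam -scalemxAr -scalemxAl -cplxM -AQ cplxM.
by rewrite mulmxK.
Qed.

Lemma ilamE : ilam lam = diag_mx (\row_i ('i * (lam i)%:C%C)).
Proof. by apply/matrixP => i j; rewrite !mxE rmorphMn mulrnAr. Qed.

Lemma orbit_pt_unitary (g h : 'M[C]_n) : g \is unitarymx -> h \is unitarymx ->
  orbit_pt lam g = orbit_pt lam h ->
  exists2 d : 'I_n -> C, (forall i, `|d i| = 1) & h = g *m diag_mx (\row_i d i).
Proof.
rewrite /orbit_pt ilamE; apply: unitary_diag_conj => i j.
by move/(mulfI (neq0Ci _))/complexI/lam_inj.
Qed.

(** Canonical representatives of one orbit point differ by diagonal phases, which are trivial; hence
    the choice made in [twist] returns Q. *)
Lemma twist_frame M Q : toda_frame lam M Q ->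
  twist lam ('i *: cplx M) = orbit_pt lam (cplx (altsign n *m Q^T)).
Proof.
case=> QQ MQ cQ; have ME := orbit_pt_cplx QQ MQ.
rewrite /twist (@xget_unique _ _ _ (cplx Q)) //=; last first.
  move=> g [cg gE]; have gU : g \is unitarymx by case: cg.
  have [|d d1 gd] := orbit_pt_unitary (unitarymx_cplx QQ) gU; first by rewrite -ME.
  have := canonical_rep_unique d1 cQ; rewrite -gd => /(_ cg) d1'.
  rewrite gd; have -> : \row_i d i = const_mx 1 by apply/rowP => i; rewrite !mxE d1'.
  by rewrite diag_const_mx mulmx1.
have QTT : cplx Q^T *m cplx Q = 1%:M by rewrite -cplxM QQ cplx1.
rewrite /orbit_pt.
have HH := altsign_tr_orth QQ.
rewrite [invmx (cplx (_ *m _))]invmx_orth; last by rewrite -cplx_tr -cplxM HH cplx1.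
rewrite [invmx (cplx Q)]invmx_orth; last by rewrite -cplx_tr -cplxM QQ cplx1.
by rewrite -!cplx_tr trmx_mul trmxK altsign_tr !cplxM cplx_altsign !mulmxA.
Qed.

(** Another representative of the flag only rescales the minors by a complex number. A real vector
    that is a complex multiple of a nonzero real vector is a real multiple, by the ratio of entries
    at a nonzero coordinate. *)
Lemma toda_pointE M Q k (x : 'cV[R]_('C(n, k))) : (k <= n)%N -> toda_frame lam M Q ->
  toda_point lam M x <->
  exists2 c : R, c != 0 & x = c *: minors k (altsign n *m Q^T).
Proof.
move=> kn fQ; have tQ := twist_frame fQ; case: fQ => QQ MQ cQ.
set H := altsign n *m Q^T in tQ *.
have HU : cplx H \is unitarymx := unitarymx_cplx (altsign_tr_orth QQ).
have Hu : H \in unitmx := altsign_tr_unit QQ.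
rewrite /toda_point /plucker /orbit_flag /= tQ.
split=> [[h [c [[g [b [gU Hg [bu ub] hE]]] c0 xE]]]|[c c0 ->]]; last first.
  exists (cplx H), c%:C%C; split; last 1 first.
  - by rewrite minors_cplx; apply/matrixP => i j; rewrite !mxE rmorphM.
  - exists (cplx H), 1%:M; split; rewrite ?mulmx1 //.
    by split; [exact: unitmx1|exact: upper1].
  - by rewrite fmorph_eq0.
have [d d1 gE] := orbit_pt_unitary HU gU Hg.
have [c' xE'] : exists c', cplx x = c' *: minors k (cplx H).
  rewrite xE hE gE -mulmxA minors_upper //; last exact: upper_mul (@upper_diag _ _ _) ub.
  by eexists; apply: scalerA.
have /matrix0Pn[a [j]] := minors_neq0 kn Hu; rewrite ord1 => Ha {j}.
have xr l : (x l 0)%:C%C = c' * (minors k H l 0)%:C%C.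
  have := congr1 (fun A : 'cV_('C(n, k)) => A l 0) xE'.
  by rewrite minors_cplx !mxE.
have c'E : c' = (x a 0 / minors k H a 0)%:C%C.
  by rewrite fmorph_div /= xr mulfK // fmorph_eq0.
have xE2 : x = (x a 0 / minors k H a 0) *: minors k H.
  apply/colP => l; apply/complexI; rewrite xr c'E -rmorphM /=.
  by congr (_%:C%C); rewrite [RHS]mxE.
exists (x a 0 / minors k H a 0) => //.
apply: contraNneq c0 => r0; move: xE2; rewrite r0 scale0r => x0.
have hu : h \in unitmx by rewrite hE unitmx_mul bu (unitarymx_unit gU).
have := minors_neq0 kn hu; apply: contraNT => c0.
move: xE; rewrite x0 /cplx map_mx0 => /esym/eqP.
by rewrite scaler_eq0 (negPf c0).
Qed.

Lemma flag_minorsE k (Q : 'M[R]_n) (a0 a : 'I_('C(n, k))) : a0 = 0 :> nat ->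
  minors k (altsign n *m Q^T) a 0 =
  (\prod_(i <- ksub a) (-1) ^+ i) * compound k Q a0 a.
Proof.
move=> a00; rewrite minors_mul compound_diag mul_diag_mx mxE [X in X * _]mxE.
by rewrite (minorsE _ _ a00) compound_tr [X in _ * X]mxE.
Qed.

Lemma norm_flag_minors k (Q : 'M[R]_n) (a0 a : 'I_('C(n, k))) : a0 = 0 :> nat ->
  `|minors k (altsign n *m Q^T) a 0| = `|compound k Q a0 a|.
Proof.
move=> a00; rewrite (flag_minorsE _ _ a00) normrM normr_prod.
by rewrite big1 ?mul1r // => i _; rewrite normrX normrN1 expr1n.
Qed.

Lemma toda_proj_point M k : (k <= n)%N -> sym_with_eigenvalues lam M ->
  proj_point (toda_point lam M (k := k)).
Proof.
move=> kn /toda_frame_exists[Q fQ]; exists (minors k (altsign n *m Q^T)).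
  by apply: minors_neq0 => //; case: fQ => QQ _ _; apply: altsign_tr_unit.
by apply/seteqP; split=> x /(toda_pointE _ kn fQ).
Qed.

End Fixed.
End Frame.

(** * Injectivity of the map to projective spaces *)

Section Injectivity.

(** Induction on the column j. The minor in rows 0, ..., j - 1, i with i > j is triangular by
    induction, hence equal to [U i j] times the first j diagonal entries. It vanishes because its
    rows are not the initial segment, while the diagonal entries are nonzero by the minor of the
    initial segment. *)
Lemma upper_of_minors (F : fieldType) n (U : 'M[F]_n) :
  (forall k, (0 < k < n)%N ->
     exists2 c, c != 0 & minors k U = c *: minors k 1%:M) ->
  upper U.
Proof.
move=> UP i j; have [l] := ubnP j; elim: l i j => // l IH i j /ltnSE jl ji.
pose k := j.+1.
have kn : (k < n)%N by apply: leq_ltn_trans ji (ltn_ord i).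
have [c c0 Uc] := UP k kn.
have kn' := ltnW kn.
have [z z0] : exists z : 'I_('C(n, k)), z = 0 :> nat.
  have bin0 : (0 < 'C(n, k))%N by rewrite bin_gt0.
  by exists (Ordinal bin0).
have Uk a : minors k U a 0 = c * (a == z)%:R.
  by rewrite Uc mxE (minorsE _ _ z0) compound1 mxE.
have det_rows (f : 'I_k -> 'I_n) : (forall s t : 'I_k, (t < s)%N -> (t < f s)%N) ->
    \det (rowsub f (U *m (pid_mx k : 'M_(n, k)))) = \prod_(s < k) U (f s) (widen_ord kn' s).
  move=> f_gt; rewrite -det_tr det_trig.
    by apply: eq_bigr => s _; rewrite (mul_pid _ kn') !mxE.
  apply/is_trig_mxP => t s ts; rewrite (mul_pid _ kn') !mxE.
  apply: IH => /=; last exact: f_gt.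
  exact: leq_trans ts (leq_trans (ltn_ord s : (s <= j)%N) jl).
have diag0 : \prod_(s < k) U (widen_ord kn' s) (widen_ord kn' s) != 0.
  rewrite -(det_rows (widen_ord kn')) //.
  have -> : rowsub (widen_ord kn') (U *m (pid_mx k : 'M_(n, k))) =
      rowsub (tnth (ksub z)) (U *m (pid_mx k : 'M_(n, k))).
    apply/matrixP => s t; rewrite !mxE; apply: eq_bigr => q _; congr (U _ _ * _).
    by apply/val_inj; rewrite /= ksub0.
  by have := Uk z; rewrite mxE eqxx mulr1 => ->.
pose f (s : 'I_k) := if (s < j)%N then widen_ord kn' s else i.
have f_gt (s t : 'I_k) : (t < s)%N -> (t < f s)%N.
  move=> ts; rewrite /f; case: ifP => // _.
  by apply: leq_trans ts _; apply: leq_trans ji; rewrite ltnW.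
have f_inj : injective f.
  have ij (s : 'I_k) : (s < j)%N -> (widen_ord kn' s == i) = false.
    by move=> sj; rewrite -(inj_eq val_inj) /= ltn_eqF // (ltn_trans sj).
  have last_k (s : 'I_k) : (s < j)%N = false -> s = j :> nat.
    move=> sj; apply/eqP; rewrite eqn_leq -ltnS ltn_ord /=.
    by rewrite leqNgt sj.
  move=> s t; rewrite /f; case: ifP => sj; case: ifP => tj.
  - by move/(congr1 val) => /= st; apply/val_inj.
  - by move/eqP; rewrite ij.
  - by move/esym/eqP; rewrite ij.
  - by move=> _; apply/val_inj; rewrite /= (last_k s) // (last_k t).
have [a [s fE]] := ksub_perm f_inj.
have az : a != z.
  apply: contraTneq ji => az.
  have fj : f ord_max = i by rewrite /f /= ltnn.
  have := fE ord_max; rewrite fj az /= => ->.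
  by rewrite -leqNgt ksub0 // -ltnS.
have : \det (rowsub f (U *m (pid_mx k : 'M_(n, k)))) = 0.
  have -> : rowsub f (U *m (pid_mx k : 'M_(n, k))) =
      row_perm s (rowsub (tnth (ksub a)) (U *m (pid_mx k : 'M_(n, k)))).
    by apply/matrixP => p q; rewrite !mxE fE.
  have := Uk a; rewrite mxE (negPf az) mulr0 row_permE det_mulmx => ->.
  by rewrite mulr0.
rewrite (det_rows f f_gt) big_ord_recr /= /f ltnn.
have -> : widen_ord kn' ord_max = j by apply/val_inj.
move/eqP; rewrite mulf_eq0 => /orP[|/eqP//].
move: diag0; rewrite big_ord_recr /= mulf_eq0 negb_or => /andP[d0 _] /eqP E.
move: d0; rewrite -E; set A := \prod_(_ < j) _; set B := \prod_(_ < j) _.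
suff -> : A = B by rewrite eqxx.
by apply: eq_bigr => t _; rewrite ltn_ord.
Qed.

Variable R : realType.

Lemma upper_orthogonal n (U : 'M[R]_n) : U^T *m U = 1%:M -> upper U ->
  exists2 e : 'I_n -> R, (forall i, e i ^+ 2 = 1) & U = diag_mx (\row_i e i).
Proof.
move=> UU uU; have [_ Uu] := mulmx1_unit UU.
have uUT : upper U^T by rewrite -(invmx_orth UU); apply: upper_inv.
have UE : U = diag_mx (\row_i U i i).
  apply/matrixP => i j; rewrite [RHS]mxE [X in X *+ _]mxE.
  have [ij|ji|/val_inj->] := ltngtP i j; last by rewrite eqxx.
    by have := uUT _ _ ij; rewrite mxE => ->; rewrite -(inj_eq val_inj) ltn_eqF.
  by rewrite uU // -(inj_eq val_inj) gtn_eqF.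
exists (fun i => U i i) => // i.
have := congr1 (fun A : 'M_n => A i i) UU.
rewrite [X in X = _ -> _]mxE [X in _ = X -> _]mxE eqxx.
rewrite (bigD1 i) //= big1 ?addr0 => [|l li].
  by rewrite [X in X * _]mxE -expr2.
by rewrite [in X in _ * X]UE [X in _ * X]mxE (negPf li) mulr0.
Qed.

Lemma canonical_rep_lead n (Q : 'M[R]_n) : canonical_rep (cplx Q) ->
  exists w : {perm 'I_n}, forall k, (0 < k <= n)%N ->
    exists a : 'I_('C(n, k)),
     [/\ [set i in ksub a]%SET = [set w j | j : 'I_n & (j < k)%N]%SET,
       0 < minors k Q a 0 &
       forall b : 'I_('C(n, k)), (a < b)%N -> minors k Q b 0 = 0].
Proof.
case=> _ [w [cell pos]]; exists w => k kn; have /andP[_ kn'] := kn.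
have [a aE _] := schubert_cell_minors kn' cell.
have [Qa Q0] := pos k kn a aE; exists a; split=> // [|b ab].
  by move: Qa; rewrite minors_cplx mxE ltcR.
by have /eqP := Q0 b ab; rewrite minors_cplx mxE fmorph_eq0 => /eqP.
Qed.

Lemma prod_ksub_perm (F : comPzRingType) n k (w : {perm 'I_n}) (a : 'I_('C(n, k)))
    (e : 'I_n -> F) :
  [set i in ksub a]%SET = [set w j | j : 'I_n & (j < k)%N]%SET ->
  \prod_(i <- ksub a) e i = \prod_(j < n | (j < k)%N) e (w j).
Proof.
move=> aE; rewrite (big_uniq _ (ksub_uniq a)) /=.
rewrite (eq_bigl (mem [set w j | j : 'I_n & (j < k)%N]%SET)) => [|x]; last first.
  by rewrite /= -aE inE.
rewrite big_imset /=; last by move=> i j _ _ /perm_inj.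
by apply: eq_bigl => j; rewrite inE.
Qed.

Lemma sqr1_gt0 (x : R) : x ^+ 2 = 1 -> 0 < x -> x = 1.
Proof. by move=> /eqP; rewrite sqrf_eq1 => /orP[/eqP//|/eqP->]; rewrite ltr0N1. Qed.

Lemma toda_point_inj n (lam : 'I_n -> R) (M M' : 'M[R]_n) : injective lam ->
  sym_with_eigenvalues lam M -> sym_with_eigenvalues lam M' ->
  (forall k, (0 < k < n)%N -> toda_point lam M (k := k) = toda_point lam M' (k := k)) ->
  M = M'.
Proof.
move=> lam_inj symM symM' pts.
have [Q fQ] := toda_frame_exists lam_inj symM.
have [Q' fQ'] := toda_frame_exists lam_inj symM'.
have [QQ MQ cQ] := fQ; have [QQ' MQ' cQ'] := fQ'.
pose U := Q *m Q'^T.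
have UU : U^T *m U = 1%:M.
  by rewrite /U trmx_mul trmxK mulmxA -(mulmxA Q') QQ mulmx1 (mulmx1C QQ').
have HU : altsign R n *m Q'^T = altsign R n *m Q^T *m U.
  by rewrite /U mulmxA -(mulmxA _ Q^T) QQ mulmx1.
have Hu := altsign_tr_unit QQ.
have uU : upper U.
  apply: upper_of_minors => k kn; have /andP[_ /ltnW kn'] := kn.
  have : toda_point lam M (minors k (altsign R n *m Q'^T)).
    rewrite pts //; apply/(toda_pointE lam_inj _ kn' fQ').
    by exists 1; rewrite ?oner_neq0 // scale1r.
  case/(toda_pointE lam_inj _ kn' fQ) => c c0; rewrite HU => E; exists c => //.
  have := congr1 (mulmx (compound k (invmx (altsign R n *m Q^T)))) E.
  by rewrite -scalemxAr -!minors_mul mulKmx // mulVmx.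
have [e e1 UE] := upper_orthogonal UU uU.
have Q'E : Q' = diag_mx (\row_i e i) *m Q.
  by rewrite -UE -[U]trmxK UE tr_diag_mx -UE /U trmx_mul trmxK -mulmxA QQ mulmx1.
have [w wP] := canonical_rep_lead cQ; have [w' wP'] := canonical_rep_lead cQ'.
(* Row signs preserve the supports of Plücker vectors, so the last nonzero minors of Q and Q' sit at
   the same subset w([k]). Both are positive, and their ratio is the product of e over w([k]). *)
have ew : forall i, e (w i) = 1.
  apply: partial_prod_eq1 => k kn.
  have [a [aE Qa Q0]] := wP k kn; have [b [_ Qb Q0']] := wP' k kn.
  have minE d : minors k Q' d 0 = (\prod_(i <- ksub d) e i) * minors k Q d 0.
    by rewrite Q'E minors_mul compound_diag mul_diag_mx mxE [X in X * _]mxE.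
  have prod_sqr d : (\prod_(i <- ksub d) e i) ^+ 2 = 1.
    by rewrite -prodrXl big1.
  have ab : a = b.
    apply/val_inj; case: (ltngtP a b) => // lt_ab.
      by move: Qb; rewrite minE Q0 // mulr0 ltxx.
    have := Q0' a lt_ab; rewrite minE => /(congr1 ( *%R (\prod_(i <- ksub a) e i))).
    by rewrite mulrA -expr2 prod_sqr mul1r mulr0 => Qa0; rewrite Qa0 ltxx in Qa.
  rewrite -(prod_ksub_perm e aE); move: Qb; rewrite -ab minE pmulr_lgt0 //.
  exact: sqr1_gt0.
have eq1 : \row_i e i = const_mx 1.
  by apply/rowP => i; rewrite !mxE -(permKV w i) ew.
have QQ'E : Q' = Q by rewrite Q'E eq1 diag_const_mx mul1mx.
rewrite QQ'E in MQ'.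
have [Qu _] := mulmx1_unit (mulmx1C QQ).
by apply: (can_inj (mulmxK Qu)); rewrite MQ MQ'.
Qed.

End Injectivity.

Local Open Scope classical_set_scope.
Local Open Scope ring_scope.

(** * Linear differential equations with triangular matrices *)

Section Primitive.
Import measure lebesgue_measure lebesgue_integral ftc.
Variable R : realType.
Implicit Types (J : set R) (f F : R -> R).

Lemma is_derive_continuous f (t d : R) : is_derive t (1 : R) f d ->
  {for t, continuous f}.
Proof. by case=> df _; apply/differentiable_continuous/derivable1_diffP. Qed.

Lemma within_itv_continuous f (a b : R) :
  (forall t, a <= t <= b -> {for t, continuous f}) ->
  {within `[a, b], continuous f}.
Proof.
move=> cf; apply: continuous_in_subspaceT => t; rewrite inE /= in_itv /=.
exact: cf.
Qed.

Lemma zero_derive_cst J f : is_interval J ->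
  (forall t, J t -> is_derive t (1 : R) f 0) ->
  forall s t, J s -> J t -> f s = f t.
Proof.
move=> iJ df s t; wlog st : s t / s <= t => [wl|] Js Jt.
  by case/orP: (le_total s t) => ?; [exact: wl|apply/esym/wl].
have J_st u : s <= u <= t -> J u by apply: iJ.
have [||u _ /eqP] := @MVT_segment R f (fun=> 0) s t st.
- by move=> u; rewrite in_itv /= => /andP[su ut]; apply/df/J_st; rewrite !ltW.
- by apply: within_itv_continuous => u /J_st/df; apply: is_derive_continuous.
- by rewrite mul0r subr_eq0 => /eqP.
Qed.

Lemma open_itv_left J t : open J -> J t -> exists2 c, J c & c < t.
Proof.
rewrite openE => oJ /oJ [e /= e0 eJ]; exists (t - e / 2).
  apply: eJ; rewrite /ball /= opprB addrCA subrr addr0 gtr0_norm ?divr_gt0 //.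
  by rewrite ltr_pdivrMr // ltr_pMr // ltr1n.
by rewrite ltrBlDr ltrDl divr_gt0.
Qed.

Lemma open_itv_right J t : open J -> J t -> exists2 c, J c & t < c.
Proof.
rewrite openE => oJ /oJ [e /= e0 eJ]; exists (t + e / 2).
  apply: eJ; rewrite /ball /= opprD addrA subrr add0r normrN gtr0_norm ?divr_gt0 //.
  by rewrite ltr_pdivrMr // ltr_pMr // ltr1n.
by rewrite ltrDl divr_gt0.
Qed.

(* The integrals from c to t only give a primitive to the right of c; those for
   different c agree up to a constant, and are glued together. *)
Lemma primitive_exists J f t0 : open J -> is_interval J -> J t0 ->
  (forall t, J t -> {for t, continuous f}) ->
  exists2 F, F t0 = 0 & forall t, J t -> is_derive t (1 : R) F (f t).
Proof.
move=> oJ iJ Jt0 cf.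
pose G c t := (\int[@lebesgue_measure R]_(s in `[c, t]) f s)%R.
pose H c t := G c t - G c t0.
have dG c t : J c -> J t -> c < t -> is_derive t (1 : R) (G c) (f t).
  move=> Jc Jt ct; have [u Ju tu] := open_itv_right oJ Jt.
  have intf : (@lebesgue_measure R).-integrable `[c, u] (EFin \o f).
    apply: continuous_compact_integrable; first exact: segment_compact.
    by apply: within_itv_continuous => s su; apply/cf/(iJ c u).
  have [dGt GtE] := continuous_FTC1_closed tu intf ct (cf t Jt).
  by rewrite derive1E in GtE; split.
have dH c t : J c -> J t -> c < t -> is_derive t (1 : R) (H c) (f t).
  move=> Jc Jt ct; have dGt := dG c t Jc Jt ct.
  have -> : H c = G c - cst (G c t0) by apply/funext.
  by apply: is_derive_eq; rewrite subr0.
have HE c c' t : J c -> J c' -> J t -> c < t0 -> c' < t0 -> c < t -> c' < t -> H c t = H c' t.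
  move=> Jc Jc' Jt ct0 c't0 ct c't.
  pose J' := [set s | [/\ J s, c < s & c' < s]].
  have iJ' : is_interval J'.
    move=> x y [Jx cx c'x] [Jy cy c'y] z xzy; have /andP[xz zy] := xzy.
    by split; [exact: (iJ x y)|exact: lt_le_trans xz|exact: lt_le_trans xz].
  have dHH s : J' s -> is_derive s (1 : R) (H c - H c') 0.
    move=> [Js cs c's]; have d1 := dH c s Jc Js cs; have d2 := dH c' s Jc' Js c's.
    by apply: is_derive_eq; rewrite subrr.
  have := zero_derive_cst iJ' dHH (And3 Jt ct c't) (And3 Jt0 ct0 c't0).
  rewrite [X in X = _]/(H c t - H c' t) [X in _ = X]/(H c t0 - H c' t0).
  by rewrite [X in _ = X - _]subrr [X in _ = _ - X]subrr subrr => /eqP; rewrite subr_eq0 => /eqP.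
have /choice[c cP] : forall t, exists c, J t -> [/\ J c, c < t & c < t0].
  move=> t; case: (pselect (J t)) => [Jt|nJt]; last by exists 0.
  have [|c Jc cm] := @open_itv_left J (Num.min t t0) oJ.
    by case: (leP t t0).
  by exists c => _; move: cm; rewrite lt_min => /andP[].
exists (fun t => H (c t) t) => [|t Jt]; first by rewrite /H subrr.
have [Jc ct ct0] := cP t Jt.
apply: near_eq_is_derive (dH _ _ Jc Jt ct).
have nJ : \forall s \near t, J s by apply: open_nbhs_nbhs.
have nc : \forall s \near t, c t < s by apply: lt_nbhsr.
near=> s; have Js : J s by near: s.
have [Jcs css cst0] := cP s Js.
by apply: HE => //; near: s.
Unshelve. all: by end_near. Qed.

(** Variation of constants. The last clause keeps the exponential form of the homogeneous solution,
    which later yields zeros and positivity. *)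
Lemma linear_ode_exists J (p q : R -> R) t0 y0 : open J -> is_interval J -> J t0 ->
  (forall t, J t -> {for t, continuous p}) ->
  (forall t, J t -> {for t, continuous q}) ->
  exists y P : R -> R, [/\ y t0 = y0,
    forall t, J t -> is_derive t (1 : R) y (p t * y t + q t) &
    (forall t, q t = 0) -> forall t, y t = y0 * expR (P t)].
Proof.
move=> oJ iJ Jt0 cp cq.
have [P P0 dP] := primitive_exists oJ iJ Jt0 cp.
have dE t : J t -> is_derive t (1 : R) (fun s => expR (P s)) (expR (P t) * p t).
  by move=> Jt; have dPt := dP t Jt; apply: (@is_derive1_comp _ expR P).
have dEN t : J t -> is_derive t (1 : R) (fun s => expR (- P s)) (- expR (- P t) * p t).
  move=> Jt; have dPt := dP t Jt.
  have d2 : is_derive t (1 : R) (fun s => - P s) (- p t).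
    exact: (@is_deriveN _ _ _ P).
  have := @is_derive1_comp _ expR (fun s => - P s) t _ _ (is_derive_expR _) d2.
  by rewrite mulrN mulNr.
have cEq t : J t -> {for t, continuous (fun s => expR (- P s) * q s)}.
  move=> Jt; apply: continuousM; last exact: cq.
  exact: is_derive_continuous (dEN t Jt).
have [V V0 dV] := primitive_exists oJ iJ Jt0 cEq.
(* The primitive V is controlled only on J. Taking 0 in the homogeneous case makes the exponential
   formula hold for every t. *)
pose V' := if pselect (forall t, q t = 0) then cst 0 else V.
have V'0 : V' t0 = 0 by rewrite /V'; case: pselect.
have dV' t : J t -> is_derive t (1 : R) V' (expR (- P t) * q t).
  move=> Jt; rewrite /V'; case: pselect => [q0|nq0]; last exact: dV.
  by rewrite q0 mulr0; apply: is_derive_cst.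
exists (fun t => expR (P t) * (y0 + V' t)), P; split.
- by rewrite P0 V'0 addr0 expR0 mul1r.
- move=> t Jt; have d1 := dE t Jt; have d2 := dV' t Jt.
  have d3 : is_derive t (1 : R) (fun s => y0 + V' s) (0 + expR (- P t) * q t).
    exact: (@is_deriveD _ _ _ (cst y0) V').
  have := @is_deriveM _ _ (fun s => expR (P s)) (fun s => y0 + V' s) t 1 _ _ d1 d3.
  move=> d4; apply: is_derive_eq; rewrite add0r /GRing.scale /=.
  have E : expR (P t) * expR (- P t) = 1 by rewrite -expRD subrr expR0.
  rewrite (mulrA (expR (P t)) (expR (- P t))) E mul1r addrC; congr (_ + _).
  by rewrite mulrC [expR _ * p t]mulrC mulrA.
- move=> q0 t; rewrite /V'; case: pselect => [zq|/(_ q0)//].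
  by rewrite addr0 mulrC.
Qed.

End Primitive.

Section MatrixDerivative.
Variable R : realType.

Definition mx_derive m n (A : R -> 'M[R]_(m, n)) (t : R) (D : 'M[R]_(m, n)) :=
  forall i j, is_derive t (1 : R) (fun s => A s i j) (D i j).

Lemma is_derive_bigsum (I : Type) (r : seq I) (P : pred I) (f : I -> R -> R) (df : I -> R) t :
  (forall i, P i -> is_derive t (1 : R) (f i) (df i)) ->
  is_derive t (1 : R) (fun s => \sum_(i <- r | P i) f i s) (\sum_(i <- r | P i) df i).
Proof.
move=> dfi; elim: r => [|i r IH].
  have -> : (fun s => \sum_(i <- [::] | P i) f i s) = cst 0.
    by apply/funext => s; rewrite big_nil.
  by rewrite big_nil; apply: is_derive_cst.
rewrite big_cons; case: (boolP (P i)) => Pi; last first.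
  suff -> : (fun s => \sum_(i <- i :: r | P i) f i s) =
      (fun s => \sum_(i <- r | P i) f i s) by [].
  by apply/funext => s; rewrite big_cons (negPf Pi).
have -> : (fun s => \sum_(i <- i :: r | P i) f i s) =
    f i + (fun s => \sum_(i <- r | P i) f i s).
  by apply/funext => s; rewrite big_cons Pi.
exact: is_deriveD (dfi i Pi) IH.
Qed.

Lemma is_derive_mul (f g : R -> R) t df dg :
  is_derive t (1 : R) f df -> is_derive t (1 : R) g dg ->
  is_derive t (1 : R) (fun s => f s * g s) (df * g t + f t * dg).
Proof.
move=> d1 d2; have d3 := is_deriveM d1 d2.
by apply: is_derive_eq; rewrite addrC [df * _]mulrC.
Qed.

Lemma mx_deriveM m n p (A : R -> 'M[R]_(m, n)) (B : R -> 'M[R]_(n, p)) t dA dB :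
  mx_derive A t dA -> mx_derive B t dB ->
  mx_derive (fun s => A s *m B s) t (dA *m B t + A t *m dB).
Proof.
move=> hA hB i j.
have -> : (fun s => (A s *m B s) i j) = (fun s => \sum_k A s i k * B s k j).
  by apply/funext => s; rewrite mxE.
rewrite !mxE -big_split /=; apply: is_derive_bigsum => k _.
exact: is_derive_mul.
Qed.

Lemma mx_derive_cst m n (A : 'M[R]_(m, n)) t : mx_derive (fun=> A) t 0.
Proof. by move=> i j; rewrite mxE; apply: is_derive_cst. Qed.

Lemma mx_deriveD m n (A B : R -> 'M[R]_(m, n)) t dA dB :
  mx_derive A t dA -> mx_derive B t dB -> mx_derive (fun s => A s + B s) t (dA + dB).
Proof.
move=> hA hB i j.
have -> : (fun s => (A s + B s) i j) = (fun s => A s i j) + (fun s => B s i j).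
  by apply/funext => s; rewrite mxE.
by rewrite mxE; apply: is_deriveD.
Qed.

Lemma mx_deriveN m n (A : R -> 'M[R]_(m, n)) t dA :
  mx_derive A t dA -> mx_derive (fun s => - A s) t (- dA).
Proof.
move=> hA i j.
have -> : (fun s => (- A s) i j) = - (fun s => A s i j).
  by apply/funext => s; rewrite mxE.
by rewrite mxE; apply: is_deriveN.
Qed.

Lemma mx_derive_tr m n (A : R -> 'M[R]_(m, n)) t dA :
  mx_derive A t dA -> mx_derive (fun s => (A s)^T) t dA^T.
Proof.
move=> hA i j; rewrite mxE.
suff -> : (fun s => (A s)^T i j) = (fun s => A s j i) by [].
by apply/funext => s; rewrite mxE.
Qed.

Lemma mx_derive_zero_cst (J : set R) m n (A : R -> 'M[R]_(m, n)) : is_interval J ->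
  (forall t, J t -> mx_derive A t 0) -> forall s t, J s -> J t -> A s = A t.
Proof.
move=> iJ dA s t Js Jt; apply/matrixP => i j.
apply: (zero_derive_cst (f := fun s => A s i j) iJ _ Js Jt) => u Ju.
by have := dA u Ju i j; rewrite mxE.
Qed.

(** Row i involves only the unknowns of index at least i, so the rows are solved from the last one
    up, each as a scalar equation with the rows below as source. The source vanishes for i >= j,
    which gives 0 below the diagonal and an exponential on it. *)
Lemma upper_ode_column (J : set R) n (T : R -> 'M[R]_n) t0 (j : 'I_n) :
  open J -> is_interval J -> J t0 ->
  (forall t, J t -> upper (T t)) ->
  (forall t, J t -> forall i l, {for t, continuous (fun s => T s i l)}) ->
  exists y : 'I_n -> R -> R, forall i,
    [/\ y i t0 = (i == j)%:R,
      forall t, J t -> is_derive t (1 : R) (y i) (\sum_l T t i l * y l t),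
      (j < i)%N -> forall t, y i t = 0 &
      i = j -> forall t, 0 < y i t].
Proof.
move=> oJ iJ Jt0 uT cT.
have claim k : (k <= n)%N -> exists y : 'I_n -> R -> R, forall i : 'I_n, (n - i <= k)%N ->
    [/\ y i t0 = (i == j)%:R,
      forall t, J t -> is_derive t (1 : R) (y i) (\sum_l T t i l * y l t),
      (j < i)%N -> forall t, y i t = 0 &
      i = j -> forall t, 0 < y i t].
  elim: k => [|k IH] kn.
    by exists (fun _ _ => 0) => i; rewrite leqn0 subn_eq0 leqNgt ltn_ord.
  have [y yP] := IH (ltnW kn).
  have i0n : (n - k.+1 < n)%N by rewrite -subSn // subSS leq_subr.
  pose i0 := Ordinal i0n.
  have gt_i0 (l : 'I_n) : (i0 < l)%N -> (n - l <= k)%N.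
    by move=> il; rewrite leq_subCl -ltnS -subSn // subSS in il *.
  have le_i0 (l : 'I_n) : (n - l <= k)%N -> (i0 < l)%N.
    by move=> lk; rewrite /= -subSn // subSS leq_subCl.
  pose q t := \sum_(l < n | (i0 < l)%N) T t i0 l * y l t.
  have cq t : J t -> {for t, continuous q}.
    move=> Jt; have -> : q = \sum_(l < n | (i0 < l)%N) (fun s => T s i0 l * y l s).
      by apply/funext => s; rewrite fct_sumE.
    apply: (big_ind (fun f : R -> R => {for t, continuous f})).
    - exact: cst_continuous.
    - by move=> f g cf cg; apply: continuousD.
    - move=> l il; apply: continuousM; first exact: cT.
      have [_ dy _ _] := yP l (gt_i0 l il).
      exact: is_derive_continuous (dy t Jt).
  have cp t : J t -> {for t, continuous (fun s => T s i0 i0)} by move=> Jt; apply: cT.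
  have [z [P [z0 dz zE]]] := linear_ode_exists (i0 == j)%:R oJ iJ Jt0 cp cq.
  have q0 : (j <= i0)%N -> forall t, q t = 0.
    move=> ji t; rewrite /q big1 // => l il.
    have [_ _ yl0 _] := yP l (gt_i0 l il).
    by rewrite yl0 ?mulr0 // (leq_ltn_trans ji).
  exists (fun i => if i == i0 then z else y i) => i ik.
  have sumE t : J t -> i != i0 ->
      \sum_l T t i l * (if l == i0 then z else y l) t = \sum_l T t i l * y l t.
    move=> Jt ii0; apply: eq_bigr => l _; case: eqP => // ->; rewrite uT ?mul0r //.
    apply: le_i0; move: ik; rewrite leq_eqVlt => /orP[/eqP E|//].
    case/eqP: ii0; apply/val_inj => /=.
    by rewrite -E subKn // ltnW.
  case: (eqVneq i i0) => [->|ii0].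
    split=> //.
    - move=> t Jt; have dzt := dz t Jt; apply: is_derive_eq.
      rewrite [RHS](bigD1 i0) //= eqxx; congr (_ + _).
      rewrite [RHS](bigID (fun l : 'I_n => (i0 < l)%N)) /= [X in _ = _ + X]big1 ?addr0.
        apply: eq_big => [l|l il].
          by rewrite andbC; case: ltnP => //= il; rewrite -(inj_eq val_inj) gtn_eqF.
        by rewrite ifN // -(inj_eq val_inj) gtn_eqF.
      by move=> l /andP[li il]; rewrite uT ?mul0r // ltn_neqAle leqNgt il andbT.
    - by move=> ji t; rewrite zE; [rewrite -(inj_eq val_inj) gtn_eqF // mul0r|exact/q0/ltnW].
    - by move=> E t; rewrite zE; [rewrite E eqxx mul1r expR_gt0|apply: q0; rewrite E].
  have ik' : (n - i <= k)%N.
    move: ik; rewrite leq_eqVlt => /orP[/eqP E|//].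
    by case/eqP: ii0; apply/val_inj => /=; rewrite -E subKn // ltnW.
  have [y0 dy yj yp] := yP i ik'; split=> //.
  by move=> t Jt; rewrite sumE //; apply: dy.
have [y yP] := claim n (leqnn n).
by exists y => i; apply: yP; apply: leq_subr.
Qed.

Lemma upper_ode_exists (J : set R) n (T : R -> 'M[R]_n) t0 :
  open J -> is_interval J -> J t0 ->
  (forall t, J t -> upper (T t)) ->
  (forall t, J t -> forall i l, {for t, continuous (fun s => T s i l)}) ->
  exists Y : R -> 'M[R]_n, [/\ Y t0 = 1%:M,
    forall t, J t -> mx_derive Y t (T t *m Y t),
    forall t, upper (Y t) & forall t i, 0 < Y t i i].
Proof.
move=> oJ iJ Jt0 uT cT.
have /fin_all_exists[y yP] (j : 'I_n) := upper_ode_column j oJ iJ Jt0 uT cT.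
exists (fun t => \matrix_(i, j) y j i t); split.
- by apply/matrixP => i j; rewrite !mxE; have [] := yP j i.
- move=> t Jt i j; have [_ dy _ _] := yP j i.
  have -> : (fun s => (\matrix_(i, j) y j i s) i j) = y j i.
    by apply/funext => s; rewrite mxE.
  have dyt := dy t Jt; apply: is_derive_eq; rewrite mxE.
  by apply: eq_bigr => l _; rewrite mxE.
- by move=> t i j ji; rewrite mxE; have [_ _ y0 _] := yP j i; exact: y0.
- by move=> t i; rewrite mxE; have [_ _ _ y_gt0] := yP i i; exact: y_gt0.
Qed.

(** Once the rows below are zero, row i satisfies a homogeneous scalar equation; multiplied by the
    positive integrating factor z, its entries are constant. *)
Lemma upper_ode_zero (J : set R) n m (T : R -> 'M[R]_n) (X : R -> 'M[R]_(n, m)) t0 :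
  open J -> is_interval J -> J t0 ->
  (forall t, J t -> upper (T t)) ->
  (forall t, J t -> forall i l, {for t, continuous (fun s => T s i l)}) ->
  (forall t, J t -> mx_derive X t (T t *m X t)) -> X t0 = 0 ->
  forall t, J t -> X t = 0.
Proof.
move=> oJ iJ Jt0 uT cT dX X0.
have claim k (i : 'I_n) j : (n - i <= k)%N -> forall t, J t -> X t i j = 0.
  elim: k i => [|k IH] i; first by rewrite leqn0 subn_eq0 leqNgt ltn_ord.
  move=> ik; have cp s : J s -> {for s, continuous (fun u => - T u i i)}.
    by move=> Js; apply: continuousN; apply: cT.
  have c0 s : J s -> {for s, continuous (cst 0 : R -> R)} by move=> _; apply: cst_continuous.
  have [z [P [_ dz zE]]] := linear_ode_exists 1 oJ iJ Jt0 cp c0.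
  have z_gt0 t : 0 < z t by rewrite zE // mul1r expR_gt0.
  have dXz s : J s -> is_derive s (1 : R) (fun u => X u i j * z u) 0.
    move=> Js; have d1 := dX s Js i j; have d2 := dz s Js.
    have d3 := is_derive_mul d1 d2; apply: is_derive_eq.
    rewrite mxE (bigD1 i) //= big1 ?addr0 => [|l li].
      by rewrite mulNr mulrN mulrA [X s i j * _]mulrC subrr.
    have [li'|il|/val_inj E] := ltngtP l i; last by rewrite E eqxx in li.
      by rewrite uT ?mul0r.
    rewrite IH ?mulr0 // -ltnS; apply: leq_trans ik.
    by rewrite ltn_sub2l.
  move=> t Jt; have := zero_derive_cst iJ dXz Jt Jt0.
  rewrite X0 mxE mul0r => /eqP; rewrite mulf_eq0 (gt_eqF (z_gt0 t)) orbF.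
  by move/eqP.
by move=> t Jt; apply/matrixP => i j; rewrite mxE; apply: claim Jt; apply: leq_subr.
Qed.

End MatrixDerivative.

(** * The Toda flow *)

Section Flow.
Variable R : realType.

Lemma pi_u_skew n (M : 'M[R]_n) : (pi_u M)^T = - pi_u M.
Proof.
apply/matrixP => i j; rewrite !mxE.
by case: ltngtP => _; rewrite ?opprK ?oppr0.
Qed.

Lemma upper_sub_pi_u n (M : 'M[R]_n) : upper (M - pi_u M).
Proof. by move=> i j ji; rewrite !mxE ji subrr. Qed.

Lemma prodr_expR (I : Type) (r : seq I) (P : pred I) (f : I -> R) (s : R) :
  \prod_(i <- r | P i) expR (s * f i) = expR (s * \sum_(i <- r | P i) f i).
Proof.
elim/big_rec2: _ => [|i x y _ ->]; first by rewrite mulr0 expR0.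
by rewrite mulrDr expRD.
Qed.

Lemma is_derive_expR_lin (t0 c t : R) :
  is_derive t (1 : R) (fun s => expR ((s - t0) * c)) (c * expR ((t - t0) * c)).
Proof.
have d1 : is_derive t (1 : R) (fun s => s - t0) 1.
  have d : is_derive t (1 : R) (id - cst t0) (1 - 0) by apply: is_deriveB.
  by rewrite subr0 in d.
have d2 : is_derive t (1 : R) (fun s => (s - t0) * c) (1 * c + (t - t0) * 0).
  exact: is_derive_mul d1 (is_derive_cst c t 1).
have := is_derive1_comp (is_derive_expR _) d2.
by rewrite mulr0 addr0 mul1r mulrC.
Qed.

(** The compound of Y is upper triangular for the lexicographic order with positive diagonal, so it
    keeps the last nonzero minor in place and positive; e rescales all minors of a given size by one
    positive factor. *)
Lemma canonical_rep_upper_mul n (Y Q : 'M[R]_n) (e : 'I_n -> R) :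
  canonical_rep (cplx Q) -> upper Y -> (forall i, 0 < Y i i) -> (forall i, 0 < e i) ->
  let Q' := Y *m Q *m diag_mx (\row_i e i) in
  Q'^T *m Q' = 1%:M -> canonical_rep (cplx Q').
Proof.
move=> [_ [w [cell pos]]] uY Y_gt0 e_gt0 Q' QQ'.
split; first exact: unitarymx_cplx.
have uYC : upper (cplx Y) by move=> i j ji; rewrite mxE uY // rmorph0.
have uE : upper (diag_mx (\row_i e i)) by apply: upper_diag.
have uEC : upper (cplx (diag_mx (\row_i e i))) by move=> i j ji; rewrite mxE uE // rmorph0.
exists w; split.
  rewrite /Q' !cplxM; apply: (schubert_cell_mulr _ uEC); last first.
    apply/(upper_unit uEC) => i; rewrite 3!mxE eqxx fmorph_eq0.
    by rewrite mulr1n gt_eqF.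
  apply: (schubert_cell_mull cell uYC); apply/(upper_unit uYC) => i.
  by rewrite mxE fmorph_eq0 gt_eqF.
move=> k kn a aE; have /andP[k0 kn'] := kn.
have [Qa Q0] := pos k kn a aE.
have [p p_gt0 minE] : exists2 p, 0 < p & forall b,
    minors k Q' b 0 = p * \sum_d compound k Y b d * minors k Q d 0.
  exists (\prod_(i < n | (i < k)%N) e i) => [|b]; first exact: prodr_gt0.
  rewrite minors_upper // mxE minors_mul; congr (_ * _); last by rewrite mxE.
  by apply: eq_bigr => i _; rewrite !mxE eqxx.
have Qa' : 0 < minors k Q a 0 by move: Qa; rewrite minors_cplx mxE ltcR.
have Q0' (d : 'I_('C(n, k))) : (a < d)%N -> minors k Q d 0 = 0.
  by move=> ad; have /eqP := Q0 d ad; rewrite minors_cplx mxE fmorph_eq0 => /eqP.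
split=> [|b ab]; rewrite minors_cplx mxE minE; last first.
  rewrite big1 ?mulr0 ?rmorph0 // => d _.
  have [db|bd] := ltnP d b; first by rewrite compound_upper ?mul0r.
  by rewrite Q0' ?mulr0 // (leq_trans ab).
rewrite ltcR pmulr_rgt0 // (bigD1 a) //= big1 ?addr0 => [|d da].
  by rewrite mulr_gt0 // compound_diag_upper // prodr_gt0.
have [da'|ad|/val_inj E] := ltngtP d a; last by rewrite E eqxx in da.
  by rewrite compound_upper ?mul0r.
by rewrite Q0' ?mulr0.
Qed.

Section TodaCurve.
Variables (n : nat) (lam : 'I_n -> R) (J : set R) (M : R -> 'M[R]_n).
Hypotheses (lam_inj : injective lam) (oJ : open J) (iJ : is_interval J).
Hypothesis dM : toda_curve J M.
Variables (t0 : R) (Q0 : 'M[R]_n).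
Hypotheses (Jt0 : J t0) (fQ0 : toda_frame lam (M t0) Q0).

(* Solving Y' = (M - pi_u M) Y, Y(t0) = 1, gives M Y = Y M(t0), and makes
   Y Q0 exp(-(t - t0) Lambda) orthogonal: it is the solution of Q' = -(pi_u M) Q. *)
Lemma toda_curve_frame t : J t -> exists Y : 'M[R]_n,
  [/\ upper Y, forall i, 0 < Y i i &
   toda_frame lam (M t) (Y *m Q0 *m diag_mx (\row_i expR ((t - t0) * - lam i)))].
Proof.
pose T s := M s - pi_u (M s).
have [QQ0 MQ0 cQ0] := fQ0.
have dMx s : J s -> mx_derive M s (M s *m pi_u (M s) - pi_u (M s) *m M s).
  by move=> Js i j; apply: dM.
have cM s : J s -> forall i j, {for s, continuous (fun u => M u i j)}.
  by move=> Js i j; apply: is_derive_continuous (dMx s Js i j).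
have uT s : J s -> upper (T s) by move=> _; apply: upper_sub_pi_u.
have cT s : J s -> forall i j, {for s, continuous (fun u => T u i j)}.
  move=> Js i j.
  have -> : (fun u => T u i j) = (fun u => M u i j) - (fun u => pi_u (M u) i j).
    by apply/funext => u; rewrite [LHS]mxE [X in _ + X]mxE.
  apply: continuousB; first exact: cM.
  have -> : (fun u => pi_u (M u) i j) = if (j < i)%N then (fun u => M u i j)
      else if (i < j)%N then - (fun u => M u j i) else cst 0.
    by apply/funext => u; rewrite mxE; case: ifP => // _; case: ifP.
  case: ifP => _; first exact: cM.
  by case: ifP => _; [apply/continuousN/cM|apply: cst_continuous].
have [Y [Y0 dY uY Y_gt0]] := upper_ode_exists oJ iJ Jt0 uT cT.
have MY s : J s -> M s *m Y s = Y s *m M t0.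
  (* The Toda equation reads M' + M T = T M, so X satisfies X' = T X with X(t0) = 0. *)
  pose X u := M u *m Y u + - (Y u *m M t0).
  have dX u : J u -> mx_derive X u (T u *m X u).
    move=> Ju; have d1 := mx_deriveM (dMx u Ju) (dY u Ju).
    have d2 := mx_deriveM (dY u Ju) (mx_derive_cst (M t0) u).
    have := mx_deriveD d1 (mx_deriveN d2); rewrite mulmx0 addr0.
    suff -> : (M u *m pi_u (M u) - pi_u (M u) *m M u) *m Y u + M u *m (T u *m Y u) +
       - (T u *m Y u *m M t0) = T u *m X u by [].
    rewrite /X mulmxDr mulmxN !mulmxA -mulmxDl; congr (_ *m _ - _).
    by rewrite /T mulmxBr mulmxBl addrC addrA subrK.
  have X0 : X t0 = 0 by rewrite /X Y0 mulmx1 mul1mx subrr.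
  move=> Js; apply/eqP; rewrite -subr_eq0; apply/eqP.
  exact: (upper_ode_zero oJ iJ Jt0 uT cT dX X0 Js).
pose L := diag_mx (\row_i lam i).
pose E s := diag_mx (\row_i expR ((s - t0) * - lam i)).
pose Q s := Y s *m Q0 *m E s.
have MQ s : J s -> M s *m Q s = Q s *m L.
  move=> Js; rewrite /Q !mulmxA MY // -(mulmxA (Y s)) MQ0 -!mulmxA.
  by congr (_ *m (_ *m _)); exact: diag_mxC.
have dE s : mx_derive E s (- (E s *m L)).
  move=> i j.
  have -> : (fun u => E u i j) = if i == j then (fun u => expR ((u - t0) * - lam i)) else cst 0.
    by apply/funext => u; rewrite !mxE; case: ifP.
  rewrite mxE mul_mx_diag !mxE; case: eqP => [->|_].
    have d := is_derive_expR_lin t0 (- lam j) s; apply: is_derive_eq.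
    by rewrite mulNr mulrC.
  by rewrite mul0r oppr0; apply: is_derive_cst.
(* Q' = T Q - Q L, and Q L = M Q turns this into (T - M) Q. *)
have dQ s : J s -> mx_derive Q s (- (pi_u (M s) *m Q s)).
  move=> Js; have d1 := mx_deriveM (dY s Js) (mx_derive_cst Q0 s).
  have := mx_deriveM d1 (dE s).
  suff -> : (T s *m Y s *m Q0 + Y s *m 0) *m E s + Y s *m Q0 *m - (E s *m L) =
     - (pi_u (M s) *m Q s) by [].
  rewrite mulmx0 addr0 mulmxN mulmxA -/(Q s) -MQ // -!mulmxA (mulmxA (Y s)) -/(Q s).
  by rewrite /T mulmxBl addrAC subrr add0r.
have QQ s : J s -> (Q s)^T *m Q s = 1%:M.
  pose P u := (Q u)^T *m Q u.
  have dP u : J u -> mx_derive P u 0.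
    move=> Ju; have := mx_deriveM (mx_derive_tr (dQ u Ju)) (dQ u Ju).
    suff -> : (- (pi_u (M u) *m Q u))^T *m Q u + (Q u)^T *m - (pi_u (M u) *m Q u) = 0 by [].
    rewrite linearN /= trmx_mul pi_u_skew mulmxN opprK mulmxN -mulmxA.
    by rewrite subrr.
  move=> Js; have := mx_derive_zero_cst iJ dP Js Jt0; rewrite /P => ->.
  have -> : Q t0 = Q0.
    rewrite /Q Y0 mul1mx /E; suff -> : \row_i expR ((t0 - t0) * - lam i) = const_mx 1.
      by rewrite diag_const_mx mulmx1.
    by apply/rowP => i; rewrite !mxE subrr mul0r expR0.
  exact: QQ0.
move=> Jt; exists (Y t); split; [exact: uY|exact: Y_gt0|].
split; [exact: QQ|exact: MQ|].
apply: canonical_rep_upper_mul => // [i|]; first exact: expR_gt0.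
exact: QQ.
Qed.

Lemma toda_curve_point k t : (k <= n)%N -> J t ->
  toda_point lam (M t) (\col_a (expR ((t - t0) * ksum lam a) *
    minors k (altsign R n *m Q0^T) a 0)).
Proof.
move=> kn Jt; have [Y [uY Y_gt0 fQ]] := toda_curve_frame Jt.
apply/(toda_pointE lam_inj _ kn fQ); have [QQ _ _] := fQ.
pose e i := expR ((t - t0) * lam i).
pose f i := expR ((t - t0) * - lam i).
set Q := Y *m Q0 *m _ in fQ QQ *.
have Yu : Y \in unitmx by apply/(upper_unit uY) => i; rewrite gt_eqF.
have [QQ0 _ _] := fQ0.
have ef : diag_mx (\row_i e i) *m diag_mx (\row_i f i) = 1%:M.
  rewrite mulmx_diag; apply/matrixP => i j; rewrite !mxE -expRD -mulrDr subrr mulr0 expR0.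
  by case: eqP.
have QTE : Q^T = diag_mx (\row_i e i) *m Q0^T *m invmx Y.
  rewrite -(invmx_orth QQ); have [_ Qu] := mulmx1_unit QQ.
  apply: (can_inj (mulmxK Qu)); rewrite mulVmx //.
  by rewrite /Q !mulmxA mulmxKV // -(mulmxA _ Q0^T) QQ0 mulmx1 ef.
have uYV := upper_inv uY Yu.
have YVn i : invmx Y i i != 0.
  by move: i; apply/(upper_unit uYV); rewrite unitmx_inv.
pose c := \prod_(i < n | (i < k)%N) invmx Y i i.
have c0 : c != 0 by apply/prodf_neq0 => i _; apply: YVn.
exists c^-1; first by rewrite invr_eq0.
have DA : altsign R n *m diag_mx (\row_i e i) = diag_mx (\row_i e i) *m altsign R n.
  exact: diag_mxC.
have -> : minors k (altsign R n *m Q^T) =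
    c *: (compound k (diag_mx (\row_i e i)) *m minors k (altsign R n *m Q0^T)).
  rewrite QTE [in LHS]mulmxA minors_upper // (mulmxA (altsign R n)) DA.
  by rewrite -(mulmxA (diag_mx _)) minors_mul.
rewrite scalerA mulVf // scale1r.
apply/colP => a; rewrite compound_diag mul_diag_mx mxE [RHS]mxE.
by rewrite [X in _ = X * _]mxE prodr_expR.
Qed.

Lemma toda_curve_gradient k : (k <= n)%N ->
  exists x : R -> 'cV[R]_('C(n, k)), forall t, J t ->
    toda_point lam (M t) (x t) /\
    forall a, is_derive t (1 : R) (fun s => x s a 0) (ksum lam a * x t a 0).
Proof.
move=> kn; eexists => t Jt; split; first exact: toda_curve_point.
move=> a; set m := minors k _.
have -> : (fun s => (\col_a (expR ((s - t0) * ksum lam a) * m a 0)) a 0) =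
    (fun s => expR ((s - t0) * ksum lam a) * m a 0).
  by apply/funext => s; rewrite mxE.
have d := is_derive_mul (is_derive_expR_lin t0 (ksum lam a) t) (is_derive_cst (m a 0) t 1).
by apply: is_derive_eq; rewrite mulr0 addr0 [X in _ = _ * X]mxE mulrA.
Qed.

End TodaCurve.
End Flow.

(** * The Toda lattice flow of the tridiagonal matrices *)

Section LanczosFlow.
Variable R : realType.

Lemma is_derive_unique (f : R -> R) (t a b : R) :
  is_derive t (1 : R) f a -> is_derive t (1 : R) f b -> a = b.
Proof. by move=> [_ <-] [_ <-]. Qed.

Lemma mx_derive_unique m n (A : R -> 'M[R]_(m, n)) t D D' :
  mx_derive A t D -> mx_derive A t D' -> D = D'.
Proof.
by move=> dA dA'; apply/matrixP => i j; apply: is_derive_unique (dA i j) (dA' i j).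
Qed.

Lemma is_derive_dot N (u v : R -> 'cV[R]_N) t du dv :
  mx_derive u t du -> mx_derive v t dv ->
  is_derive t (1 : R) (fun s => dot (u s) (v s)) (dot du (v t) + dot (u t) dv).
Proof.
move=> hu hv; have := mx_deriveM (mx_derive_tr hu) hv 0 0.
by rewrite mxE.
Qed.

Lemma mx_deriveZ m n (c : R -> R) (A : R -> 'M[R]_(m, n)) t dc dA :
  is_derive t (1 : R) c dc -> mx_derive A t dA ->
  mx_derive (fun s => c s *: A s) t (dc *: A t + c t *: dA).
Proof.
move=> hc hA i j.
have -> : (fun s => (c s *: A s) i j) = (fun s => c s * A s i j).
  by apply/funext => s; rewrite mxE.
by rewrite !mxE; apply: is_derive_mul.
Qed.

Lemma is_derive_inv_norm N (u : R -> 'cV[R]_N) t du : u t != 0 -> mx_derive u t du ->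
  exists d, is_derive t (1 : R) (fun s => (Num.sqrt (dot (u s) (u s)))^-1) d.
Proof.
move=> u0 hu; have dd := is_derive_dot hu hu.
have dot0 : 0 < dot (u t) (u t) by rewrite dot_gt0.
have ds := is_derive1_comp (is_derive1_sqrt dot0) dd.
eexists; apply: is_deriveV ds.
by rewrite /= gt_eqF // sqrtr_gt0.
Qed.

(** Only the existence of derivatives is recorded: the derivative of the orthogonal factor is
    identified afterwards by [pi_u_unique]. *)
Lemma gsv_derivable N m (v : R -> nat -> 'cV[R]_N) t :
  (forall j, (j < m)%N -> exists D, mx_derive (fun s => v s j) t D) ->
  (forall j, (j < m)%N -> gsu (v t) j != 0) ->
  forall j, (j < m)%N -> exists D, mx_derive (fun s => gsv (v s) j) t D.
Proof.
move=> dv u0 j; have [l] := ubnP j; elim: l j => // l IH j /ltnSE jl jm.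
have [Dv dvj] := dv j jm.
have /fin_all_exists[Dw dw] (i : 'I_j) : exists D, mx_derive (fun s => gsv (v s) i) t D.
  by apply: IH; rewrite ?(leq_trans (ltn_ord i)) // ltnW // (leq_ltn_trans _ jm) // ltnW.
have [Du du] : exists D, mx_derive (fun s => gsu (v s) j) t D.
  have ds (i : 'I_j) := mx_deriveZ (is_derive_dot (dw i) dvj) (dw i).
  have dsum := fun a b => is_derive_bigsum (index_enum 'I_j) (fun i (_ : predT i) => ds i a b).
  exists (Dv + - \matrix_(a, b) \sum_(i < j)
    ((dot (Dw i) (v t j) + dot (gsv (v t) i) Dv) *: gsv (v t) i
      + dot (gsv (v t) i) (v t j) *: Dw i) a b).
  apply: mx_deriveD dvj _; apply: mx_deriveN => a b; rewrite mxE.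
  have -> : (fun s => (\sum_(i < j) dot (gsv (v s) i) (v s j) *: gsv (v s) i) a b) =
      (fun s => \sum_(i < j) (dot (gsv (v s) i) (v s j) *: gsv (v s) i) a b).
    by apply/funext => s; rewrite summxE.
  exact: dsum.
have [d dn] := is_derive_inv_norm (u0 j jm) du.
have := mx_deriveZ dn du; set D := (X in mx_derive _ _ X) => dD; exists D.
have -> : (fun s => gsv (v s) j) =
   (fun s => (Num.sqrt (dot (gsu (v s) j) (gsu (v s) j)))^-1 *: gsu (v s) j).
  by apply/funext => s; rewrite gsvE.
exact: dD.
Qed.

Lemma pi_u_unique m (T S : 'M[R]_m) : T^T = T -> S^T = - S -> upper (T - S) ->
  S = pi_u T.
Proof.
move=> symT skS uTS.
have low (i j : 'I_m) : (j < i)%N -> S i j = T i j.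
  by move=> ji; have /eqP := uTS i j ji; rewrite !mxE subr_eq0 => /eqP.
have skE i j : S i j = - S j i by have /matrixP/(_ j i) := skS; rewrite !mxE.
apply/matrixP => i j; rewrite mxE; case: ltngtP => [ji|ij|/val_inj ->].
- exact: low.
- by rewrite skE low.
- have : S i i *+ 2 == 0 by rewrite mulr2n {2}skE subrr.
  by rewrite mulrn_eq0 => /orP[//|/eqP].
Qed.

Variables (m : nat) (nu f0 : 'I_m -> R) (t0 : R).
Hypotheses (nu_inj : injective nu) (f0_gt0 : forall i, 0 < f0 i).

Let f t i := expR ((t - t0) * nu i) * f0 i.

Let f_neq0 t i : f t i != 0.
Proof. by rewrite mulf_neq0 // gt_eqF // expR_gt0. Qed.

(* Writing the Krylov matrix as K = W R with W orthogonal and R upper triangular,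
   K' = diag(nu) K shows that W^T W' = pi_u T for T = W^T diag(nu) W. *)
Lemma lanczos_toda t :
  let T s := lanczos_tridiag nu (f s) in
  mx_derive T t (T t *m pi_u (T t) - pi_u (T t) *m T t).
Proof.
move=> T.
pose D := diag_mx (\row_i nu i).
pose W s := lanczos nu (f s).
pose K s : 'M[R]_m := \matrix_(i, j) pkrylov nu (f s) j i 0.
pose U s := (W s)^T *m K s.
have WW s : (W s)^T *m W s = 1%:M by apply: lanczos_orth.
have WWt s : W s *m (W s)^T = 1%:M by apply: lanczos_orthV.
have dpk s j : mx_derive (fun u => pkrylov nu (f u) j) s (D *m pkrylov nu (f s) j).
  move=> i l.
  have -> : (fun u => pkrylov nu (f u) j i l) =
      (fun u => (nu i ^+ j * f0 i) * expR ((u - t0) * nu i)).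
    by apply/funext => u; rewrite mxE /f mulrA mulrAC.
  have := is_derive_mul (is_derive_cst (nu i ^+ j * f0 i) s 1) (is_derive_expR_lin t0 (nu i) s).
  move=> d; apply: is_derive_eq; rewrite mul0r add0r mul_diag_mx !mxE /f.
  by rewrite mulrCA -mulrA [f0 i * _]mulrC.
have dK s : mx_derive K s (D *m K s).
  move=> i j.
  have -> : (fun u => K u i j) = (fun u => pkrylov nu (f u) j i 0).
    by apply/funext => u; rewrite mxE.
  have -> : (D *m K s) i j = (D *m pkrylov nu (f s) j) i 0.
    by rewrite !mul_diag_mx !mxE.
  exact: dpk.
have [dW hW] : exists dW, mx_derive W t dW.
  have /fin_all_exists[d dP] (j : 'I_m) :
      exists d, mx_derive (fun s => gsv (pkrylov nu (f s)) j) t d.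
    apply: (@gsv_derivable m m) => [l lm|l lm|//].
      by exists (D *m pkrylov nu (f t) l); apply: dpk.
    exact: gsu_pkrylov_neq0.
  exists (\matrix_(i, j) d j i 0) => i j; rewrite mxE.
  have -> : (fun s => W s i j) = (fun s => gsv (pkrylov nu (f s)) j i 0).
    by apply/funext => s; rewrite mxE.
  exact: dP.
have UE s i j : U s i j = dot (gsv (pkrylov nu (f s)) i) (pkrylov nu (f s) j).
  by rewrite /U !mxE dotE; apply: eq_bigr => l _; rewrite !mxE.
have uU s : upper (U s).
  move=> i j ji; rewrite UE; apply: gsv_tri (ltn_ord i) ji => l lm.
  exact: gsu_pkrylov_neq0.
have Uu s : U s \in unitmx.
  apply/(upper_unit (uU s)) => i; rewrite UE.
  have gsu0 := gsu_pkrylov_neq0 nu_inj (f_neq0 s).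
  by rewrite (gsv_diag gsu0) // gt_eqF // sqrtr_gt0 dot_gt0 gsu0.
have [dU hU] : exists dU, mx_derive U t dU.
  by eexists; apply: mx_deriveM (mx_derive_tr hW) (dK t).
have udU : upper dU.
  move=> i j ji; apply: is_derive_unique (hU i j) _.
  have -> : (fun s => U s i j) = cst 0 by apply/funext => s; rewrite uU.
  exact: is_derive_cst.
have KE s : K s = W s *m U s by rewrite /U mulmxA WWt mul1mx.
have E1 : D *m K t = dW *m U t + W t *m dU.
  apply: mx_derive_unique (dK t) _.
  have -> : K = (fun s => W s *m U s) by apply/funext.
  exact: mx_deriveM hW hU.
pose S := (W t)^T *m dW.
(* Splits T into a skew part and an upper triangular part; such a splitting is unique. *)
have TE : T t = S + dU *m invmx (U t).
  have : T t *m U t = S *m U t + dU.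
    rewrite /T /lanczos_tridiag -/(W t) -/D -!mulmxA -KE E1 mulmxDr.
    by rewrite !mulmxA WW mul1mx.
  move=> /(congr1 (mulmx^~ (invmx (U t)))).
  by rewrite mulmxK // mulmxDl mulmxK.
have skS : S^T = - S.
  have := mx_deriveM (mx_derive_tr hW) hW.
  have -> : (fun s => (W s)^T *m W s) = (fun=> 1%:M) by apply/funext.
  move/(mx_derive_unique (mx_derive_cst _ _)) => /esym/eqP; rewrite addr_eq0.
  by rewrite /S trmx_mul trmxK => /eqP.
have [symT _] := lanczos_jacobi nu_inj (f_neq0 t).
have SE : S = pi_u (T t).
  apply: pi_u_unique => //; rewrite TE addrC addKr.
  by apply: upper_mul udU (upper_inv (uU t) (Uu t)).
have dWE : dW = W t *m S by rewrite /S mulmxA WWt mul1mx.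
have hT := mx_deriveM (mx_deriveM (mx_derive_tr hW) (mx_derive_cst D t)) hW.
rewrite -SE; have -> : T t *m S - S *m T t =
  (dW^T *m D + (W t)^T *m 0) *m W t + (W t)^T *m D *m dW; last exact: hT.
rewrite mulmx0 addr0 dWE trmx_mul skS !mulNmx /T /lanczos_tridiag -/(W t) -/D.
by rewrite addrC !mulmxA.
Qed.

End LanczosFlow.

Section Moser.
Variable R : realType.

(** The uniqueness clause of [is_moser] identifies S with the explicit matrix, whose dependence on x
    can then be differentiated. *)
Lemma is_moser_abs_lanczos N (mu : 'I_N -> R) (x : 'cV[R]_N) (S : sqmx R) :
  injective mu -> x != 0 -> is_moser_abs mu x S ->
  let s := tnth (in_tuple (support_by mu x)) in
  S = Sqmx (lanczos_tridiag (fun i => mu (s i)) (fun i => `|x (s i) 0|)).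
Proof.
move=> mu_inj x0 [T -> [spec uniqT]] s; congr Sqmx; apply/esym/uniqT.
apply: lanczos_moser.
- have /cV0Pn[a xa] := x0; have := mem_support_by mu x a.
  by rewrite xa; case: (support_by mu x).
- by move=> i j /mu_inj/tnth_support_inj.
- by move=> i; rewrite normr_gt0; apply/(tnth_support mu); exists i.
Qed.

End Moser.

(** * From symmetric Toda curves to tridiagonal ones *)

Section Assembly.
Variables (R : realType) (n : nat) (lam : 'I_n -> R).
Hypothesis lam_inj : injective lam.

Lemma toda_point_moser M k (x : 'cV[R]_('C(n, k))) : (k <= n)%N ->
  injective (@ksum R n lam k) -> sym_with_eigenvalues lam M -> toda_point lam M x ->
  is_moser_abs (@ksum R n lam k) x (tridiag (ext_mx M k)).
Proof.
move=> kn mu_inj /(toda_frame_exists lam_inj)[Q fQ].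
move/(toda_pointE lam_inj _ kn fQ) => [c c0 xE]; have [QQ MQ _] := fQ.
have bin0 : (0 < 'C(n, k))%N by rewrite bin_gt0.
apply: (@is_moser_abs_spectral _ _ _ (compound k Q) _ (Ordinal bin0) _ `|c|) => //.
- by rewrite -compound_tr -compound_mul QQ compound1.
- exact: ext_mx_diag.
- by rewrite normr_gt0.
- by move=> a; rewrite xE mxE normrM (@norm_flag_minors _ _ _ _ (Ordinal bin0)).
Qed.

(** The coordinates evolve by nonvanishing exponential factors, so the support, and with it the size
    of the tridiagonal matrix, is constant in time; [lanczos_toda] then applies to their absolute
    values. *)
Lemma tridiag_toda_curve (J : set R) (M : R -> 'M[R]_n) k : (k <= n)%N ->
  injective (@ksum R n lam k) -> open J -> is_interval J ->
  (forall t, J t -> sym_with_eigenvalues lam (M t)) -> toda_curve J M ->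
  exists m (T : R -> 'M[R]_m),
    (forall t, J t -> tridiag (ext_mx (M t) k) = Sqmx (T t) /\ jacobi (T t)) /\
    toda_curve J T.
Proof.
move=> kn mu_inj oJ iJ symM dM.
case: (pselect (exists t0, J t0)) => [[t0 Jt0]|noJ]; last first.
  by exists 0%N, (fun=> 0); split=> t Jt; case: noJ; exists t.
have [Q fQ] := toda_frame_exists lam_inj (symM t0 Jt0); have [QQ _ _] := fQ.
pose y := minors k (altsign R n *m Q^T).
pose mu := @ksum R n lam k.
pose x t : 'cV[R]_('C(n, k)) := \col_a (expR ((t - t0) * mu a) * y a 0).
have xP t : J t -> toda_point lam (M t) (x t).
  exact: (toda_curve_point lam_inj oJ iJ dM Jt0 fQ kn).
have y0 : y != 0.
  exact: minors_neq0 kn (altsign_tr_unit QQ).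
have xy t a : (x t a 0 != 0) = (y a 0 != 0).
  by rewrite mxE mulf_eq0 gt_eqF // expR_gt0.
have supp_eq t : support_by mu (x t) = support_by mu y.
  by congr sort; apply: eq_filter => a; apply: xy.
have x0 t : x t != 0.
  have /cV0Pn[a ya] := y0; apply/cV0Pn; exists a.
  by rewrite xy.
pose s := tnth (in_tuple (support_by mu y)).
pose nu i := mu (s i).
have nu_inj : injective nu by move=> i j /mu_inj/tnth_support_inj.
have y_gt0 i : 0 < `|y (s i) 0| by rewrite normr_gt0; apply/(tnth_support mu); exists i.
pose f t i := expR ((t - t0) * nu i) * `|y (s i) 0|.
have f_neq0 t i : f t i != 0 by rewrite mulf_neq0 // gt_eqF // expR_gt0.
exists (size (support_by mu y)), (fun t => lanczos_tridiag nu (f t)); split=> t Jt.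
  split; last exact: lanczos_jacobi.
  have := toda_point_moser kn mu_inj (symM t Jt) (xP t Jt).
  move/(is_moser_abs_lanczos mu_inj (x0 t)) => /=; rewrite -/mu supp_eq => ->.
  congr (Sqmx (lanczos_tridiag _ _)); apply/funext => i.
  by rewrite mxE normrM gtr0_norm // expR_gt0.
exact: lanczos_toda.
Qed.

End Assembly.

Theorem theorem1p2 (R : realType) (n : nat) (lam : 'I_n -> R)
  (n_gt0 : (0 < n)%N)
  (lam_decr : forall i j : 'I_n, (i < j)%N -> lam j < lam i)
  (ksum_inj : forall k, (0 < k < n)%N -> injective (@ksum R n lam k)) :
  (* the map to the product of real projective spaces is well defined *)
  (forall M, sym_with_eigenvalues lam M ->
     forall k, (0 < k < n)%N -> proj_point (toda_point lam M (k := k)))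
  (* it is injective *)
  /\ (forall M M', sym_with_eigenvalues lam M -> sym_with_eigenvalues lam M' ->
        (forall k, (0 < k < n)%N ->
           toda_point lam M (k := k) = toda_point lam M' (k := k)) ->
        M = M')
  (* it takes the symmetric Toda flow to the gradient flow *)
  /\ (forall (J : set R) (M : R -> 'M[R]_n), open J -> is_interval J ->
        (forall t, J t -> sym_with_eigenvalues lam (M t)) ->
        toda_curve J M ->
        forall k, (0 < k < n)%N ->
        exists x : R -> 'cV[R]_('C(n, k)), forall t, J t ->
          toda_point lam (M t) (x t) /\
          forall a, is_derive t (1 : R) (fun s => x s a 0)
                      (ksum lam a * x t a 0))
  (* after deletion of zeros and signs, Moser's map gives (M_(k))_T *)
  /\ (forall M, sym_with_eigenvalues lam M ->
        forall k, (0 < k < n)%N -> forall x, toda_point lam M x ->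
        is_moser_abs (@ksum R n lam k) x (tridiag (ext_mx M k)))
  (* (M_(k))_T evolves by the tridiagonal Toda lattice flow *)
  /\ (forall (J : set R) (M : R -> 'M[R]_n), open J -> is_interval J ->
        (forall t, J t -> sym_with_eigenvalues lam (M t)) ->
        toda_curve J M ->
        forall k, (0 < k < n)%N ->
        exists m (T : R -> 'M[R]_m),
          (forall t, J t -> tridiag (ext_mx (M t) k) = Sqmx (T t) /\
                            jacobi (T t)) /\
          toda_curve J T)
  (* the family of tridiagonal matrices determines the projective points up to
     the signs of their coordinates *)
  /\ (forall M M', sym_with_eigenvalues lam M -> sym_with_eigenvalues lam M' ->
        (forall k, (0 < k < n)%N ->
           tridiag (ext_mx M k) = tridiag (ext_mx M' k)) ->
        forall k, (0 < k < n)%N ->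
        forall x x' : 'cV[R]_('C(n, k)),
          toda_point lam M x -> toda_point lam M' x' ->
          exists2 c : R, 0 < c & forall a, `|x a 0| = c * `|x' a 0|).
Proof.
have lam_inj : injective lam.
  move=> i j lij; apply/val_inj; case: (ltngtP i j) => // /lam_decr.
    by rewrite lij ltxx.
  by rewrite lij ltxx.
have le_k k : (0 < k < n)%N -> (k <= n)%N by case/andP=> _ /ltnW.
split; [|split; [|split; [|split; [|split]]]].
- by move=> M symM k /le_k kn; apply: toda_proj_point.
- by move=> M M' symM symM'; apply: toda_point_inj.
- move=> J M oJ iJ symM dM k /le_k kn.
  case: (pselect (exists t0, J t0)) => [[t0 Jt0]|noJ]; last first.
    by exists (fun=> 0) => t Jt; case: noJ; exists t.
  have [Q fQ] := toda_frame_exists lam_inj (symM t0 Jt0).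
  exact: (toda_curve_gradient lam_inj oJ iJ dM Jt0 fQ kn).
- move=> M symM k kn x; apply: toda_point_moser symM; first exact: lam_inj.
    exact: le_k.
  exact: ksum_inj.
- move=> J M oJ iJ symM dM k kn.
  by apply: (tridiag_toda_curve lam_inj) symM dM; [exact: le_k|exact: ksum_inj| |].
- move=> M M' symM symM' TT k kn x x' Mx M'x'.
  have mu_inj := ksum_inj k kn; have kn' := le_k k kn.
  apply: (is_moser_abs_determines mu_inj) (toda_point_moser lam_inj kn' mu_inj symM Mx) _.
  rewrite TT //; exact: toda_point_moser.
Qed.
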